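(* Let $X$ be an (infinite-dimensional) Banach space with an unconditional basis. Then the following are equivalent: (1) $X$ is isomorphic to one of the spaces $\ell_1$, $\ell_2$ or $c_0$. (2) Whenever $(E_n)$ is a UFDD for $X$ and, for each $n$, $(f_{ni})_{i=1}^{\dim E_n}$ is an unconditional basis of $E_n$ with $\sup_n \mathrm{ubc}\,(f_{ni})_{i=1}^{\dim E_n}<\infty$, then the whole family $(f_{ni})_{n,i}$ is an unconditional basis for $X$.
   Context: A UFDD (unconditional finite-dimensional Schauder decomposition) of a Banach space $X$ is a sequence $(E_n)$ of finite-dimensional subspaces of $X$ such that every $x\in X$ has a unique expansion $x=\sum_n x_n$ with $x_n\in E_n$, and this series converges unconditionally. The unconditional basis constant $\mathrm{ubc}\,(f_i)$ of a basis $(f_i)$ is the least $K$ such that $\|\sum_i\epsilon_i a_i f_i\|\le K\|\sum_i a_if_i\|$ for all finitely nonzero scalars $(a_i)$ and all scalars $|\epsilon_i|=1$. Isomorphic means linearly homeomorphic. An unconditional basis of $X$ is an infinite sequence $(e_n)_{n=1}^\infty$. *)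

(* Defs.v *)
From HB Require Import structures.
From mathcomp Require Import all_boot all_order all_algebra.
From mathcomp Require Import all_classical all_reals all_analysis.
From mathcomp Require Import complex.

Set Implicit Arguments.
Unset Strict Implicit.
Unset Printing Implicit Defensive.

Import Order.TTheory GRing.Theory Num.Theory.
Import numFieldNormedType.Exports.

Local Open Scope classical_set_scope.
Local Open Scope ring_scope.

Variant scalar_kind := RealScalars | ComplexScalars.

Definition scalars (R : realType) (k : scalar_kind) : numFieldType :=
  match k with RealScalars => R | ComplexScalars => R[i] end.

(* The norm of a [normedModType K] takes its values in [K], so over [R[i]] the
   modulus is read off in [R] and the norms below are sent back to [R[i]]. *)
Definition modulus (R : realType) (k : scalar_kind) : scalars R k -> R :=
  match k with RealScalars => fun x => `|x| | ComplexScalars => fun z => ComplexField.Normc.normc z end.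

Definition of_real (R : realType) (k : scalar_kind) : R -> scalars R k :=
  match k with RealScalars => id | ComplexScalars => real_complex R end.

Section Scalars.
Context (R : realType) (k : scalar_kind).
Implicit Types x y : scalars R k.

Lemma of_realD (s t : R) : of_real k (s + t) = of_real k s + of_real k t.
Proof. by case: k => //=; rewrite rmorphD. Qed.

Lemma of_realM (s t : R) : of_real k (s * t) = of_real k s * of_real k t.
Proof. by case: k => //=; rewrite rmorphM. Qed.

Lemma of_real0 : of_real k (0 : R) = 0.
Proof. by case: k. Qed.

Lemma of_real_le (s t : R) : (of_real k s <= of_real k t) = (s <= t).
Proof. by case: k => //=; rewrite lecR. Qed.

Lemma of_real_inj : injective (@of_real R k).
Proof. by case: k => // s t []. Qed.

Lemma modulusE x : of_real k (modulus x) = `|x|.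
Proof. by case: k x. Qed.

Lemma modulus_ge0 x : 0 <= modulus x.
Proof. by rewrite -of_real_le modulusE of_real0. Qed.

Lemma modulusD x y : modulus (x + y) <= modulus x + modulus y.
Proof. by rewrite -of_real_le of_realD !modulusE ler_normD. Qed.

Lemma modulusM x y : modulus (x * y) = modulus x * modulus y.
Proof. by apply: of_real_inj; rewrite of_realM !modulusE normrM. Qed.

Lemma modulus_eq0 x : modulus x = 0 -> x = 0.
Proof. by move=> x0; apply/normr0_eq0; rewrite -modulusE x0 of_real0. Qed.

Lemma modulus0 : modulus (0 : scalars R k) = 0.
Proof. by apply: of_real_inj; rewrite modulusE normr0 of_real0. Qed.

End Scalars.

Definition c0_null (R : realType) (k : scalar_kind) : {pred nat -> scalars R k} :=
  fun a => `[< (fun n => modulus (a n)) @ \oo --> (0 : R) >].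

Section Lp.
Context (R : realType) (k : scalar_kind).
Local Notation K := (scalars R k).

Definition lpnorm (p : R) (a : nat -> K) : \bar R :=
  'N[counting]_p%:E[EFin \o (@modulus R k \o a)]%E.

(* The proof of [1 <= p] makes this a submodule. *)
Definition lp_finite (p : R) (p1 : 1 <= p) : {pred nat -> K} :=
  fun a => `[< (lpnorm p a < +oo)%E >].

Lemma lpnormE (p : R) (a : nat -> K) : 1 <= p ->
  (lpnorm p a = (\sum_(n <oo) (modulus (a n) `^ p)%:E) `^ p^-1)%E.
Proof.
move=> p1; rewrite /lpnorm Lnorm_counting ?(lt_le_trans ltr01)//.
congr (_ `^ _)%E; apply: eq_eseriesr => n _.
by rewrite abse_EFin ger0_norm ?modulus_ge0// poweR_EFin.
Qed.

Lemma lpnorm_ge0 (p : R) (a : nat -> K) : (0 <= lpnorm p a)%E.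
Proof. exact: Lnorm_ge0. Qed.

Lemma lpnormD (p : R) (a b : nat -> K) : 1 <= p ->
  (lpnorm p (a + b)%R <= lpnorm p a + lpnorm p b)%E.
Proof.
move=> p1.
have := @minkowski_EFin _ nat R counting (@modulus R k \o a) (@modulus R k \o b) p.
have mnat (g : nat -> R) : measurable_fun setT g by [].
move=> /(_ (mnat _) (mnat _) p1); apply: le_trans.
have p0 : 0 < p by rewrite (lt_le_trans ltr01).
rewrite /lpnorm !Lnorm_counting//.
  apply: gt0_ler_poweR; first by rewrite invr_ge0 ltW.
  - by rewrite in_itv/= leey andbT nneseries_ge0// => n _ _; exact: poweR_ge0.
  - by rewrite in_itv/= leey andbT nneseries_ge0// => n _ _; exact: poweR_ge0.
  apply: lee_nneseries => [n _ _|n _]; first exact: poweR_ge0.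
  have s0 : 0 <= modulus (a n) + modulus (b n) by rewrite addr_ge0// modulus_ge0.
  apply: gt0_ler_poweR; rewrite ?(ltW p0)// ?in_itv/= ?leey ?andbT ?lee_fin//.
  by rewrite !ger0_norm ?modulus_ge0// modulusD.
Qed.

Lemma lpnormZ (p : R) (c : K) (a : nat -> K) : 1 <= p ->
  (lpnorm p (c *: a)%R = (modulus c)%:E * lpnorm p a)%E.
Proof.
move=> p1; rewrite !lpnormE//.
under eq_eseriesr do rewrite modulusM powRM ?modulus_ge0// EFinM.
rewrite nneseriesZl; last by move=> n _; rewrite lee_fin powR_ge0.
rewrite poweRM ?lee_fin ?powR_ge0//; last first.
  by apply: nneseries_ge0 => n _ _; rewrite lee_fin powR_ge0.
have p0 : p != 0 by rewrite gt_eqF// (lt_le_trans ltr01).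
by rewrite poweR_EFin -powRrM divff// powRr1 ?modulus_ge0.
Qed.

Lemma lpnorm0 (p : R) : 1 <= p -> lpnorm p 0 = 0%E.
Proof.
move=> p1; have -> : (0 : nat -> K) = 0 *: 0 by rewrite scale0r.
by rewrite lpnormZ// modulus0 mul0e.
Qed.

Lemma lpnorm_eq0 (p : R) (a : nat -> K) : 1 <= p -> lpnorm p a = 0%E -> a = 0.
Proof.
move=> p1; rewrite lpnormE// => /poweR_eq0_eq0 s0; apply/funext => n.
have p0 : p != 0 by rewrite gt_eqF// (lt_le_trans ltr01).
have ge0 m : (0 <= (modulus (a m) `^ p)%:E)%E by rewrite lee_fin powR_ge0.
have /s0 {}s0 : (0 <= \sum_(n <oo) (modulus (a n) `^ p)%:E)%E.
  by apply: nneseries_ge0 => m _ _.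
have : ((modulus (a n) `^ p)%:E <= 0)%E.
  rewrite -s0; apply: le_trans (nneseries_lim_ge n.+1 _) => [|m _ _]; last exact: ge0.
  by rewrite big_nat_recr//= leeDr// sume_ge0.
rewrite lee_fin => le0.
have /eqP : modulus (a n) `^ p = 0 by apply/eqP; rewrite eq_le le0 powR_ge0.
by rewrite powR_eq0 p0 andbT => /eqP/modulus_eq0.
Qed.

End Lp.

Record lp (R : realType) (k : scalar_kind) (p : R) (p1 : 1 <= p) := Lp {
  lp_seq :> nat -> scalars R k;
  _ : lp_seq \in lp_finite p1 }.

Section LpNormed.
Context (R : realType) (k : scalar_kind) (p : R) (p1 : 1 <= p).
Local Notation K := (scalars R k).

HB.instance Definition _ := [isSub for @lp_seq R k p p1].
HB.instance Definition _ := [Choice of lp k p1 by <:].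

Lemma lp_finiteP (a : nat -> K) :
  reflect (lpnorm p a < +oo)%E (a \in lp_finite p1).
Proof. exact: asboolP. Qed.

Lemma lp_submod_closed : submod_closed (@lp_finite R k p p1).
Proof.
split=> [|c a b /lp_finiteP fa /lp_finiteP fb]; apply/lp_finiteP.
  by rewrite lpnorm0.
apply: le_lt_trans (lpnormD _ _ p1) _; rewrite lpnormZ// lte_add_pinfty//.
by rewrite lte_mul_pinfty ?lee_fin ?modulus_ge0.
Qed.

HB.instance Definition _ :=
  GRing.isSubmodClosed.Build K (nat -> K) (lp_finite p1) lp_submod_closed.
HB.instance Definition _ := [SubChoice_isSubLmodule of lp k p1 by <:].

Definition lp_norm (a : lp k p1) : K := of_real k (fine (lpnorm p a)).

Lemma lpnorm_fin_num (a : lp k p1) : lpnorm p a \is a fin_num.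
Proof.
rewrite fin_numElt (lt_le_trans ltNy0 (lpnorm_ge0 _ _))/=.
by apply/lp_finiteP; exact: (valP a).
Qed.

Lemma lp_normD (a b : lp k p1) : lp_norm (a + b) <= lp_norm a + lp_norm b.
Proof.
rewrite /lp_norm -of_realD of_real_le -fineD ?lpnorm_fin_num//.
by rewrite fine_le ?fin_numD ?lpnorm_fin_num//; exact: lpnormD.
Qed.

Lemma lp_normZ (c : K) (a : lp k p1) : lp_norm (c *: a) = `|c| * lp_norm a.
Proof.
rewrite /lp_norm -modulusE -of_realM; congr of_real.
by rewrite [lpnorm _ _]lpnormZ// fineM ?lpnorm_fin_num.
Qed.

Lemma lp_norm_eq0 (a : lp k p1) : lp_norm a = 0 -> a = 0.
Proof.
rewrite -(of_real0 R k) => /of_real_inj a0; apply: val_inj.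
apply: (lpnorm_eq0 p1); rewrite -[LHS]fineK ?lpnorm_fin_num//.
by rewrite [fine _]a0.
Qed.

HB.instance Definition _ :=
  Lmodule_isNormed.Build K (lp k p1) lp_normD lp_normZ lp_norm_eq0.

End LpNormed.

Record c0 (R : realType) (k : scalar_kind) := C0 {
  c0_seq :> nat -> scalars R k;
  _ : c0_seq \in @c0_null R k }.

Section C0Normed.
Context (R : realType) (k : scalar_kind).
Local Notation K := (scalars R k).

HB.instance Definition _ := [isSub for @c0_seq R k].
HB.instance Definition _ := [Choice of c0 R k by <:].

Lemma c0_nullP (a : nat -> K) :
  reflect ((fun n => modulus (a n)) @ \oo --> (0 : R)) (a \in @c0_null R k).
Proof. exact: asboolP. Qed.

Lemma c0_submod_closed : submod_closed (@c0_null R k).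
Proof.
split=> [|c a b /c0_nullP a0 /c0_nullP b0]; apply/c0_nullP.
  by under eq_fun do rewrite modulus0; exact: cvg_cst.
apply: (@squeeze_cvgr _ _ _ _ (cst 0)
  (fun n => modulus c * modulus (a n) + modulus (b n))).
- near=> n; rewrite modulus_ge0/= (le_trans (modulusD _ _))//.
  by rewrite modulusM.
- exact: cvg_cst.
- rewrite -[X in _ --> X]addr0 -[X in _ --> X + _](mulr0 (modulus c)).
  by apply: cvgD => //; apply: cvgMr.
Unshelve. all: by end_near. Qed.

HB.instance Definition _ :=
  GRing.isSubmodClosed.Build K (nat -> K) (@c0_null R k) c0_submod_closed.
HB.instance Definition _ := [SubChoice_isSubLmodule of c0 R k by <:].

Definition c0_norm (a : c0 R k) : K :=
  of_real k (sup (range (fun n => modulus (a n)))).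

Lemma c0_has_sup (a : c0 R k) : has_sup (range (fun n => modulus (a n))).
Proof.
split; first by exists (modulus (a 0%N)); exists 0%N.
have /c0_nullP a0 : (a : nat -> K) \in @c0_null R k by exact: (valP a).
have [M [_ /(_ (M + 1))]] := cvg_seq_bounded (cvgP _ a0).
rewrite ltrDl ltr01 => /(_ isT) aM; exists (M + 1) => _ [n _ <-].
by have /= := aM n I; rewrite ger0_norm// modulus_ge0.
Qed.

Lemma c0_norm_ub (a : c0 R k) n :
  modulus (a n) <= sup (range (fun n => modulus (a n))).
Proof. by apply: ub_le_sup; [have [] := c0_has_sup a | exists n]. Qed.

Lemma c0_normD (a b : c0 R k) : c0_norm (a + b) <= c0_norm a + c0_norm b.
Proof.
rewrite -of_realD of_real_le; apply: ge_sup; first by have [] := c0_has_sup (a + b).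
move=> _ [n _ <-]; apply: le_trans (modulusD _ _) _.
by apply: lerD; exact: c0_norm_ub.
Qed.

Lemma c0_normZ (c : K) (a : c0 R k) : c0_norm (c *: a) = `|c| * c0_norm a.
Proof.
rewrite /c0_norm -modulusE -of_realM; congr of_real.
apply/le_anti/andP; split.
  apply: ge_sup; first by have [] := c0_has_sup (c *: a).
  move=> _ [n _ <-]; rewrite [modulus _]modulusM.
  by rewrite ler_wpM2l ?modulus_ge0// c0_norm_ub.
have [c0|c0] := eqVneq c 0.
  rewrite c0 modulus0 mul0r; apply: le_trans (c0_norm_ub (0 *: a) 0%N).
  exact: modulus_ge0.
have mc0 : 0 < modulus c.
  by rewrite lt_neqAle modulus_ge0 andbT eq_sym; apply: contra_neq c0 => /modulus_eq0.
rewrite -ler_pdivlMl//; apply: ge_sup; first by have [] := c0_has_sup a.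
move=> _ [n _ <-]; rewrite ler_pdivlMl// -modulusM.
exact: (c0_norm_ub (c *: a) n).
Qed.

Lemma c0_norm_eq0 (a : c0 R k) : c0_norm a = 0 -> a = 0.
Proof.
rewrite -(of_real0 R k) => /of_real_inj a0; apply: val_inj; apply/funext => n.
apply: modulus_eq0; apply/le_anti; rewrite modulus_ge0 andbT.
by rewrite -a0 c0_norm_ub.
Qed.

HB.instance Definition _ :=
  Lmodule_isNormed.Build K (c0 R k) c0_normD c0_normZ c0_norm_eq0.

End C0Normed.

Definition ell1 (R : realType) (k : scalar_kind) : normedModType (scalars R k) :=
  lp k (lexx (1 : R)).

Definition ell2 (R : realType) (k : scalar_kind) : normedModType (scalars R k) :=
  lp k (ler1n R 2).

Section Banach.
Context (K : numFieldType).
Implicit Types X Y : normedModType K.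

Definition isomorphic X Y :=
  exists (T : {linear X -> Y}) (S : Y -> X),
    [/\ cancel T S, cancel S T, continuous T & continuous S].

Definition unconditionally_convergent X (x : nat -> X) :=
  forall s : nat -> nat, bijective s -> cvgn (series (x \o s)).

Definition unconditional_basis X (e : nat -> X) :=
  forall x : X,
    (exists! a : nat -> K, series (fun n => a n *: e n) @ \oo --> x) /\
    forall a : nat -> K, series (fun n => a n *: e n) @ \oo --> x ->
      unconditionally_convergent (fun n => a n *: e n).

(* Unconditional bases do not depend on the order, so a family with a countable
   index set is one when it is one along an enumeration of the index set. *)
Definition unconditional_basis_family X (I : Type) (f : I -> X) :=
  exists s : nat -> I, bijective s /\ unconditional_basis (f \o s).

(* Expansions are finite sums here, so unconditionality only enters through
   the constant [is_ubc]. *)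
Definition finite_basis X (E : set X) (d : nat) (f : 'I_d -> X) :=
  (forall a : 'I_d -> K, E (\sum_i a i *: f i)) /\
  forall x, E x -> exists! a : 'I_d -> K, x = \sum_i a i *: f i.

Definition finite_dimensional X (E : set X) :=
  exists (d : nat) (f : 'I_d -> X), finite_basis E f.

Definition UFDD X (E : nat -> set X) :=
  (forall n, finite_dimensional (E n)) /\
  forall x : X,
    (exists! y : nat -> X, (forall n, E n (y n)) /\ series y @ \oo --> x) /\
    forall y : nat -> X, (forall n, E n (y n)) -> series y @ \oo --> x ->
      unconditionally_convergent y.

(* [0 <= C] is implied by the inequality unless the family is empty. *)
Definition ubc_bounds X (d : nat) (f : 'I_d -> X) : set K :=
  [set C | 0 <= C /\
    forall a eps : 'I_d -> K, (forall i, `|eps i| = 1) ->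
      `|\sum_i (eps i * a i) *: f i| <= C * `|\sum_i a i *: f i|].

Definition is_ubc X (d : nat) (f : 'I_d -> X) (C : K) :=
  ubc_bounds f C /\ lbound (ubc_bounds f) C.

End Banach.

(* Main.v *)
Require Import Defs.
From HB Require Import structures.
From mathcomp Require Import all_boot all_order all_algebra.
From mathcomp Require Import all_classical all_reals all_analysis.
From mathcomp Require Import complex.
From mathcomp Require Import ring lra zify.

(** Suppose first that [X] is isomorphic to [ell1], [ell2] or [c0]. The point is that every
    decomposition of [X] is then dominated ([dominated]): up to a constant, the norm of a finite
    sum of vectors taken from the blocks grows with the norms of its terms. Unconditionality
    inside the blocks, with a uniform constant, then passes to the whole family
    ([dominated_family]). In [ell2], domination follows from averaging over all changes of signs
    of the terms ([avg_sqr_le], [avg_sqr_ge]). In [ell1], the Khintchine inequality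
    [khintchine_L1], applied to the entries of the matrices of the projections, bounds the sums
    over each column of their square functions, and the Cauchy-Schwarz inequality shows that the
    norm of a sum is comparable with the sum of the norms ([summable_family]). In [c0] the same
    argument on rows gives comparability with the supremum of the norms ([supremum_family]).

    Conversely, suppose that [X] has the stability property, and let [e] be a normalized
    unconditional basis. Grouping [e] into finite blocks shows that unconditionality survives
    every uniformly bounded change of basis inside disjoint blocks ([stable_blocks]). Swapping
    one basis vector of each block with a block vector, one finds that the associated rank-one
    projections are jointly bounded ([rank_one_bounded]), and a gliding hump makes the bound
    uniform ([blocks_le_uniform]). Applied to sums of two vectors, this makes all sequences of
    distinct basis vectors equivalent ([symmetric_basis]), as well as all sequences of disjoint
    normalized blocks with constant coefficients ([constant_blocks]). Hence the norm of a sum of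
    [n] basis vectors is multiplicative in [n] up to constants, so it grows like a power of
    exponent [al] between 0 and 1 ([power_law], [perfectly_homogeneous_power]), and, as in the
    theorem of Zippin, [e] is equivalent to the unit vectors of [c0] if [al = 0], and to those
    of the space of exponent [p = 1 / al] otherwise ([sum_power_c0_like], [sum_power_lp_like]).

    It remains to exclude the exponents [p] other than 1 and 2. For [p > 1], the Rademacher
    functions on a cube span a uniformly complemented, uniformly Euclidean subspace of the
    functions on the cube with the [p]-norm. Infinitely many copies of each cube are available,
    so these complemented parts can be shifted from each copy to the next, as in the
    decomposition method of Pelczynski. The vacated place is filled with the Rademacher vectors,
    and the result is an unconditional basis of the same space ([new_vec], [new_vec_unc]) which
    contains, uniformly, long bases of Euclidean spaces next to long parts of the original basis.
    Since the sums of its normalized vectors must also grow like a single power, [1 / 2 = 1 / p]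
    ([stable_exponent]). *)

Set Implicit Arguments.
Unset Strict Implicit.
Unset Printing Implicit Defensive.

Import Order.TTheory GRing.Theory Num.Theory.
Import numFieldNormedType.Exports.

Local Open Scope classical_set_scope.
Local Open Scope ring_scope.

(** * Real and complex scalars *)

Section ScalarFacts.
Context (R : realType) (k : scalar_kind).
Local Notation K := (scalars R k).
Local Notation "t %:K" := (@of_real R k t) (at level 2, format "t %:K").
Implicit Types (x y : K) (s t : R).

Lemma of_real1 : 1%:K = 1.
Proof. by case: k. Qed.

Lemma of_realN t : (- t)%:K = - t%:K.
Proof. by case: k => //=; rewrite rmorphN. Qed.

Lemma of_realB s t : (s - t)%:K = s%:K - t%:K.
Proof. by rewrite of_realD of_realN. Qed.

Lemma of_real_lt s t : (s%:K < t%:K) = (s < t).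
Proof. by rewrite !lt_neqAle of_real_le (inj_eq (@of_real_inj R k)). Qed.

Lemma of_real_eq0 t : (t%:K == 0) = (t == 0).
Proof. by rewrite -(of_real0 R k) (inj_eq (@of_real_inj R k)). Qed.

Lemma of_realV t : (t^-1)%:K = (t%:K)^-1.
Proof.
have [->|t0] := eqVneq t 0; first by rewrite invr0 of_real0 invr0.
have tK : t%:K != 0 by rewrite of_real_eq0.
by apply: (mulfI tK); rewrite -of_realM !mulfV// of_real1.
Qed.

Lemma modulus_of_real t : modulus t%:K = `|t|.
Proof.
case: k => //=; rewrite /ComplexField.Normc.normc /=.
by rewrite expr0n/= addr0 sqrtr_sqr.
Qed.

Lemma modulusN x : modulus (- x) = modulus x.
Proof. by apply: (@of_real_inj R k); rewrite !modulusE normrN. Qed.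

Lemma modulus1 : modulus (1 : K) = 1.
Proof. by rewrite -of_real1 modulus_of_real normr1. Qed.

Lemma modulusV x : modulus x^-1 = (modulus x)^-1.
Proof. by apply: (@of_real_inj R k); rewrite modulusE normfV -modulusE of_realV. Qed.

Lemma modulus_sum I (s : seq I) (P : pred I) (F : I -> K) :
  modulus (\sum_(i <- s | P i) F i) <= \sum_(i <- s | P i) modulus (F i).
Proof.
elim/big_rec2 : _ => [|i u v _ uv]; first by rewrite modulus0.
by rewrite (le_trans (modulusD _ _))// lerD2l.
Qed.

(** The only Euclidean feature of the scalar field that the averaging arguments need. *)
Lemma modulus_parallelogram x y :
  modulus (x + y) ^+ 2 + modulus (x - y) ^+ 2 = 2 * (modulus x ^+ 2 + modulus y ^+ 2).
Proof.
case: k x y => /= [x y|[a b] [c d]]; first by rewrite !real_normK ?num_real//; ring.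
rewrite /ComplexField.Normc.normc /= !sqr_sqrtr ?addr_ge0 ?sqr_ge0//; ring.
Qed.

Lemma of_real_modulus_sign x : exists2 z, modulus z = 1 & x = (modulus x)%:K * z.
Proof.
have [->|x0] := eqVneq x 0.
  by exists 1; rewrite ?modulus1// modulus0 of_real0 mul0r.
have mx0 : modulus x != 0 by apply: contra x0 => /eqP/modulus_eq0 ->.
exists ((modulus x)^-1%:K * x).
  by rewrite modulusM modulus_of_real ger0_norm ?invr_ge0 ?modulus_ge0// mulVf.
by rewrite mulrA -of_realM mulfV// of_real1 mul1r.
Qed.

(** Reduces multipliers in the unit disc to multipliers in [[0, 1]]. *)
Lemma scalar_decomposition : exists2 z : K, modulus z <= 1 &
  forall x, modulus x <= 1 -> exists t : 'I_4 -> R, (forall i, 0 <= t i <= 1) /\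
   x = (t 0)%:K - (t 1)%:K + z * ((t 2)%:K - (t 3)%:K).
Proof.
have pn s : `|s| <= 1 -> exists t1 t2 : R, [/\ 0 <= t1 <= 1, 0 <= t2 <= 1 & s = t1 - t2].
  move=> s1; have [s0|s0] := leP 0 s.
    exists s, 0; rewrite lexx ler01 s0 subr0; split => //.
    by move: s1; rewrite ger0_norm.
  exists 0, (- s); rewrite lexx ler01 opprK add0r; split => //.
  by move: s1; rewrite ltr0_norm// => ->; rewrite oppr_ge0 ltW.
case: k => /=.
  exists 0 => [|x /pn[t1 [t2 [h1 h2 ->]]]]; first by rewrite normr0 ler01.
  exists (fun i => nth 0 [:: t1; t2; 0; 0] i); split => /=.
    by case=> -[|[|[|[|//]]]] ? /=; rewrite ?lexx ?ler01.
  by rewrite mul0r addr0.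
exists 'i%C => [|[a b] /= ab1]; first by rewrite /= expr0n/= add0r expr1n sqrtr1.
have ab2 : a ^+ 2 + b ^+ 2 <= 1.
  by move: ab1; rewrite -[leRHS]sqrtr1 ler_sqrt// ltr01.
have sq1 (s : R) : s ^+ 2 <= 1 -> `|s| <= 1.
  by move=> s1; rewrite -sqrtr_sqr -[leRHS]sqrtr1 ler_sqrt// ltr01.
have /pn[t1 [t2 [h1 h2 ->]]] : `|a| <= 1 by apply/sq1/(le_trans _ ab2); rewrite lerDl sqr_ge0.
have /pn[t3 [t4 [h3 h4 ->]]] : `|b| <= 1 by apply/sq1/(le_trans _ ab2); rewrite lerDr sqr_ge0.
exists (fun i => nth 0 [:: t1; t2; t3; t4] i); split => /=.
  by case=> -[|[|[|[|//]]]] ? /=.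
by apply/eqP; rewrite eq_complex /=; apply/andP; split; apply/eqP; ring.
Qed.

Definition scalar_tends (a : nat -> K) (b : K) :=
  forall e : R, 0 < e -> exists N, forall n, (N <= n)%N -> modulus (a n - b) <= e.

Lemma scalar_complete (a : nat -> K) :
  (forall e : R, 0 < e -> exists N, forall m n, (N <= m)%N -> (N <= n)%N ->
     modulus (a m - a n) <= e) ->
  exists b, scalar_tends a b.
Proof.
have real_complete (u : nat -> R) :
    (forall e : R, 0 < e -> exists N, forall m n, (N <= m)%N -> (N <= n)%N ->
     `|u m - u n| <= e) ->
    exists b, forall e : R, 0 < e -> exists N, forall n, (N <= n)%N -> `|u n - b| <= e.
  move=> cu; have /cauchy_cvgP : cauchy (u @ \oo).
    apply/cauchyP => e e0; have [N hN] := cu (e / 2) (divr_gt0 e0 (ltr0n _ 2)).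
    exists (u N); exists N => // n /= Nn; rewrite /ball /= (le_lt_trans (hN _ _ _ _))//.
    by rewrite ltr_pdivrMr// ltr_pMr// ltr1n.
  move=> /cvg_ex[b /cvgrPdistC_le ub]; exists b => e e0.
  by have [N _ hN] := ub e e0; exists N => n Nn; exact: hN.
rewrite /scalar_tends; case: k a => /= [a /real_complete//|a ca].
have re_le (z : R[i]) : `|complex.Re z| <= ComplexField.Normc.normc z.
  case: z => x y /=; rewrite -sqrtr_sqr ler_wsqrtr// lerDl sqr_ge0//.
have im_le (z : R[i]) : `|complex.Im z| <= ComplexField.Normc.normc z.
  case: z => x y /=; rewrite -sqrtr_sqr ler_wsqrtr// lerDr sqr_ge0//.
have reB (z w : R[i]) : complex.Re (z - w) = complex.Re z - complex.Re w.
  by case: z w => ? ? [].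
have imB (z w : R[i]) : complex.Im (z - w) = complex.Im z - complex.Im w.
  by case: z w => ? ? [].
have [|r hr] := real_complete (fun n => complex.Re (a n)).
  move=> e /ca[N hN]; exists N => m n Nm Nn; rewrite -reB.
  by apply: le_trans (re_le _) _; exact: hN.
have [|i hi] := real_complete (fun n => complex.Im (a n)).
  move=> e /ca[N hN]; exists N => m n Nm Nn; rewrite -imB.
  by apply: le_trans (im_le _) _; exact: hN.
exists (Complex r i) => e e0.
have e20 : 0 < e / 2 by rewrite divr_gt0.
have [N1 h1] := hr _ e20; have [N2 h2] := hi _ e20.
exists (maxn N1 N2) => n; rewrite geq_max => /andP[/h1 + /h2].
case: (a n) => x y /= hx hy.
have -> : e = Num.sqrt (e ^+ 2) by rewrite sqrtr_sqr gtr0_norm.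
apply: ler_wsqrtr.
rewrite -[(x - r) ^+ 2]real_normK ?num_real// -[(y - i) ^+ 2]real_normK ?num_real//.
have : `|x - r| ^+ 2 <= (e / 2) ^+ 2 by rewrite lerXn2r ?nnegrE ?normr_ge0 ?(ltW e20).
have : `|y - i| ^+ 2 <= (e / 2) ^+ 2 by rewrite lerXn2r ?nnegrE ?normr_ge0 ?(ltW e20).
have : 0 <= e ^+ 2 by exact: sqr_ge0.
lra.
Qed.

End ScalarFacts.

(** * Norms, limits and finite-dimensional subspaces *)

Section RealNorm.
Context (R : realType) (k : scalar_kind).
Local Notation K := (scalars R k).
Local Notation "t %:K" := (@of_real R k t) (at level 2, format "t %:K").

Section Normed.
Context (X : normedModType K).
Implicit Types (x y : X) (a b : K).

(** The norm of [X] read in [R]: all estimates are made there. *)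
Definition nrm x : R := modulus (`|x| : K).

Lemma nrmE x : (nrm x)%:K = `|x|.
Proof. by rewrite modulusE normr_id. Qed.

Lemma nrm_ge0 x : 0 <= nrm x. Proof. exact: modulus_ge0. Qed.

Lemma nrm0 : nrm 0 = 0. Proof. by rewrite /nrm normr0 modulus0. Qed.

Lemma nrm_eq0 x : nrm x = 0 -> x = 0.
Proof. by move=> x0; apply/normr0_eq0; rewrite -nrmE x0 of_real0. Qed.

Lemma nrm_gt0 x : (0 < nrm x) = (x != 0).
Proof.
rewrite lt_neqAle nrm_ge0 andbT eq_sym; apply/idP/idP; apply: contra => /eqP.
  by move->; rewrite nrm0.
by move/nrm_eq0 ->.
Qed.

Lemma nrmZ a x : nrm (a *: x) = modulus a * nrm x.
Proof. by apply: (@of_real_inj R k); rewrite nrmE normrZ of_realM nrmE modulusE. Qed.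

Lemma nrmZr (t : R) x : nrm (t%:K *: x) = `|t| * nrm x.
Proof. by rewrite nrmZ modulus_of_real. Qed.

Lemma nrmD x y : nrm (x + y) <= nrm x + nrm y.
Proof. by rewrite -(of_real_le k) of_realD !nrmE ler_normD. Qed.

Lemma nrmN x : nrm (- x) = nrm x.
Proof. by rewrite /nrm normrN. Qed.

Lemma nrmBC x y : nrm (x - y) = nrm (y - x).
Proof. by rewrite -nrmN opprB. Qed.

Lemma nrmB x y : nrm (x - y) <= nrm x + nrm y.
Proof. by rewrite -(nrmN y) nrmD. Qed.

Lemma nrm_triangle y x z : nrm (x - z) <= nrm (x - y) + nrm (y - z).
Proof. by rewrite (le_trans _ (nrmD _ _))// addrA subrK. Qed.

Lemma nrm_sum I (s : seq I) (P : pred I) (F : I -> X) :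
  nrm (\sum_(i <- s | P i) F i) <= \sum_(i <- s | P i) nrm (F i).
Proof.
elim/big_rec2 : _ => [|i u v _ uv]; first by rewrite nrm0.
by rewrite (le_trans (nrmD _ _))// lerD2l.
Qed.

Lemma nrm_le_split x y : nrm x <= nrm (x - y) + nrm y.
Proof. by rewrite (le_trans _ (nrmD _ _))// subrK. Qed.

Definition tends (u : nat -> X) x :=
  forall e : R, 0 < e -> exists N, forall n, (N <= n)%N -> nrm (u n - x) <= e.

Lemma tendsP (u : nat -> X) x : (u @ \oo --> x) <-> tends u x.
Proof.
split=> [/cvgrPdistC_le ux e e0|ux].
  have eK : 0 < e%:K by rewrite -(of_real0 R k) of_real_lt.
  have [N _ hN] := ux _ eK; exists N => n Nn.
  by have /= := hN n Nn; rewrite -nrmE of_real_le.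
apply/cvgrPdistC_le => e e0.
have em : e = (modulus e)%:K by rewrite modulusE gtr0_norm.
have [|N hN] := ux (modulus e); first by rewrite -(of_real_lt k) -em of_real0.
by exists N => // n /= Nn; rewrite em -nrmE of_real_le hN.
Qed.

Lemma tends_cst x : tends (fun=> x) x.
Proof. by move=> e e0; exists 0%N => n _; rewrite subrr nrm0 ltW. Qed.

Lemma tends_unique u x y : tends u x -> tends u y -> x = y.
Proof.
move=> ux uy; apply/eqP; rewrite -subr_eq0; apply/eqP/nrm_eq0/le_anti.
rewrite nrm_ge0 andbT; apply/ler_addgt0Pl => e e0; rewrite addr0.
have e2 : 0 < e / 2 by rewrite divr_gt0.
have [N hN] := ux _ e2; have [M hM] := uy _ e2.
have := hN _ (leq_maxl N M); have := hM _ (leq_maxr N M); set n := maxn N M => h1 h2.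
by rewrite (le_trans (nrm_triangle (u n) _ _))// nrmBC (splitr e) lerD.
Qed.

Lemma tendsD u v x y : tends u x -> tends v y -> tends (fun n => u n + v n) (x + y).
Proof.
move=> ux vy e e0; have e2 : 0 < e / 2 by rewrite divr_gt0.
have [N hN] := ux _ e2; have [M hM] := vy _ e2; exists (maxn N M) => n.
rewrite geq_max => /andP[/hN h1 /hM h2].
by rewrite opprD addrACA (le_trans (nrmD _ _))// (splitr e) lerD.
Qed.

Lemma tendsZ a u x : tends u x -> tends (fun n => a *: u n) (a *: x).
Proof.
move=> ux e e0; have d0 : 0 < modulus a + 1 by rewrite ltr_wpDl ?modulus_ge0.
have [N hN] := ux _ (divr_gt0 e0 d0); exists N => n /hN h.
rewrite -scalerBr nrmZ; move: h; rewrite ler_pdivlMr// mulrC => h.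
by rewrite (le_trans _ h)// ler_wpM2r ?nrm_ge0// lerDl.
Qed.

Lemma tendsB u v x y : tends u x -> tends v y -> tends (fun n => u n - v n) (x - y).
Proof.
move=> ux /(tendsZ (-1)); rewrite scaleN1r => vy.
by have := tendsD ux vy; under [X in tends X]eq_fun do rewrite scaleN1r.
Qed.

Lemma tends_sum I (s : seq I) (u : I -> nat -> X) (x : I -> X) :
  (forall i, tends (u i) (x i)) ->
  tends (fun n => \sum_(i <- s) u i n) (\sum_(i <- s) x i).
Proof.
move=> ux; elim: s => [|i s ih].
  by rewrite big_nil; under [X in tends X]eq_fun do rewrite big_nil; exact: tends_cst.
rewrite big_cons; under [X in tends X]eq_fun do rewrite big_cons.
exact: tendsD.
Qed.

Lemma tends_nrm_le u x (B : R) N :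
  tends u x -> (forall n, (N <= n)%N -> nrm (u n) <= B) -> nrm x <= B.
Proof.
move=> ux uB; apply/ler_addgt0Pl => e e0; have [M hM] := ux _ e0.
have := hM _ (leq_maxl M N); have := uB _ (leq_maxr M N).
set n := maxn _ _ => h1 h2; apply: le_trans (nrm_le_split x (u n)) _.
by rewrite nrmBC lerD.
Qed.

Definition cauchy_nrm (u : nat -> X) := forall e : R, 0 < e ->
  exists N, forall m n, (N <= m)%N -> (N <= n)%N -> nrm (u m - u n) <= e.

Lemma tends_cauchy u x : tends u x -> cauchy_nrm u.
Proof.
move=> ux e e0; have e2 : 0 < e / 2 by rewrite divr_gt0.
have [N hN] := ux _ e2; exists N => m n /hN h1 /hN h2.
by rewrite (le_trans (nrm_triangle x _ _))// (splitr e) lerD// nrmBC.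
Qed.

End Normed.

Lemma tends_complete (X : completeNormedModType K) (u : nat -> X) :
  cauchy_nrm u -> exists x, tends u x.
Proof.
move=> cu; suff /cauchy_cvgP/cvg_ex[x /tendsP] : cauchy (u @ \oo) by exists x.
apply/cauchyP => e e0; have em : e = (modulus e)%:K by rewrite modulusE gtr0_norm.
have m0 : 0 < modulus e by rewrite -(of_real_lt k) -em of_real0.
have [N hN] := cu (modulus e / 2) (divr_gt0 m0 (ltr0n _ 2)).
exists (u N); exists N => // n /= Nn; rewrite -ball_normE /ball_/= -nrmE em of_real_lt.
by rewrite (le_lt_trans (hN _ _ _ _))// ltr_pdivrMr// ltr_pMr// ltr1n.
Qed.

Section FiniteDim.
Context (X : completeNormedModType K).

Definition closed_subspace (E : set X) :=
  [/\ E 0, forall x y, E x -> E y -> E (x + y), forall (a : K) x, E x -> E (a *: x) &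
      forall u x, (forall n, E (u n)) -> tends u x -> E x].

(** Each new vector has positive distance to the span of the previous ones,
    because that span, having coordinates, is already known to be closed. *)
Lemma coordinates_bounded d (f : 'I_d -> X) :
  (forall a : 'I_d -> K, \sum_i a i *: f i = 0 -> forall i, a i = 0) ->
  exists2 C : R, 0 <= C & forall a : 'I_d -> K,
    \sum_i modulus (a i) <= C * nrm (\sum_i a i *: f i).
Proof.
elim: d f => [|d ih] f f_free.
  by exists 0 => // a; rewrite !big_ord0 mul0r.
pose f' i := f (widen_ord (leqnSn d) i).
have [a a0 i|C C0 hC] := ih f'.
  pose b (j : 'I_d.+1) := if unlift ord_max j is Some i then a i else 0.
  have bw j : b (widen_ord (leqnSn d) j) = a j.
    have -> : widen_ord (leqnSn d) j = lift ord_max j.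
      by apply: val_inj; rewrite /= /bump leqNgt ltn_ord.
    by rewrite /b liftK.
  rewrite -bw; apply: f_free; rewrite big_ord_recr /= {2}/b unlift_none scale0r addr0.
  by rewrite -[RHS]a0; apply: eq_bigr => j _; rewrite bw.
have [D D0 hD] : exists2 D : R, 0 <= D & forall a : 'I_d -> K,
    1 <= D * nrm (f ord_max + \sum_i a i *: f' i).
  apply: contrapT => noD.
  have approx (n : nat) : exists a : 'I_d -> K,
      nrm (f ord_max + \sum_i a i *: f' i) <= n.+1%:R^-1.
    apply: contrapT => /forallNP na; apply: noD; exists n.+1%:R => // a.
    have /negP := na a; rewrite -ltNge => /ltW h.
    by rewrite -[leLHS](mulfV (_ : n.+1%:R != 0 :> R))// ler_wpM2l.
  have [a ha] := choice approx.
  have small (e : R) : 0 < e -> exists N, forall n, (N <= n)%N -> n.+1%:R^-1 <= e.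
    move=> e0; have [N hN] : exists N : nat, e^-1 <= N%:R.
      exists (Num.bound e^-1); have := archi_boundP (ltW (_ : 0 < e^-1)).
      by rewrite invr_gt0 => /(_ e0)/ltW.
    exists N => n Nn; rewrite -[e]invrK lef_pV2 ?posrE ?invr_gt0//.
    by rewrite (le_trans hN)// ler_nat ltnW.
  have cauchy_a i : exists b, scalar_tends (fun n => a n i) b.
    apply: scalar_complete => e e0.
    have C1 : 0 < C + 1 by rewrite ltr_wpDl.
    have [N hN] := small (e / (C + 1) / 2) (divr_gt0 (divr_gt0 e0 C1) (ltr0n _ 2)).
    exists N => m n Nm Nn; apply: (@le_trans _ _ (\sum_i modulus (a m i - a n i))).
      by rewrite (bigD1 i)//= lerDl sumr_ge0// => j _; exact: modulus_ge0.
    apply: le_trans (hC _) _.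
    have -> : \sum_i0 (a m i0 - a n i0) *: f' i0 =
      (f ord_max + \sum_i a m i *: f' i) - (f ord_max + \sum_i a n i *: f' i).
      rewrite opprD addrACA subrr add0r -sumrB.
      by apply: eq_bigr => j _; rewrite scalerBl.
    apply: le_trans (_ : (C + 1) * (e / (C + 1)) <= _); last first.
      by rewrite mulrC divfK// gt_eqF.
    apply: ler_pM; rewrite ?nrm_ge0 ?lerDl//.
    rewrite (le_trans (nrmB _ _))// [leRHS]splitr.
    by apply: lerD; apply: le_trans (ha _) _; apply: hN.
  have [b hb] := choice cauchy_a.
  suff : f ord_max + \sum_i b i *: f' i = 0.
    pose c (j : 'I_d.+1) := if unlift ord_max j is Some i then b i else 1.
    move=> fb0; suff : c ord_max = 0.
      by rewrite /c unlift_none => /eqP; rewrite oner_eq0.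
    apply: f_free; rewrite big_ord_recr /= {2}/c unlift_none scale1r addrC -[RHS]fb0.
    congr (_ + _); apply: eq_bigr => j _; rewrite /c /f'.
    have -> : widen_ord (leqnSn d) j = lift ord_max j.
      by apply: val_inj; rewrite /= /bump leqNgt ltn_ord.
    by rewrite liftK.
  apply: (@tends_unique _ (fun n => f ord_max + \sum_i a n i *: f' i)).
    apply: tendsD; first exact: tends_cst.
    apply: tends_sum => i e e0.
    have d0 : 0 < nrm (f' i) + 1 by rewrite ltr_wpDl ?nrm_ge0.
    have [N hN] := hb i _ (divr_gt0 e0 d0); exists N => n /hN h.
    rewrite -scalerBl nrmZ; move: h; rewrite ler_pdivlMr// => h.
    by rewrite (le_trans _ h)// ler_wpM2l ?modulus_ge0// lerDl.
  move=> e e0; have [N hN] := small e e0; exists N => n Nn; rewrite subr0.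
  exact: le_trans (ha n) (hN n Nn).
exists (D + C * (1 + D * nrm (f ord_max))).
  by rewrite addr_ge0// mulr_ge0// addr_ge0// mulr_ge0// nrm_ge0.
move=> a; rewrite big_ord_recr [in leRHS]big_ord_recr /=.
set y := (X in nrm (X + _)); set t := a ord_max; set v := f ord_max.
have ht : modulus t <= D * nrm (y + t *: v).
  have [t0|t0] := eqVneq t 0; first by rewrite t0 modulus0 mulr_ge0// nrm_ge0.
  have -> : y + t *: v = t *: (v + \sum_i (t^-1 * a (widen_ord (leqnSn d) i)) *: f' i).
    rewrite addrC scalerDr; congr (_ + _); rewrite scaler_sumr.
    by apply: eq_bigr => i _; rewrite scalerA mulrA mulfV// mul1r.
  rewrite nrmZ mulrCA -[leLHS]mulr1 ler_wpM2l ?modulus_ge0//.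
rewrite mulrDl addrC lerD// -mulrA; apply: le_trans (hC _) _.
rewrite -/y ler_wpM2l//; apply: le_trans (nrm_le_split y (- (t *: v))) _.
rewrite opprK nrmN nrmZ mulrDl mul1r lerD2l mulrAC.
by rewrite ler_wpM2r ?nrm_ge0.
Qed.

Lemma finite_dimensional_closed (E : set X) : finite_dimensional E -> closed_subspace E.
Proof.
move=> [d [f [Ef Efu]]].
have f_free (a : 'I_d -> K) : \sum_i a i *: f i = 0 -> forall i, a i = 0.
  move=> a0; have E0 : E 0 by rewrite -a0; exact: Ef.
  have [c [_ hc]] := Efu 0 E0.
  have ca : c = a by apply: hc; rewrite a0.
  have c0 : c = fun=> 0.
    by apply: hc; rewrite big1// => i _; rewrite scale0r.
  by move=> i; rewrite -ca c0.
have [C C0 hC] := coordinates_bounded f_free.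
split=> [|x y /Efu[a [-> _]] /Efu[b [-> _]]|a x /Efu[b [-> _]]|u x Eu ux].
- by have := Ef (fun=> 0); under eq_bigr do rewrite scale0r; rewrite big1.
- rewrite -big_split /=; under eq_bigr do rewrite -scalerDl; exact: Ef.
- by rewrite scaler_sumr; under eq_bigr do rewrite scalerA; exact: Ef.
have [a ha] : exists a : nat -> 'I_d -> K, forall n, u n = \sum_i a n i *: f i.
  have ex n : exists a : 'I_d -> K, u n = \sum_i a i *: f i.
    by have [a [? _]] := Efu _ (Eu n); exists a.
  by have [a] := choice ex; exists a.
have cauchy_a i : exists b, scalar_tends (fun n => a n i) b.
  apply: scalar_complete => e e0.
  have C1 : 0 < C + 1 by rewrite ltr_wpDl.
  have [N hN] := tends_cauchy ux (divr_gt0 e0 C1).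
  exists N => m n Nm Nn; apply: (@le_trans _ _ (\sum_i modulus (a m i - a n i))).
    by rewrite (bigD1 i)//= lerDl sumr_ge0// => j _; exact: modulus_ge0.
  apply: le_trans (hC _) _.
  have -> : \sum_i0 (a m i0 - a n i0) *: f i0 = u m - u n.
    by rewrite !ha -sumrB; apply: eq_bigr => j _; rewrite scalerBl.
  apply: le_trans (_ : (C + 1) * (e / (C + 1)) <= _); last first.
    by rewrite mulrC divfK// gt_eqF.
  by apply: ler_pM; rewrite ?nrm_ge0 ?lerDl//; exact: hN.
have [b hb] := choice cauchy_a.
suff -> : x = \sum_i b i *: f i by exact: Ef.
apply: (tends_unique ux); under [X in tends X]eq_fun do rewrite ha.
apply: tends_sum => i e e0.
have d0 : 0 < nrm (f i) + 1 by rewrite ltr_wpDl ?nrm_ge0.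
have [N hN] := hb i _ (divr_gt0 e0 d0); exists N => n /hN h.
rewrite -scalerBl nrmZ; move: h; rewrite ler_pdivlMr// => h.
by rewrite (le_trans _ h)// ler_wpM2l ?modulus_ge0// lerDl.
Qed.

End FiniteDim.
End RealNorm.

(** * Multipliers of modulus at most one *)

Section Multipliers.
Context (R : realType) (k : scalar_kind).
Local Notation K := (scalars R k).
Local Notation "t %:K" := (@of_real R k t) (at level 2, format "t %:K").
Context (X : normedModType K).

(** A norm is convex in each multiplier separately, hence is largest when all
    multipliers are 0 or 1. *)
Lemma nrm_convex_multiplier (I : eqType) (s : seq I) (y : I -> X) (t : I -> R) (v : X) B :
  uniq s -> (forall i, 0 <= t i <= 1) ->
  (forall m : pred I, nrm (v + \sum_(i <- s | m i) y i) <= B) ->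
  nrm (v + \sum_(i <- s) (t i)%:K *: y i) <= B.
Proof.
move=> + t01; elim: s v => [|i s ih] v /=.
  by move=> _ /(_ predT); rewrite !big_nil.
move=> /andP[si us] h; rewrite big_cons.
have eqm (m : pred I) b : \sum_(j <- s | if j == i then b else m j) y j = \sum_(j <- s | m j) y j.
  rewrite big_seq_cond [RHS]big_seq_cond; apply: eq_bigl => j.
  by have [->|] := eqVneq j i; rewrite ?(negbTE si).
have h1 : nrm (v + y i + \sum_(j <- s) (t j)%:K *: y j) <= B.
  apply: ih => // m; rewrite -(eqm m true) -addrA.
  by have := h (fun j => if j == i then true else m j); rewrite big_cons eqxx.
have h0 : nrm (v + \sum_(j <- s) (t j)%:K *: y j) <= B.
  apply: ih => // m; rewrite -(eqm m false).
  by have := h (fun j => if j == i then false else m j); rewrite big_cons eqxx.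
set z := \sum_(j <- s) _ in h0 h1 *.
have /andP[t0 t1] := t01 i.
have -> : v + ((t i)%:K *: y i + z) = (t i)%:K *: (v + y i + z) + (1 - t i)%:K *: (v + z).
  rewrite (_ : v + y i + z = y i + (v + z)); last by rewrite addrAC addrC.
  rewrite scalerDr -addrA -scalerDl of_realB of_real1 [_%:K + (1 - _)]addrCA subrr addr0 scale1r.
  by rewrite addrCA.
rewrite (le_trans (nrmD _ _))// !nrmZr !ger0_norm ?subr_ge0//.
rewrite (_ : B = t i * B + (1 - t i) * B); last by ring.
by apply: lerD; apply: ler_wpM2l; rewrite ?subr_ge0.
Qed.

Lemma nrm_multiplier (I : eqType) (s : seq I) (y : I -> X) (th : I -> K) B :
  uniq s -> (forall i, modulus (th i) <= 1) ->
  (forall m : pred I, nrm (\sum_(i <- s | m i) y i) <= B) ->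
  nrm (\sum_(i <- s) th i *: y i) <= 4 * B.
Proof.
move=> us th1 hB.
have [z z1 hz] := scalar_decomposition R k.
have [t ht] := choice (fun i => hz _ (th1 i)).
have one (j : 'I_4) : nrm (\sum_(i <- s) (t i j)%:K *: y i) <= B.
  rewrite -[X in nrm X]add0r; apply: nrm_convex_multiplier => // [i|m].
    by have [] := ht i.
  by rewrite add0r.
have -> : \sum_(i <- s) th i *: y i =
    (\sum_(i <- s) (t i 0)%:K *: y i - \sum_(i <- s) (t i 1)%:K *: y i) +
    z *: (\sum_(i <- s) (t i 2)%:K *: y i - \sum_(i <- s) (t i 3)%:K *: y i).
  rewrite -!sumrB scaler_sumr -big_split /=; apply: eq_bigr => i _.
  by have [_ ->] := ht i; rewrite scalerDl -!scalerBl scalerA.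
have B0 : 0 <= B by rewrite (le_trans (nrm_ge0 _) (one 0)).
rewrite (_ : 4 * B = (B + B) + (B + B)); last by ring.
rewrite (le_trans (nrmD _ _))// lerD// ?nrmZ; last rewrite -[leRHS]mul1r ler_pM ?modulus_ge0 ?nrm_ge0//.
all: by rewrite (le_trans (nrmB _ _))// lerD.
Qed.

End Multipliers.

(** * Unconditional convergence bounds all finite subsums *)

Section UnconditionalSums.
Context (R : realType) (k : scalar_kind).
Local Notation K := (scalars R k).

Lemma ler_sum_subset (I : eqType) (s s' : seq I) (F : I -> R) :
  uniq s -> {subset s <= s'} -> (forall i, 0 <= F i) ->
  \sum_(i <- s) F i <= \sum_(i <- s') F i.
Proof.
move=> + + F0; elim: s s' => [|i s ih] s' /=; first by rewrite big_nil sumr_ge0.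
move=> /andP[si us] ss'; have is' : i \in s' by apply: ss'; rewrite mem_head.
rewrite (perm_big _ (perm_to_rem is')) !big_cons lerD2l ih// => j js.
have := perm_mem (perm_to_rem is') j; rewrite ss' ?inE ?js ?orbT//.
by have [ji|//] := eqVneq j i; rewrite -ji js in si.
Qed.

(** Lists with sums that stay large, taken further and further out, can be laid
    end to end into a permutation along which the series is not Cauchy. *)
Lemma unconditionally_convergent_bounded (X : normedModType K) (y : nat -> X) :
  unconditionally_convergent y ->
  exists B : R, forall s : seq nat, uniq s -> nrm (\sum_(n <- s) y n) <= B.
Proof.
move=> ucy.
suff [N hN] : exists N, forall s : seq nat, uniq s -> all (leq N) s ->
    nrm (\sum_(n <- s) y n) <= 1.
  exists (\sum_(0 <= n < N) nrm (y n) + 1) => s us.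
  rewrite (bigID (fun n => n < N)%N) /= (le_trans (nrmD _ _))// lerD//.
    rewrite (le_trans (nrm_sum _ _ _))// -[leLHS]big_filter.
    apply: ler_sum_subset => [|i|i]; rewrite ?filter_uniq ?nrm_ge0//.
    by rewrite mem_filter mem_index_iota => /andP[].
  rewrite -big_filter; apply: hN; first exact: filter_uniq.
  by apply/allP => n; rewrite mem_filter -leqNgt => /andP[].
apply: contrapT => /forallNP noN.
have [F hF] : exists F : nat -> seq nat, forall N,
    [/\ uniq (F N), all (leq N) (F N) & 1 < nrm (\sum_(n <- F N) y n)].
  have ex N : exists s : seq nat,
      [/\ uniq s, all (leq N) s & 1 < nrm (\sum_(n <- s) y n)].
    apply: contrapT => /forallNP nos; apply: (noN N) => s us hs.
    by rewrite leNgt; apply/negP => lt1; apply: (nos s).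
  by have [F] := choice ex; exists F.
pose next N := (\max_(i <- F N) i).+1.
have F_lt N n : n \in F N -> (N <= n < next N)%N.
  have [_ /allP h _] := hF N => nF; rewrite h//= ltnS.
  exact: leq_bigmax_seq.
have next_gt N : (N < next N)%N.
  have [_ _] := hF N; case E : (F N) => [|n s]; first by rewrite big_nil nrm0 ltr10.
  by have /andP[] := F_lt N n (eq_ind_r (fun s => n \in s) (mem_head n s) E); lia.
pose blk N := F N ++ [seq i <- iota N (next N - N) | i \notin F N].
have blk_perm N : perm_eq (blk N) (iota N (next N - N)).
  apply: uniq_perm; rewrite ?iota_uniq//.
    rewrite cat_uniq filter_uniq ?iota_uniq// andbT; have [-> _ _] := hF N => /=.
    by apply/hasPn => i; rewrite mem_filter => /andP[].
  move=> i; rewrite mem_cat mem_filter mem_iota.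
  by case: (boolP (i \in F N)) => //= /F_lt; have := next_gt N; lia.
pose st n := iter n (fun p => (next p.1, p.2 ++ blk p.1)) (0%N, [::]).
pose N_ n := (st n).1; pose l_ n := (st n).2.
have N_S n : N_ n.+1 = next (N_ n) by [].
have l_S n : l_ n.+1 = l_ n ++ blk (N_ n) by [].
have l_perm n : perm_eq (l_ n) (iota 0 (N_ n)).
  elim: n => // n ih; rewrite l_S N_S.
  rewrite (permPl (perm_cat ih (blk_perm _))) -[X in iota X (_ - _)]add0n -iotaD.
  by rewrite subnKC// ltnW.
have l_size n : size (l_ n) = N_ n by rewrite (perm_size (l_perm n)) size_iota.
have N_ge n : (n <= N_ n)%N by elim: n => // n ih; rewrite N_S (leq_ltn_trans ih).
clearbody l_ N_ => {st}.
have l_prefix m n : (m <= n)%N -> exists t, l_ n = l_ m ++ t.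
  move=> /subnK <-; elim: (n - m)%N => [|d [t ih]]; first by exists [::]; rewrite cats0.
  by exists (t ++ blk (N_ (d + m))); rewrite addSn l_S ih catA.
pose sg i := nth 0%N (l_ i.+1) i.
have sgE n i : (i < N_ n)%N -> sg i = nth 0%N (l_ n) i.
  move=> iN; rewrite /sg; have [/l_prefix[t ->]|/ltnW/l_prefix[t ->]] := leqP i.+1 n.
    by rewrite nth_cat l_size N_ge.
  by rewrite nth_cat l_size iN.
have bij_sg : bijective sg.
  exists (fun n => index n (l_ n.+1)) => [i|n].
    have sgl : sg i \in l_ (sg i).+1.
      rewrite (perm_mem (l_perm _)) mem_iota add0n /=.
      exact: leq_trans (N_ge _).
    pose m := maxn i.+1 (sg i).+1.
    have im : (i < N_ m)%N by rewrite (leq_trans (N_ge i.+1))//; have [t] := l_prefix _ _ (leq_maxl i.+1 (sg i).+1); rewrite -!l_size => ->; rewrite size_cat leq_addr.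
    have [t ht] := l_prefix _ _ (leq_maxr i.+1 (sg i).+1).
    have -> : index (sg i) (l_ (sg i).+1) = index (sg i) (l_ m).
      by rewrite ht index_cat sgl.
    rewrite (sgE m i im) index_uniq ?l_size//.
    by rewrite (perm_uniq (l_perm _)) iota_uniq.
  have nl : n \in l_ n.+1.
    rewrite (perm_mem (l_perm _)) mem_iota add0n /=.
    exact: leq_trans (N_ge _).
  by rewrite (sgE n.+1) ?nth_index// -l_size index_mem.
have /cvg_ex[x /tendsP/tends_cauchy cx] := ucy sg bij_sg.
have [M hM] := cx (1 / 2) (divr_gt0 ltr01 (ltr0n _ 2)).
have sumE n m : (m <= N_ n)%N -> series (y \o sg) m = \sum_(j <- take m (l_ n)) y j.
  move=> mN; rewrite (big_nth 0%N) size_takel ?l_size// /series /=.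
  apply: eq_big_nat => i /andP[_ im].
  by rewrite nth_take// (sgE n)// (leq_trans im).
have NM : (M <= N_ M)%N by exact: N_ge.
have h := hM (N_ M + size (F (N_ M)))%N (N_ M) (leq_trans NM (leq_addr _ _)) NM.
have [_ _ big] := hF (N_ M).
have sz : (N_ M + size (F (N_ M)) <= N_ M.+1)%N.
  by rewrite -(l_size M.+1) l_S !size_cat l_size leq_add2l leq_addr.
move: h; rewrite (sumE M.+1)// (sumE M.+1); last by rewrite N_S ltnW.
rewrite l_S [take (N_ M) _]take_size_cat ?l_size// take_cat l_size.
rewrite ltnNge leq_addr /= addKn take_size_cat// big_cat /= [_ + _ - _]addrC addKr => h.
by have := le_lt_trans h (lt_trans _ big); rewrite ltxx => /(_ _)/negP; apply; lra.
Qed.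

End UnconditionalSums.

(** * The projections of a decomposition *)

Section Decompositions.
Context (R : realType) (k : scalar_kind).
Local Notation K := (scalars R k).
Local Notation "t %:K" := (@of_real R k t) (at level 2, format "t %:K").
Context (X : completeNormedModType K).
Implicit Types (x : X).

Lemma half_pow_small (e : R) : 0 < e -> exists N, forall n, (N <= n)%N -> 2^-1 ^+ n <= e.
Proof.
move=> e0; have [N hN] : exists N : nat, e^-1 <= N%:R.
  exists (Num.bound e^-1); have := archi_boundP (ltW (_ : 0 < e^-1)).
  by rewrite invr_gt0 => /(_ e0)/ltW.
exists N => n Nn; rewrite exprVn -[e]invrK lef_pV2 ?posrE ?invr_gt0 ?exprn_gt0//.
rewrite (le_trans hN)// -natrX ler_nat (leq_trans Nn)// ltnW// ltn_expl//.
Qed.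

(** Otherwise one could choose nested balls, the [n]-th of them disjoint from [V n];
    their common point would lie in no [V n]. *)
Lemma baire_ball (V : nat -> set X) : (forall x, exists n, V n x) ->
  exists n x0 (r : R), 0 < r /\ forall x, nrm (x - x0) <= r ->
    forall e : R, 0 < e -> exists2 v, V n v & nrm (v - x) <= e.
Proof.
move=> cover; apply: contrapT => noball.
have step (n : nat) (c : X * R) : exists c' : X * R, 0 < c.2 ->
    [/\ 0 < c'.2, nrm (c'.1 - c.1) <= c.2 / 2, c'.2 <= c.2 / 2 &
        forall v, V n v -> c'.2 < nrm (v - c'.1)].
  have [c0|] := boolP (0 < c.2); last by exists c.
  apply: contrapT => no; apply: noball; exists n, c.1, (c.2 / 2).
  rewrite divr_gt0//; split=> // x xc e e0; apply: contrapT => /forall2NP nov.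
  apply: no; exists (x, Num.min e (c.2 / 2)) => _ /=.
  rewrite lt_min e0 divr_gt0// ge_min lexx orbT; split=> // v Vv.
  have [//|/negP] := nov v; rewrite -ltNge => lt; rewrite (le_lt_trans _ lt)//.
  by rewrite ge_min lexx.
have [nx hnx] := choice (fun p : nat * (X * R) => step p.1 p.2).
pose c := fix c n := if n is n'.+1 then nx (n', c n') else (0, 1).
have c0 n : 0 < (c n).2.
  by elim: n => [|n ih] /=; [exact: ltr01 | have [] := hnx (n, c n) ih].
have hc n := hnx (n, c n) (c0 n); rewrite /= -/(c _) in hc.
have ball_in m n : (m <= n)%N -> nrm ((c n).1 - (c m).1) + (c n).2 <= (c m).2.
  move=> /subnK <-; elim: (n - m)%N => [|d ih]; first by rewrite subrr nrm0 add0r.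
  rewrite addSn; have [_ h1 h2 _] := hc (d + m)%N.
  apply: le_trans ih; rewrite -/(c (d + m).+1).
  have := nrm_triangle (c (d + m)%N).1 (c (d + m).+1).1 (c m).1.
  move: h1 h2; change (nx (d + m, c (d + m)%N))%N with (c (d + m).+1); lra.
have r_le n : (c n).2 <= 2^-1 ^+ n.
  elim: n => [|n ih]; first by rewrite expr0.
  have [_ _ h _] := hc n; rewrite exprS; apply: le_trans h _.
  by rewrite mulrC ler_wpM2l.
have in_ball m n : (m <= n)%N -> nrm ((c n).1 - (c m).1) <= (c m).2.
  by move=> /ball_in; apply: le_trans; rewrite lerDl ltW.
have [z hz] : exists z, tends (fun n => (c n).1) z.
  apply: tends_complete => e e0.
  have [N hN] := half_pow_small (divr_gt0 e0 (ltr0n _ 2) : 0 < e / 2).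
  have near n : (N <= n)%N -> nrm ((c n).1 - (c N).1) <= e / 2.
    by move=> /in_ball h; apply: le_trans h (le_trans (r_le _) (hN _ _)).
  exists N => m n /near hm /near hn; apply: le_trans (nrm_triangle (c N).1 _ _) _.
  by rewrite (splitr e) lerD// nrmBC.
have [n Vz] := cover z; have [_ _ _ /(_ z Vz)] := hc n.
rewrite ltNge => /negP; apply.
have h := tendsB hz (tends_cst (c n.+1).1).
by apply: (tends_nrm_le h (N := n.+1)) => m /in_ball.
Qed.

Definition bounded_projections (E : nat -> set X) (P : nat -> X -> X) (C : R) :=
  [/\ 0 <= C, forall n x, E n (P n x),
      forall x, tends (fun N => \sum_(n < N) P n x) x,
      forall n (a : K) (x y : X), P n (a *: x + y) = a *: P n x + P n y &
      [/\ forall (s : seq nat) (y : nat -> X) n, uniq s -> (forall i, E i (y i)) ->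
            P n (\sum_(i <- s) y i) = if n \in s then y n else 0 &
          forall (s : seq nat) (th : nat -> K) x, uniq s -> (forall n, modulus (th n) <= 1) ->
            nrm (\sum_(n <- s) th n *: P n x) <= C * nrm x]].

Lemma seriesE (u : nat -> X) : series u = fun N => \sum_(n < N) u n.
Proof. by apply/funext => N; rewrite /series /= big_mkord. Qed.

(** The open mapping argument: by Baire, the points with finite subsums bounded by a fixed integer
    are dense in some ball, and successive approximation removes the closure. *)
Lemma UFDD_projections (E : nat -> set X) : UFDD E ->
  exists P C, bounded_projections E P C.
Proof.
move=> [fdE expE].
have clE n : closed_subspace (E n) := finite_dimensional_closed (fdE n).
have [y hy] : exists y : X -> nat -> X, forall x,
    [/\ forall n, E n (y x n), tends (fun N => \sum_(n < N) y x n) x,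
      forall z, (forall n, E n (z n)) -> tends (fun N => \sum_(n < N) z n) x -> y x = z &
      unconditionally_convergent (y x)].
  have ex x : exists z : nat -> X, [/\ forall n, E n (z n),
      tends (fun N => \sum_(n < N) z n) x,
      forall z', (forall n, E n (z' n)) -> tends (fun N => \sum_(n < N) z' n) x -> z = z' &
      unconditionally_convergent z].
    have [[z [[Ez zx] uz]] uc] := expE x; exists z; split=> //.
    - by move/tendsP : zx; rewrite seriesE.
    - move=> z' Ez' z'x; apply: uz; split=> //; apply/tendsP.
      by rewrite seriesE.
    - exact: uc.
  by have [y] := choice ex; exists y.
have lin n a x x' : y (a *: x + x') n = a *: y x n + y x' n.
  have [Ex xx _ _] := hy x; have [Ex' xx' _ _] := hy x'.
  have [_ _ /(_ (fun n => a *: y x n + y x' n)) -> //] := hy (a *: x + x').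
    by move=> i; have [_ hD hZ _] := clE i; apply: hD; first exact: hZ.
  have := tendsD (tendsZ a xx) xx'.
  by under eq_fun do rewrite scaler_sumr -big_split.
have y0 n : y 0 n = 0.
  by have := lin n (-1) 0 0; rewrite scaler0 addr0 scaleN1r addNr.
have linD n x x' : y (x + x') n = y x n + y x' n.
  by rewrite -[x in LHS]scale1r lin scale1r.
have linZ n a x : y (a *: x) n = a *: y x n by rewrite -[a *: x]addr0 lin y0 addr0.
have linB n x x' : y (x - x') n = y x n - y x' n.
  by rewrite linD -scaleN1r linZ scaleN1r.
have single n i x : E i x -> y x n = if n == i then x else 0.
  move=> Eix; have [_ _ /(_ (fun n => if n == i then x else 0)) -> //] := hy x.
    by move=> j; case: eqP => [-> //|_]; have [] := clE j.
  move=> e e0; exists i.+1 => N iN; rewrite (bigD1 (Ordinal iN)) //= eqxx big1.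
    by rewrite addr0 subrr nrm0 ltW.
  by move=> j /negbTE; rewrite -val_eqE /= => ->.
have ysum n s (z : nat -> X) : y (\sum_(i <- s) z i) n = \sum_(i <- s) y (z i) n.
  elim: s => [|i s ih]; first by rewrite !big_nil y0.
  by rewrite !big_cons linD ih.
pose V (b : nat) := [set x | forall s : seq nat, uniq s -> nrm (\sum_(n <- s) y x n) <= b%:R].
have [b [x0 [r [r0 hV]]]] : exists n x0 (r : R), 0 < r /\ forall x, nrm (x - x0) <= r ->
    forall e : R, 0 < e -> exists2 v, V n v & nrm (v - x) <= e.
  apply: baire_ball => x; have [_ _ _ /unconditionally_convergent_bounded[B hB]] := hy x.
  exists (Num.bound B) => s /hB h; apply: le_trans h _.
  have [/archi_boundP/ltW//|/ltW B0] := leP 0 B.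
  exact: le_trans B0 (ler0n _ _).
(* The set [V b] is convex and symmetric, so the ball may be centred at 0. *)
have near0 x : nrm x <= r -> forall e : R, 0 < e -> exists2 v, V b v & nrm (v - x) <= e.
  move=> xr e e0.
  have [|v1 V1 h1] := hV (x0 + x) _ e e0; first by rewrite addrAC subrr add0r.
  have [|v2 V2 h2] := hV (x0 - x) _ e e0; first by rewrite addrAC subrr add0r nrmN.
  exists ((2^-1)%:K *: (v1 - v2)).
    move=> s us; under eq_bigr do rewrite linZ linB.
    rewrite -scaler_sumr sumrB nrmZr ger0_norm ?invr_ge0//.
    have := nrmB (\sum_(i <- s) y v1 i) (\sum_(i <- s) y v2 i).
    by have := V1 s us; have := V2 s us; lra.
  have dv : v1 - v2 = (v1 - (x0 + x)) - (v2 - (x0 - x)) + (x + x).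
    move: (v1 - (x0 + x)) (v2 - (x0 - x)) (subrK (x0 + x) v1) (subrK (x0 - x) v2).
    move=> w1 w2 <- <-; rewrite opprD addrACA; congr (_ + _).
    by rewrite opprB [x0 + x]addrC addrACA subrr addr0.
  have half : (2^-1)%:K *: (x + x) = x.
    rewrite scalerDr -scalerDl -of_realD (_ : 2^-1 + 2^-1 = 1) ?of_real1 ?scale1r//.
    by lra.
  rewrite dv scalerDr half addrK nrmZr ger0_norm ?invr_ge0//.
  have := nrmB (v1 - (x0 + x)) (v2 - (x0 - x)); lra.
pose D : R := b%:R / r.
have D0 : 0 <= D by rewrite divr_ge0// ltW.
have [G hG] : exists G : X * R -> X, forall p, 0 < p.2 ->
    (forall s, uniq s -> nrm (\sum_(n <- s) y (G p) n) <= D * nrm p.1) /\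
    nrm (p.1 - G p) <= p.2.
  have ex (p : X * R) : exists v, 0 < p.2 ->
      (forall s, uniq s -> nrm (\sum_(n <- s) y v n) <= D * nrm p.1) /\
      nrm (p.1 - v) <= p.2.
    case: p => x e /=; have [e0|] := boolP (0 < e); last by exists x.
    have [->|xn0] := eqVneq x 0.
      exists 0 => _; rewrite subrr nrm0 mulr0 ltW//; split=> // s _.
      by rewrite big1 ?nrm0// => i _; rewrite y0.
    rewrite -nrm_gt0 in xn0; pose t := r / nrm x.
    have t0 : 0 < t by rewrite divr_gt0.
    have [|v Vv hv] := near0 (t%:K *: x) _ (t * e) (mulr_gt0 t0 e0).
      by rewrite nrmZr gtr0_norm// divfK// gt_eqF.
    exists ((t^-1)%:K *: v) => _; split.
      move=> s us; under eq_bigr do rewrite linZ.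
      rewrite -scaler_sumr nrmZr gtr0_norm ?invr_gt0//.
      rewrite ler_pdivrMl// (le_trans (Vv s us))// /t /D.
      rewrite [leRHS](_ : _ = b%:R)//; field.
      by rewrite !gt_eqF.
    have -> : x - (t^-1)%:K *: v = - ((t^-1)%:K *: (v - t%:K *: x)).
      rewrite scalerBr scalerA -of_realM mulVf ?gt_eqF// of_real1 scale1r.
      by rewrite opprB.
    by rewrite nrmN nrmZr gtr0_norm ?invr_gt0// ler_pdivrMl.
  by have [G] := choice ex; exists G.
clearbody D.
have bound x s : uniq s -> nrm (\sum_(n <- s) y x n) <= (2 * D) * nrm x.
  have [->|xn0] := eqVneq x 0.
    by move=> us; rewrite big1 ?nrm0 ?mulr0// => i _; rewrite y0.
  rewrite -nrm_gt0 in xn0; pose q j := 2^-1 ^+ j : R.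
  have q0 j : 0 < q j by rewrite exprn_gt0.
  (* The remainder after [j] steps; the corrections have geometrically decreasing norms. *)
  pose res := fix res j :=
    if j is j'.+1 then res j' - G (res j', nrm x * q j) else x.
  have resS j : res j.+1 = res j - G (res j, nrm x * q j.+1) by [].
  have res_le j : nrm (res j) <= nrm x * q j.
    case: j => [|j]; first by rewrite /q expr0 mulr1.
    have [|_ h] := hG (res j, nrm x * q j.+1); first by rewrite /= mulr_gt0.
    by rewrite resS.
  pose v j := x - res j.
  have vS j : v j.+1 - v j = G (res j, nrm x * q j.+1).
    by rewrite /v resS !opprB addrC addrA subrK addrC subrK.
  have vtends : tends v x.
    move=> e e0; have [N hN] := half_pow_small (divr_gt0 e0 xn0).
    exists N => n /hN h; rewrite /v addrAC subrr sub0r nrmN.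
    by rewrite (le_trans (res_le n))// mulrC -ler_pdivlMr.
  have vdist i j t : (i <= j)%N -> uniq t ->
      nrm (\sum_(n <- t) y (v j - v i) n) <= 2 * D * nrm x * (q i - q j).
    move=> ij ut; rewrite -(subnK ij); elim: (j - i)%N => [|d ih].
      rewrite !subrr mulr0 big1 ?nrm0// => n _; exact: y0.
    have -> : v (d.+1 + i)%N - v i = (v (d + i)%N - v i) + (v (d + i).+1 - v (d + i)%N).
      by rewrite [RHS]addrC addrA subrK addSn.
    under eq_bigr do rewrite linD.
    rewrite big_split /= (le_trans (nrmD _ _))//.
    have -> : q i - q (d.+1 + i)%N = (q i - q (d + i)%N) + q (d + i)%N / 2.
      by rewrite /q addSn exprS; field.
    rewrite mulrDr lerD// vS.
    have [|h _] := hG (res (d + i)%N, nrm x * q (d + i).+1); first by rewrite /= mulr_gt0.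
    rewrite (le_trans (h t ut))//= (le_trans (ler_wpM2l D0 (res_le _)))//.
    by rewrite [leLHS](_ : _ = 2 * D * nrm x * (q (d + i)%N / 2))//; field.
  have vdist' i j t : (i <= j)%N -> uniq t ->
      nrm (\sum_(n <- t) y (v j - v i) n) <= 2 * D * nrm x * q i.
    move=> ij ut; rewrite (le_trans (vdist _ _ _ ij ut))// ler_wpM2l ?mulr_ge0 ?nrm_ge0//.
    by rewrite lerBlDr lerDl ltW// q0.
  pose M := 2 * D * nrm x.
  have M0 : 0 <= M by rewrite !mulr_ge0// nrm_ge0.
  have small (e : R) : 0 < e -> exists N, forall n, (N <= n)%N -> M * q n <= e.
    move=> e0; have M1 : 0 < M + 1 by rewrite ltr_wpDl.
    have [N hN] := half_pow_small (divr_gt0 e0 M1); exists N => n /hN.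
    rewrite ler_pdivlMr// mulrC; apply: le_trans; rewrite mulrDl lerDl mul1r.
    exact: ltW.
  have cz n : exists z, tends (fun j => y (v j) n) z.
    apply: tends_complete => e e0; have [N hN] := small (e / 2) (divr_gt0 e0 (ltr0n _ 2)).
    have h i : (N <= i)%N -> nrm (y (v i) n - y (v N) n) <= e / 2.
      move=> Ni; have := vdist' N i [:: n] Ni isT; rewrite big_seq1 linB.
      by move=> h'; apply: le_trans h' (hN N (leqnn N)).
    exists N => i j /h hi /h hj; apply: le_trans (nrm_triangle (y (v N) n) _ _) _.
    by rewrite (splitr e) lerD// nrmBC.
  have [z hz] := choice cz.
  have Ez n : E n (z n).
    have [_ _ _ cl] := clE n; apply: cl (hz n) => j.
    by have [] := hy (v j).
  have zdist j t : uniq t -> nrm (\sum_(n <- t) (z n - y (v j) n)) <= M * q j.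
    move=> ut; have h n := tendsB (hz n) (tends_cst (y (v j) n)).
    apply: (tends_nrm_le (N := j) (tends_sum t h)) => i /= ji.
    under eq_bigr do rewrite -linB; exact: vdist'.
  (* By uniqueness, the coordinates of the sum of the corrections are those of [x]. *)
  have yx : y x = z.
    have [_ _ h _] := hy x; apply: h Ez _ => e e0.
    have e3 : 0 < e / 3 by rewrite divr_gt0.
    have [N hN] := small _ e3; have [N' hN'] := vtends _ e3.
    pose j := maxn N N'; have [_ yvj _ _] := hy (v j).
    have [L hL] := yvj _ e3; exists L => n /hL h1.
    have -> : \sum_(i < n) z i - x = \sum_(i < n) (z i - y (v j) i) +
        ((\sum_(i < n) y (v j) i - v j) + (v j - x)).
      by rewrite sumrB !subrKA.
    have h2 : nrm (\sum_(i < n) (z i - y (v j) i)) <= e / 3.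
      rewrite -(big_mkord xpredT (fun i => z i - y (v j) i)).
      exact: le_trans (zdist j _ (iota_uniq _ _)) (hN _ (leq_maxl _ _)).
    have h3 := hN' j (leq_maxr _ _).
    have := nrmD (\sum_(i < n) (z i - y (v j) i))
       ((\sum_(i < n) y (v j) i - v j) + (v j - x)).
    have := nrmD (\sum_(i < n) y (v j) i - v j) (v j - x).
    by move: h1 h2 h3; lra.
  move=> us; rewrite yx; have := zdist 0%N s us.
  rewrite /q expr0 mulr1 /v subrr; under eq_bigr do rewrite y0 subr0.
  by [].
exists (fun n x => y x n), (4 * (2 * D)); split=> //.
- by rewrite !mulr_ge0.
- by move=> n x; have [] := hy x.
- by move=> x; have [] := hy x.
- split=> [s z n us Ez|s th x us th1].
    rewrite ysum; under eq_bigr do rewrite (single _ _ _ (Ez _)).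
    case: ifPn => [ns|ns].
      rewrite (perm_big _ (perm_to_rem ns)) big_cons eqxx big_seq big1 /= ?addr0// => i.
      by rewrite mem_rem_uniq// inE => /andP[/negbTE + _]; rewrite eq_sym => ->.
    rewrite big_seq big1// => i; case: eqP => // <- ns'.
    by rewrite ns' in ns.
  rewrite -mulrA; apply: nrm_multiplier => // m.
  by rewrite -big_filter; apply: bound; rewrite filter_uniq.
Qed.

End Decompositions.

(** * Recognizing decompositions *)

Section Criteria.
Context (R : realType) (k : scalar_kind).
Local Notation K := (scalars R k).
Local Notation "t %:K" := (@of_real R k t) (at level 2, format "t %:K").
Context (X : completeNormedModType K).
Implicit Types (x : X).

Definition dense_sums (E : nat -> set X) := forall x (e : R), 0 < e ->
  exists N (y : nat -> X), (forall n, E n (y n)) /\ nrm (x - \sum_(n < N) y n) <= e.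

(** Uniformly bounded projections turn approximation by finite sums into expansions:
    the coordinates of the approximants converge, uniformly over finite sets of indices. *)
Lemma UFDD_criterion (E : nat -> set X) C :
  (forall n, finite_dimensional (E n)) -> 0 <= C ->
  (forall (s : seq nat) (y : nat -> X) (m : pred nat), uniq s -> (forall n, E n (y n)) ->
     nrm (\sum_(n <- s | m n) y n) <= C * nrm (\sum_(n <- s) y n)) ->
  dense_sums E -> UFDD E.
Proof.
move=> fdE C0 hC dE.
have clE n : closed_subspace (E n) := finite_dimensional_closed (fdE n).
have EB n x x' : E n x -> E n x' -> E n (x - x').
  by have [_ hD hZ _] := clE n => Ex Ex'; rewrite -scaleN1r; apply/hD/hZ.
have initial (s : seq nat) N (y : nat -> X) : uniq s -> all (gtn N) s ->
    (forall n, E n (y n)) -> nrm (\sum_(n <- s) y n) <= C * nrm (\sum_(n < N) y n).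
  move=> us sN Ey; have := hC (index_iota 0 N) y (fun i => i \in s) (iota_uniq _ _) Ey.
  rewrite -big_filter big_mkord => /(le_trans _); apply; rewrite le_eqVlt; apply/orP; left.
  apply/eqP; congr nrm; apply: perm_big; apply: uniq_perm; rewrite ?filter_uniq ?iota_uniq//.
  move=> i; rewrite mem_filter mem_index_iota /=.
  by case: (boolP (i \in s)) => //= /(allP sN) /= ->.
have bounded_by (s : seq nat) : exists N, all (gtn N) s.
  exists (\max_(i <- s) i).+1; apply/allP => i si /=; rewrite ltnS.
  exact: leq_bigmax_seq.
have initial_lim (s : seq nat) (y : nat -> X) x : uniq s -> (forall n, E n (y n)) ->
    tends (fun N => \sum_(n < N) y n) x -> nrm (\sum_(n <- s) y n) <= C * nrm x.
  move=> us Ey yx; apply/ler_addgt0Pl => e e0; have C1 : 0 < C + 1 by rewrite ltr_wpDl.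
  have [N hN] := yx _ (divr_gt0 e0 C1); have [M sM] := bounded_by s.
  have sMN : all (gtn (maxn N M)) s.
    by apply/allP => i /(allP sM) /=; lia.
  apply: le_trans (initial s _ y us sMN Ey) _.
  have h1 := hN _ (leq_maxl N M); set S := \sum_(n < _) _ in h1 *.
  have h2 : nrm S <= e / (C + 1) + nrm x by apply: le_trans (nrm_le_split S x) _; rewrite lerD2r.
  apply: le_trans (ler_wpM2l C0 h2) _; rewrite mulrDr lerD2r mulrCA.
  by rewrite -[leRHS]mulr1 ler_wpM2l ?(ltW e0)// ler_pdivrMr// mul1r lerDl.
have unique_lim (y z : nat -> X) x : (forall n, E n (y n)) -> (forall n, E n (z n)) ->
    tends (fun N => \sum_(n < N) y n) x -> tends (fun N => \sum_(n < N) z n) x -> y = z.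
  move=> Ey Ez yx zx; apply/funext => n; apply/eqP; rewrite -subr_eq0; apply/eqP/nrm_eq0.
  have /initial_lim : uniq [:: n] by []; move=> /(_ (fun n => y n - z n) 0).
  rewrite big_seq1 nrm0 mulr0 => h; apply/le_anti; rewrite nrm_ge0 andbT.
  apply: h => [i|]; first exact: EB.
  have := tendsB yx zx; rewrite subrr.
  by under [X in tends X]eq_fun do rewrite -sumrB.
split=> // x; split; last first.
  move=> y Ey /tendsP; rewrite seriesE => yx s bij_s; have inj_s := bij_inj bij_s.
  suff : tends (series (y \o s)) x by move/tendsP/cvgP.
  move=> e e0; have C1 : 0 < C + 1 by rewrite ltr_wpDl.
  have [N hN] := yx _ (divr_gt0 e0 C1).
  have [g gs sg] := bij_s; exists (\max_(n < N) g n).+1 => m hm.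
  rewrite seriesE -(big_mkord xpredT (y \o s)) -(big_map s xpredT y).
  set l := map s _; have ul : uniq l by rewrite map_inj_uniq// iota_uniq.
  have hl n : (n < N)%N -> n \in l.
    move=> nN; rewrite -[n]sg map_f// mem_index_iota /= (leq_trans _ hm)// ltnS.
    exact: (leq_bigmax (Ordinal nN)).
  have tail : nrm (\sum_(n <- l | ~~ (n < N)%N) y n) <= C * nrm (x - \sum_(n < N) y n).
    pose z n := if (n < N)%N then 0 else y n.
    have -> : \sum_(n <- l | ~~ (n < N)%N) y n = \sum_(n <- [seq n <- l | ~~ (n < N)%N]) z n.
      by rewrite big_filter; apply: eq_bigr => n /negbTE; rewrite /z => ->.
    apply: initial_lim; first exact: filter_uniq.
      by move=> n; rewrite /z; case: ifP => // _; have [] := clE n.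
    move=> e' e'0; have [N' hN'] := yx _ e'0; exists (maxn N N') => i.
    rewrite geq_max => /andP[Ni /hN'].
    suff -> : \sum_(n < i) z n - (x - \sum_(n < N) y n) = \sum_(n < i) y n - x by [].
    rewrite opprB addrA; congr (_ - _).
    rewrite -(big_mkord xpredT z) -(big_mkord xpredT y) -(big_mkord xpredT y).
    rewrite (big_cat_nat (leq0n N) Ni) [RHS](big_cat_nat (leq0n N) Ni) /=.
    rewrite [\sum_(0 <= n < N) z n]big_nat_cond big1 ?add0r; last first.
      by move=> n /andP[/andP[_ nN] _]; rewrite /z nN.
    rewrite addrC; congr (_ + _); rewrite big_nat_cond [RHS]big_nat_cond.
    by apply: eq_bigr => n /andP[/andP[Nn _] _]; rewrite /z ltnNge Nn.
  rewrite (bigID (fun n => n < N)%N) /=.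
  have -> : \sum_(n <- l | (n < N)%N) y n = \sum_(n < N) y n.
    rewrite -big_filter -(big_mkord xpredT y); apply: perm_big; apply: uniq_perm.
    - exact: filter_uniq.
    - exact: iota_uniq.
    - move=> n; rewrite mem_filter mem_index_iota /=.
      by case: (boolP (n < N)%N) => // /hl ->.
  rewrite addrAC (le_trans (nrmD _ _))//.
  have := hN N (leqnn N); rewrite ler_pdivlMr// => h; apply: le_trans h.
  by rewrite mulrDr mulr1 [leLHS]addrC lerD2r mulrC nrmBC.
have ex (j : nat) : exists y : nat -> X, (forall n, E n (y n)) /\
    exists w, tends (fun N => \sum_(n < N) y n) w /\ nrm (x - w) <= 2^-1 ^+ j.
  have [|N [y [Ey hy]]] := dE x (2^-1 ^+ j); first by rewrite exprn_gt0.
  exists (fun n => if (n < N)%N then y n else 0); split.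
    by move=> n; case: ifP => // _; have [] := clE n.
  exists (\sum_(n < N) y n); split=> // e e0; exists N => n Nn.
  rewrite -(big_mkord xpredT (fun n => if (n < N)%N then y n else 0)) -(big_mkord xpredT y).
  rewrite (big_cat_nat (leq0n N) Nn) /= [X in _ + X - _]big_nat_cond [X in _ + X - _]big1 ?addr0.
    rewrite (eq_big_nat _ _ (F2 := y)) ?subrr ?nrm0 ?ltW// => i /andP[_ ->].
    by [].
  by move=> i /andP[/andP[Ni _] _]; rewrite ltnNge Ni.
have {ex} [y /all_and2[Ey ey]] := choice ex.
have {ey} [w /all_and2[yw wx]] := choice ey.
have wtends : tends w x.
  by move=> e /half_pow_small[N hN]; exists N => n /hN; rewrite nrmBC; apply: le_trans.
have ydist i j (s : seq nat) : uniq s ->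
    nrm (\sum_(n <- s) (y i n - y j n)) <= C * nrm (w i - w j).
  move=> us; apply: initial_lim => // [n|]; first exact: EB.
  have := tendsB (yw i) (yw j).
  by under [X in tends X]eq_fun do rewrite -sumrB.
have smallw (e : R) : 0 < e -> exists N, forall i j, (N <= i)%N -> (N <= j)%N ->
    C * nrm (w i - w j) <= e.
  move=> e0; have C1 : 0 < C + 1 by rewrite ltr_wpDl.
  have [N hN] := tends_cauchy wtends (divr_gt0 e0 C1); exists N => i j Ni Nj.
  have := hN _ _ Ni Nj; rewrite ler_pdivlMr// mulrC; apply: le_trans.
  by rewrite mulrDl mul1r lerDl nrm_ge0.
have cz n : exists z, tends (fun j => y j n) z.
  apply: tends_complete => e /smallw[N hN]; exists N => i j Ni Nj.
  by have := ydist i j [:: n] isT; rewrite big_seq1 => /le_trans; apply; exact: hN.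
have [z hz] := choice cz.
have Ez n : E n (z n) by have [_ _ _ cl] := clE n; apply: cl (hz n).
have zx : tends (fun N => \sum_(n < N) z n) x.
  move=> e e0; have e3 : 0 < e / 3 by rewrite divr_gt0.
  have [N hN] := smallw _ e3; have [N' hN'] := wtends _ e3.
  pose j := maxn N N'; have [L hL] := yw j _ e3; exists L => n /hL h1.
  have h2 := hN' j (leq_maxr _ _).
  have h3 : nrm (\sum_(i < n) (z i - y j i)) <= e / 3.
    have lim := tends_sum (index_enum 'I_n)
      (fun i : 'I_n => tendsB (hz i) (tends_cst (y j i))).
    apply: (tends_nrm_le (N := j) lim) => i ji /=.
    rewrite -(big_mkord xpredT (fun n => y i n - y j n)).
    apply: le_trans (ydist _ _ _ (iota_uniq _ _)) (hN _ _ _ (leq_maxl _ _)).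
    exact: leq_trans (leq_maxl _ _) ji.
  have -> : \sum_(i < n) z i - x = \sum_(i < n) (z i - y j i) +
      ((\sum_(i < n) y j i - w j) + (w j - x)) by rewrite sumrB !subrKA.
  have := nrmD (\sum_(i < n) (z i - y j i)) ((\sum_(i < n) y j i - w j) + (w j - x)).
  have := nrmD (\sum_(i < n) y j i - w j) (w j - x).
  by move: h1 h2 h3; lra.
exists z; split; first by split=> //; apply/tendsP; rewrite seriesE.
move=> z' [Ez' /tendsP]; rewrite seriesE => z'x; exact: unique_lim zx z'x.
Qed.

End Criteria.

(** * Unconditional families and bases *)

Section Bases.
Context (R : realType) (k : scalar_kind).
Local Notation K := (scalars R k).
Local Notation "t %:K" := (@of_real R k t) (at level 2, format "t %:K").

Definition unc (X : normedModType K) (I : eqType) (f : I -> X) (C : R) :=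
  0 <= C /\ forall (s : seq I) (a th : I -> K), uniq s -> (forall i, modulus (th i) <= 1) ->
    nrm (\sum_(i <- s) (th i * a i) *: f i) <= C * nrm (\sum_(i <- s) a i *: f i).

Lemma unc_subset (X : normedModType K) (I : eqType) (f : I -> X) (C : R)
    (s : seq I) (a : I -> K) (m : pred I) : unc f C -> uniq s ->
  nrm (\sum_(i <- s | m i) a i *: f i) <= C * nrm (\sum_(i <- s) a i *: f i).
Proof.
move=> [C0 hC] us.
have := hC s a (fun i => if m i then 1 else 0) us; rewrite [in X in _ -> X]big_mkcond.
under [X in (_ -> nrm X <= _) -> _]eq_bigr => i _.
  rewrite (_ : _ *: _ = if m i then a i *: f i else 0); first over.
  by case: (m i); rewrite ?mul1r// mul0r scale0r.
by apply=> i; case: (m i); rewrite ?modulus1// modulus0.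
Qed.

Lemma unc_coordinate (X : normedModType K) (I : eqType) (f : I -> X) (C : R)
    (s : seq I) (a : I -> K) i : unc f C -> uniq s -> i \in s ->
  modulus (a i) * nrm (f i) <= C * nrm (\sum_(i <- s) a i *: f i).
Proof.
move=> uf us si; have := unc_subset a (pred1 i) uf us.
by rewrite -big_filter filter_pred1_uniq// big_seq1 nrmZ.
Qed.

Lemma unc_inj (X : normedModType K) (I J : eqType) (f : I -> X) (h : J -> I) (C : R) :
  injective h -> unc f C -> unc (f \o h) C.
Proof.
move=> inj_h [C0 hC]; split=> // s a th us th1.
pose ext (b : J -> K) i := nth 0 (map b s) (index i (map h s)).
have extE (b : J -> K) j : j \in s -> ext b (h j) = b j.
  by move=> js; rewrite /ext index_map// (nth_map j) ?index_mem// nth_index.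
have := hC (map h s) (ext a) (ext th); rewrite map_inj_uniq// => /(_ us).
rewrite !big_map.
have -> : \sum_(j <- s) (ext th (h j) * ext a (h j)) *: f (h j) =
    \sum_(j <- s) (th j * a j) *: f (h j) by apply: eq_big_seq => j js; rewrite !extE.
have -> : \sum_(j <- s) ext a (h j) *: f (h j) = \sum_(j <- s) a j *: f (h j).
  by apply: eq_big_seq => j js; rewrite extE.
apply=> i; rewrite /ext; set n := index _ _.
have [sn|ns] := leqP (size s) n; first by rewrite nth_default ?size_map// modulus0.
by clear us extE; subst n ext; case: s ns => // j0 s' ns; rewrite (nth_map j0).
Qed.

(** The quotients of the coefficients are admissible multipliers. *)
Lemma unc_le (X : normedModType K) (I : eqType) (f : I -> X) (C : R)
    (s : seq I) (a b : I -> K) : unc f C -> uniq s ->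
  (forall i, i \in s -> modulus (a i) <= modulus (b i)) ->
  nrm (\sum_(i <- s) a i *: f i) <= C * nrm (\sum_(i <- s) b i *: f i).
Proof.
move=> [C0 hC] us ab.
pose th i := if i \in s then a i / b i else 0.
have th1 i : modulus (th i) <= 1.
  rewrite /th; case: ifPn => [si|_]; last by rewrite modulus0.
  have [b0|b0] := eqVneq (b i) 0; first by rewrite b0 invr0 mulr0 modulus0.
  have mb0 : 0 < modulus (b i).
    by rewrite lt_neqAle modulus_ge0 andbT eq_sym; apply: contra_neq b0 => /modulus_eq0.
  by rewrite modulusM modulusV ler_pdivrMr// mul1r ab.
have := hC s b th us th1; rewrite (eq_big_seq (fun i => a i *: f i))// => i si.
rewrite /th si; have [b0|b0] := eqVneq (b i) 0; last by rewrite divfK.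
have -> : a i = 0; last by rewrite !mul0r.
by apply/modulus_eq0/le_anti; rewrite modulus_ge0 andbT (le_trans (ab i si))// b0 modulus0.
Qed.

Section Complete.
Context (X : completeNormedModType K).

Definition line (f : nat -> X) (n : nat) : set X := [set x | exists a : K, x = a *: f n].

Lemma line_finite_dimensional (f : nat -> X) n : f n != 0 -> finite_dimensional (line f n).
Proof.
move=> fn0; exists 1%N, (fun=> f n); split=> [a|x [a ->]].
  by exists (a ord0); rewrite big_ord1.
exists (fun=> a); split; first by rewrite big_ord1.
move=> b; rewrite big_ord1 => /eqP; rewrite -subr_eq0 -scalerBl scaler_eq0 (negbTE fn0) orbF.
by rewrite subr_eq0 => /eqP ab; apply/funext => i; rewrite ab (ord1 i).
Qed.

Definition dense_span (I : Type) (f : I -> X) := forall (x : X) (e : R), 0 < e ->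
  exists (s : seq I) (a : I -> K), nrm (x - \sum_(i <- s) a i *: f i) <= e.

(** Lets the results on decompositions be used for bases: the blocks are the lines spanned by
    the basis vectors. *)
Lemma basis_UFDD (f : nat -> X) : (forall n, f n != 0) ->
  UFDD (line f) <-> unconditional_basis f.
Proof.
move=> f0; have coef (y : nat -> X) : (forall n, line f n (y n)) ->
    exists a : nat -> K, y = fun n => a n *: f n.
  by move=> /choice[a ha]; exists a; apply/funext.
have inj_coef (a b : nat -> K) : (fun n => a n *: f n) = (fun n => b n *: f n) -> a = b.
  move=> ab; apply/funext => n; have /eqP := congr1 (fun g => g n) ab.
  rewrite -subr_eq0 -scalerBl scaler_eq0 (negbTE (f0 n)) orbF subr_eq0.
  by move/eqP.
split=> [[_ h] x|h].
  have [[y [[Ey yx] yu]] uc] := h x; have [a ya] := coef y Ey; split; last first.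
    by move=> b bx; apply: uc => // n; exists (b n).
  exists a; split; first by rewrite -ya.
  move=> b bx; apply: inj_coef; rewrite -ya; apply: yu; split=> // n.
  by exists (b n).
split=> [n|x]; first exact: line_finite_dimensional.
have [[a [ax au]] uc] := h x; split; last first.
  by move=> y /coef[b ->] /uc.
exists (fun n => a n *: f n); split; first by split=> // n; exists (a n).
by move=> y [/coef[b ->] /au ->].
Qed.

Definition coordinates (f : nat -> X) (c : nat -> X -> K) (C : R) :=
  [/\ 0 <= C, forall n, f n != 0,
      forall x, tends (fun N => \sum_(n < N) c n x *: f n) x,
      forall n a x y, c n (a *: x + y) = a * c n x + c n y &
      [/\ forall (s : seq nat) (a : nat -> K) n, uniq s ->
            c n (\sum_(i <- s) a i *: f i) = if n \in s then a n else 0 &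
          forall (s : seq nat) (th : nat -> K) x, uniq s -> (forall n, modulus (th n) <= 1) ->
            nrm (\sum_(n <- s) (th n * c n x) *: f n) <= C * nrm x]].

Lemma basis_coordinates (f : nat -> X) : unconditional_basis f ->
  exists c C, coordinates f c C.
Proof.
move=> fb; have f0 n : f n != 0.
  apply/negP => /eqP fn0; have [[a [_ au]] _] := fb 0.
  have zero (b : nat -> K) : (forall m, b m *: f m = 0) -> a = b.
    move=> b0; apply: au; rewrite (_ : series _ = fun=> 0); first exact: cvg_cst.
    by apply/funext => N; rewrite seriesE big1.
  have a0 : a = fun=> 0 by apply: zero => m; rewrite scale0r.
  have a1 : a = fun m => (m == n)%:R.
    by apply: zero => m; case: eqP => [->|_]; rewrite ?fn0 ?scaler0// scale0r.
  have := congr1 (fun g => g n) a1; rewrite a0 eqxx => /eqP.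
  by rewrite eq_sym oner_eq0.
have [P [C [C0 EP Px Plin [Psum PC]]]] := UFDD_projections ((basis_UFDD f0).2 fb).
have ex n : exists c : X -> K, forall x, P n x = c x *: f n.
  have ex' x : exists a : K, P n x = a *: f n by exact: EP.
  by have [c hc] := choice ex'; exists c.
have [c hc] := choice ex.
have inj_f n (a b : K) : a *: f n = b *: f n -> a = b.
  by move/eqP; rewrite -subr_eq0 -scalerBl scaler_eq0 (negbTE (f0 n)) orbF subr_eq0 => /eqP.
exists c, C; split=> //.
- move=> x; have := Px x; by under eq_fun do under eq_bigr do rewrite hc.
- by move=> n a x y; apply: (inj_f n); rewrite -hc Plin !hc scalerDl scalerA.
- split=> [s a n us|s th x us th1].
    apply: (inj_f n); rewrite -hc Psum//; last by move=> i; exists (a i).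
    by case: ifP; rewrite ?scale0r.
  by have := PC s th x us th1; under eq_bigr do rewrite hc scalerA.
Qed.

Lemma coordinates_unc f c C : coordinates f c C -> unc f C.
Proof.
move=> [C0 _ _ _ [csum cC]]; split=> // s a th us th1.
have := cC s th (\sum_(i <- s) a i *: f i) us th1.
by rewrite (eq_big_seq (fun i => (th i * a i) *: f i))// => i si; rewrite csum// si.
Qed.

Lemma coordinates_dense f c C : coordinates f c C -> dense_span f.
Proof.
move=> [_ _ fx _ _] x e /(fx x)[N /(_ N (leqnn N))]; rewrite nrmBC => h.
by exists (index_iota 0 N), (c^~ x); rewrite big_mkord.
Qed.

Lemma basis_criterion (f : nat -> X) C :
  (forall n, f n != 0) -> unc f C -> dense_span f -> unconditional_basis f.
Proof.
move=> f0 uf df; apply/(basis_UFDD f0); have C0 : 0 <= C by have [] := uf.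
apply: (UFDD_criterion (C := C)) => //.
- by move=> n; exact: line_finite_dimensional.
- move=> s y m us /choice[a ya]; under eq_bigr do rewrite ya.
  by under [X in _ <= _ * nrm X]eq_bigr do rewrite ya; exact: unc_subset.
- move=> x e /(df x)[s [a h]].
  exists (\max_(i <- s) i).+1, (fun n => (\sum_(i <- s | i == n) a i) *: f n); split.
    by move=> n; eexists.
  suff -> : \sum_(n < (\max_(i <- s) i).+1) (\sum_(i <- s | i == n) a i) *: f n =
    \sum_(i <- s) a i *: f i by [].
  under [LHS]eq_bigr do rewrite scaler_suml big_mkcond.
  rewrite exchange_big /= big_seq [RHS]big_seq; apply: eq_bigr => i si.
  have im : (i < (\max_(i <- s) i).+1)%N by rewrite ltnS; exact: leq_bigmax_seq.
  rewrite (bigD1 (Ordinal im))//= eqxx big1 ?addr0// => j.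
  by rewrite -val_eqE /= eq_sym => /negbTE ->.
Qed.

End Complete.
End Bases.

(** * Changing a basis inside disjoint blocks *)

Section Stability.
Context (R : realType) (k : scalar_kind).
Local Notation K := (scalars R k).
Local Notation "t %:K" := (@of_real R k t) (at level 2, format "t %:K").
Context (X : completeNormedModType K).

(** The second condition of the theorem, kept under a name while its consequences are drawn. *)
Definition stable := forall (E : nat -> set X) (d : nat -> nat) (f : forall n, 'I_(d n) -> X)
          (u : nat -> K),
     UFDD E -> (forall n, finite_basis (E n) (f n)) ->
     (forall n, is_ubc (f n) (u n)) -> has_ubound (range u) ->
     unconditional_basis_family
       (fun i : {n : nat & 'I_(d n)} => f (tag i) (tagged i)).

(** The infimum of the admissible constants is admissible. *)
Lemma is_ubc_exists d (f : 'I_d -> X) (C : R) : 0 <= C ->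
  (forall a eps : 'I_d -> K, (forall i, modulus (eps i) <= 1) ->
     nrm (\sum_i (eps i * a i) *: f i) <= C * nrm (\sum_i a i *: f i)) ->
  exists2 u : R, u <= C & is_ubc f u%:K.
Proof.
move=> C0 hC; have mod1 (z : K) : `|z| = 1 -> modulus z = 1.
  by move=> z1; apply: (@of_real_inj R k); rewrite modulusE z1 of_real1.
pose S := [set c : R | 0 <= c /\ forall a eps : 'I_d -> K, (forall i, modulus (eps i) = 1) ->
     nrm (\sum_i (eps i * a i) *: f i) <= c * nrm (\sum_i a i *: f i)].
have SC : S C by split=> // a eps e1; apply: hC => i; rewrite e1.
have lbS : lbound S 0 by move=> c [].
have infS : has_inf S by split; [exists C | exists 0].
have inf0 : 0 <= inf S by apply: lb_le_inf => //; exists C.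
exists (inf S); first by apply: ge_inf => //; exists 0.
split.
  split=> [|a eps e1]; first by rewrite -(of_real0 R k) of_real_le.
  rewrite -!nrmE -of_realM of_real_le.
  have [z0|z0] := eqVneq (nrm (\sum_i a i *: f i)) 0.
    have [_ /(_ a eps)] := SC; rewrite z0 !mulr0; apply => i; exact: mod1.
  have zp : 0 < nrm (\sum_i a i *: f i) by rewrite lt_neqAle eq_sym z0 nrm_ge0.
  rewrite -ler_pdivrMr//; apply: lb_le_inf => [|c [_ hc]]; first by exists C.
  by rewrite ler_pdivrMr//; apply: hc => i; exact: mod1.
move=> c [c0 hc]; have cE : c = (modulus c)%:K by rewrite modulusE ger0_norm.
rewrite cE of_real_le; apply: ge_inf; first by exists 0.
split=> [|a eps e1]; first exact: modulus_ge0.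
rewrite -(of_real_le k) of_realM !nrmE -cE; apply: hc => i.
by rewrite -modulusE e1 of_real1.
Qed.

Lemma sum_ord_nth (V : nmodType) (s : seq nat) (g : nat -> V) :
  \sum_(i < size s) g (nth 0%N s i) = \sum_(i <- s) g i.
Proof. by rewrite (big_nth 0%N) big_mkord. Qed.

Lemma extend_ord (s : seq nat) (a : 'I_(size s) -> K) : uniq s ->
  exists b : nat -> K, forall i : 'I_(size s), b (nth 0%N s i) = a i.
Proof.
move=> us; exists (fun j => if insub (index j s) is Some i then a i else 0) => i.
by rewrite index_uniq// insubT// => p; congr a; apply: val_inj.
Qed.

(** The spans of the blocks, together with the lines of the remaining vectors, form a
    decomposition; inside each block the new vectors inherit unconditionality from [e]. *)
Lemma stable_blocks (e f : nat -> X) (D : nat -> seq nat) (c : R) :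
  stable -> unconditional_basis e ->
  (forall q, uniq (D q)) -> (forall q q' i, i \in D q -> i \in D q' -> q = q') ->
  (forall i, (forall q, i \notin D q) -> f i = e i) ->
  (forall q i, i \in D q -> exists b : nat -> K, f i = \sum_(j <- D q) b j *: e j) ->
  (forall q i, i \in D q -> exists b : nat -> K, e i = \sum_(j <- D q) b j *: f j) ->
  (forall q a, nrm (\sum_(i <- D q) a i *: f i) <= c * nrm (\sum_(i <- D q) a i *: e i)) ->
  (forall q a, nrm (\sum_(i <- D q) a i *: e i) <= c * nrm (\sum_(i <- D q) a i *: f i)) ->
  exists C, unc f C.
Proof.
move=> st eb uD disjD f_out f_span e_span f_le e_le.
have [co [C0 hco]] := basis_coordinates eb.
have ue := coordinates_unc hco; have C00 : 0 <= C0 by have [] := ue.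
have e0 i : e i != 0 by have [_ h _ _ _] := hco.
have c_ge0 i q : i \in D q -> 0 <= c.
  move=> iq; pose a j : K := if j == i then 1 else 0.
  have ai : \sum_(j <- D q) a j *: e j = e i.
    rewrite (bigD1_seq i)//= /a eqxx scale1r big1 ?addr0// => j /negbTE ->.
    by rewrite scale0r.
  have := f_le q a; rewrite ai => h; have := le_trans (nrm_ge0 _) h.
  by rewrite pmulr_lge0// nrm_gt0.
pose c' := Num.max c 1.
have c'1 : 1 <= c' by rewrite le_max lexx orbT.
have c'0 : 0 <= c' by rewrite (le_trans ler01).
have cc' : c <= c' by rewrite le_max lexx.
(* The blocks sit at even places; the indices outside all blocks sit alone at odd places. *)
pose B n := if odd n then (if `[< exists q, n./2 \in D q >] then [::] else [:: n./2])
            else D n./2.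
have uB n : uniq (B n) by rewrite /B; case: ifP => // _; case: ifP.
have disjB n m i : i \in B n -> i \in B m -> n = m.
  have half_inj : odd n = odd m -> n./2 = m./2 -> n = m.
    by move=> h1 h2; rewrite -(odd_double_half n) h1 h2 odd_double_half.
  rewrite /B; case on : (odd n); case om : (odd m).
  - case: asboolP => // _; case: asboolP => // _; rewrite !inE => /eqP -> /eqP h.
    by apply: half_inj; rewrite ?on ?om.
  - case: asboolP => // noq; rewrite inE => /eqP -> im; case: noq; by exists m./2.
  - move=> im; case: asboolP => // noq; rewrite inE => /eqP ni; case: noq.
    by rewrite -ni; exists n./2.
  - by move=> h1 h2; apply: half_inj; rewrite ?on ?om// (disjD _ _ _ h1 h2).
have covB i : exists n, i \in B n.
  have [[q iq]|noq] := pselect (exists q, i \in D q).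
    by exists q.*2; rewrite /B odd_double doubleK.
  exists i.*2.+1; rewrite /B /= odd_double /= uphalf_double.
  by case: asboolP => // _; rewrite mem_head.
have [be hbe] := choice covB.
have beE i n : i \in B n -> be i = n by exact: disjB (hbe i).
have fB_le n a : nrm (\sum_(i <- B n) a i *: f i) <= c' * nrm (\sum_(i <- B n) a i *: e i).
  rewrite /B; case: ifP => _; last first.
    by rewrite (le_trans (f_le _ _))// ler_wpM2r ?nrm_ge0.
  case: asboolP => [_|noq]; first by rewrite !big_nil nrm0 mulr0.
  rewrite !big_seq1 f_out ?ler_peMl ?nrm_ge0// => q; apply/negP => h; apply: noq.
  by exists q.
have eB_le n a : nrm (\sum_(i <- B n) a i *: e i) <= c' * nrm (\sum_(i <- B n) a i *: f i).
  rewrite /B; case: ifP => _; last first.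
    by rewrite (le_trans (e_le _ _))// ler_wpM2r ?nrm_ge0.
  case: asboolP => [_|noq]; first by rewrite !big_nil nrm0 mulr0.
  rewrite !big_seq1 f_out ?ler_peMl ?nrm_ge0// => q; apply/negP => h; apply: noq.
  by exists q.
have f_spanB n i : i \in B n -> exists b : nat -> K, f i = \sum_(j <- B n) b j *: e j.
  rewrite /B; case: ifP => _; last exact: f_span.
  case: asboolP => // noq; rewrite inE => /eqP ->; exists (fun=> 1).
  rewrite big_seq1 scale1r f_out// => q; apply/negP => h; apply: noq.
  by exists q.
have e_spanB n i : i \in B n -> exists b : nat -> K, e i = \sum_(j <- B n) b j *: f j.
  rewrite /B; case: ifP => _; last exact: e_span.
  case: asboolP => // noq; rewrite inE => /eqP ->; exists (fun=> 1).
  rewrite big_seq1 scale1r f_out// => q; apply/negP => h; apply: noq.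
  by exists q.
clearbody B.
pose E n := [set x : X | exists a : nat -> K, x = \sum_(i <- B n) a i *: e i].
pose d n := size (B n).
pose g n (i : 'I_(d n)) := f (nth 0%N (B n) i).
have spanT (h1 h2 : nat -> X) n a :
    (forall i, i \in B n -> exists b : nat -> K, h1 i = \sum_(j <- B n) b j *: h2 j) ->
    exists b : nat -> K, \sum_(i <- B n) a i *: h1 i = \sum_(j <- B n) b j *: h2 j.
  move=> sp; have ex i : exists b : nat -> K, i \in B n -> h1 i = \sum_(j <- B n) b j *: h2 j.
    by have [/sp[b ->]|_] := boolP (i \in B n); [exists b | exists (fun=> 0)].
  have [b hb] := choice ex; exists (fun j => \sum_(i <- B n) a i * b i j).
  under [RHS]eq_bigr do rewrite scaler_suml; rewrite exchange_big /=.
  apply: eq_big_seq => i iB; rewrite (hb i iB) scaler_sumr.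
  by apply: eq_bigr => j _; rewrite scalerA.
have free (h : nat -> X) n :
    (forall a, nrm (\sum_(i <- B n) a i *: e i) <= c' * nrm (\sum_(i <- B n) a i *: h i)) ->
    forall a, \sum_(i <- B n) a i *: h i = 0 -> forall i, i \in B n -> a i = 0.
  move=> he a a0 i iB; have := he a; rewrite a0 nrm0 mulr0 => le0.
  have := unc_coordinate a ue (uB n) iB.
  have -> : nrm (\sum_(i <- B n) a i *: e i) = 0 by apply/le_anti; rewrite le0 nrm_ge0.
  rewrite mulr0 pmulr_lle0 ?nrm_gt0// => m0; apply/modulus_eq0/le_anti.
  by rewrite m0 modulus_ge0.
have fin_basis (h : nat -> X) n :
    (forall i, i \in B n -> exists b : nat -> K, h i = \sum_(j <- B n) b j *: e j) ->
    (forall i, i \in B n -> exists b : nat -> K, e i = \sum_(j <- B n) b j *: h j) ->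
    (forall a, nrm (\sum_(i <- B n) a i *: e i) <= c' * nrm (\sum_(i <- B n) a i *: h i)) ->
    finite_basis (E n) (fun i : 'I_(d n) => h (nth 0%N (B n) i)).
  move=> he eh hle; split=> [a|x [a ->]].
    have [b hb] := extend_ord a (uB n).
    under eq_bigr do rewrite -hb.
    by rewrite (sum_ord_nth (B n) (fun i => b i *: h i)); exact: spanT.
  have [b ->] := spanT e h n a eh.
  exists (fun i => b (nth 0%N (B n) i)); split.
    by rewrite (sum_ord_nth (B n) (fun i => b i *: h i)).
  move=> b'; have [b1 hb1] := extend_ord b' (uB n) => eq.
  apply/funext => i; rewrite -hb1; apply/eqP; rewrite -subr_eq0; apply/eqP.
  apply: (free h n hle (fun j => b j - b1 j)); last by rewrite mem_nth// ltn_ord.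
  under eq_bigr do rewrite scalerBl; rewrite sumrB eq; apply/eqP; rewrite subr_eq0.
  rewrite -(sum_ord_nth (B n) (fun i => b1 i *: h i)); apply/eqP.
  by apply: eq_bigr => j _; rewrite hb1.
have flat_uniq (s : seq nat) : uniq s -> uniq (flatten (map B s)).
  elim: s => //= n s ih /andP[ns us]; rewrite cat_uniq uB ih//= andbT.
  apply/hasPn => i /flatten_mapP[m ms im]; apply/negP => iB.
  by rewrite (disjB _ _ _ iB im) ms in ns.
have flat_sum (s : seq nat) (m : pred nat) (a : nat -> nat -> K) :
    \sum_(n <- s | m n) \sum_(i <- B n) a n i *: e i =
    \sum_(i <- flatten (map B s) | m (be i)) a (be i) i *: e i.
  elim: s => [|n s ih]; first by rewrite !big_nil.
  rewrite big_cons /= big_cat /= -ih.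
  have -> : \sum_(i <- B n | m (be i)) a (be i) i *: e i =
      if m n then \sum_(i <- B n) a n i *: e i else 0.
    rewrite big_seq_cond; case: ifP => mn.
      rewrite [RHS]big_seq; apply: eq_big => [i|i /andP[/beE -> _]//].
      by case: (boolP (i \in B n)) => //= /beE ->.
    by rewrite big1// => i /andP[/beE ->]; rewrite mn.
  by case: (m n); rewrite ?add0r.
have ufdd : UFDD E.
  apply: (UFDD_criterion (C := C0)) => //.
  - move=> n; exists (d n), (fun i : 'I_(d n) => e (nth 0%N (B n) i)).
    apply: fin_basis => [i iB|i iB|a].
    + exists (fun j => if j == i then 1 else 0).
      rewrite (bigD1_seq i)//= eqxx scale1r big1 ?addr0// => j /negbTE ->.
      by rewrite scale0r.
    + exists (fun j => if j == i then 1 else 0).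
      rewrite (bigD1_seq i)//= eqxx scale1r big1 ?addr0// => j /negbTE ->.
      by rewrite scale0r.
    + by rewrite ler_peMl ?nrm_ge0.
  - move=> s y m us /choice[a ya].
    under eq_bigr do rewrite ya.
    under [X in _ <= _ * nrm X]eq_bigr do rewrite ya.
    rewrite (flat_sum s m a) (flat_sum s predT a).
    apply: unc_subset => //; exact: flat_uniq.
  - move=> x e1 e10; have [_ _ /(_ x e1 e10)[N hN] _ _] := hco.
    pose a i := if (i < N)%N then co i x else 0.
    exists (\max_(i < N) be i).+1, (fun n => \sum_(i <- B n) a i *: e i); split.
      by move=> n; exists a.
    have := hN N (leqnn N); rewrite nrmBC.
    suff -> : \sum_(n < (\max_(i < N) be i).+1) \sum_(i <- B n) a i *: e i =
      \sum_(i < N) co i x *: e i by [].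
    set M := (\max_(i < N) be i).+1.
    rewrite -(big_mkord xpredT (fun n => \sum_(i <- B n) a i *: e i)).
    rewrite (flat_sum _ predT (fun _ => a)).
    have uL : uniq (flatten (map B (index_iota 0 M))) by rewrite flat_uniq ?iota_uniq.
    have memL i : (i < N)%N -> i \in flatten (map B (index_iota 0 M)).
      move=> iN; apply/flatten_mapP; exists (be i) => //.
      by rewrite mem_index_iota /= ltnS; exact: (leq_bigmax (Ordinal iN)).
    move: (flatten _) uL memL => L uL memL; rewrite (bigID (fun i => i < N)%N) /= addrC big1 ?add0r.
      rewrite -(big_mkord xpredT (fun i => co i x *: e i)) -big_filter.
      rewrite (perm_big (index_iota 0 N)) /=.
        by apply: eq_big_nat => i /andP[_ iN]; rewrite /a iN.
      apply: uniq_perm; rewrite ?iota_uniq//.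
        exact: filter_uniq.
      move=> i; rewrite mem_filter mem_index_iota /=.
      by case: (boolP (i < N)%N) => //= /memL ->.
    by move=> i /negbTE; rewrite /a => ->; rewrite scale0r.
have block_unc n (a eps : 'I_(d n) -> K) : (forall i, modulus (eps i) <= 1) ->
    nrm (\sum_i (eps i * a i) *: g n i) <= c' * C0 * c' * nrm (\sum_i a i *: g n i).
  move=> e1; have [b hb] := extend_ord a (uB n); have [th hth] := extend_ord eps (uB n).
  have -> : \sum_i (eps i * a i) *: g n i = \sum_(i <- B n) (th i * b i) *: f i.
    rewrite -(sum_ord_nth (B n) (fun i => (th i * b i) *: f i)).
    by apply: eq_bigr => i _; rewrite hb hth.
  have -> : \sum_i a i *: g n i = \sum_(i <- B n) b i *: f i.
    rewrite -(sum_ord_nth (B n) (fun i => b i *: f i)).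
    by apply: eq_bigr => i _; rewrite hb.
  rewrite (le_trans (fB_le _ _))// -!mulrA ler_wpM2l//.
  apply: (@le_trans _ _ (C0 * nrm (\sum_(i <- B n) b i *: e i))).
    apply: unc_le => // i iB; rewrite modulusM ler_piMl ?modulus_ge0//.
    by have [j jn <-] := nthP 0%N iB; rewrite (hth (Ordinal jn)).
  by rewrite ler_wpM2l.
have /choice[u hu] n : exists u : R, u <= c' * C0 * c' /\ is_ubc (g n) u%:K.
  by have [|u ? ?] := is_ubc_exists _ (block_unc n); [rewrite !mulr_ge0|exists u].
have gb n : finite_basis (E n) (@g n).
  by apply: fin_basis => [i /f_spanB|i /e_spanB|].
have gu n : is_ubc (@g n) (u n)%:K by have [] := hu n.
have ub : has_ubound (range (fun n => (u n)%:K)).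
  exists (c' * C0 * c')%:K => _ [n _ <-]; rewrite of_real_le; by have [] := hu n.
have [s [[s' ss' s's] /basis_coordinates[co' [C hco']]]] := st E d g _ ufdd gb gu ub.
exists C.
have pos i : (index i (B (be i)) < d (be i))%N by rewrite index_mem.
pose t i : {n : nat & 'I_(d n)} := Tagged (fun n => 'I_(d n)) (Ordinal (pos i)).
have ft i : f i = g (tag (t i)) (tagged (t i)) by rewrite /g /= nth_index.
have := unc_inj (h := s' \o t) _ (coordinates_unc hco').
suff -> : (fun i => g (tag i) (tagged i)) \o s \o (s' \o t) = f.
  apply => i j /= /(can_inj s's) tij; have := hbe i; have := hbe j.
  have bij : be i = be j by have := congr1 (@tag _ _) tij.
  have : nth 0%N (B (tag (t i))) (tagged (t i)) = nth 0%N (B (tag (t j))) (tagged (t j)).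
    by rewrite tij.
  by rewrite /= !nth_index.
by apply/funext => i /=; rewrite s's -ft.
Qed.

End Stability.

(** * Rank-one projections onto block vectors *)

Section RankOne.
Context (R : realType) (k : scalar_kind).
Local Notation K := (scalars R k).
Local Notation "t %:K" := (@of_real R k t) (at level 2, format "t %:K").
Context (X : completeNormedModType K).

Lemma sum_blocks (V : nmodType) (D : nat -> seq nat) (be : nat -> nat) (s : seq nat)
    (F : nat -> nat -> V) :
  (forall q i, q \in s -> i \in D q -> be i = q) ->
  \sum_(q <- s) \sum_(i <- D q) F q i = \sum_(i <- flatten (map D s)) F (be i) i.
Proof.
elim: s => [|q s ih] h; first by rewrite !big_nil.
rewrite big_cons /= big_cat /= -ih; last first.
  by move=> q' i q's; apply: h; rewrite inE q's orbT.
congr (_ + _); by apply: eq_big_seq => i iD; rewrite (h q i (mem_head _ _) iD).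
Qed.

Lemma uniq_flatten_blocks (D : nat -> seq nat) (be : nat -> nat) (s : seq nat) :
  (forall q, q \in s -> uniq (D q)) ->
  (forall q i, q \in s -> i \in D q -> be i = q) -> uniq s ->
  uniq (flatten (map D s)).
Proof.
elim: s => //= q s ih uD h /andP[qs us].
rewrite cat_uniq uD ?mem_head//= ih//; last 2 first.
- by move=> q' q's; apply: uD; rewrite inE q's orbT.
- by move=> q' i q's; apply: h; rewrite inE q's orbT.
rewrite andbT; apply/hasPn => i /flatten_mapP[q' q's iq']; apply/negP => iq.
have q'E : be i = q' by apply: h iq'; rewrite inE q's orbT.
by move: qs; rewrite -(h q i (mem_head _ _) iq) q'E q's.
Qed.

Section Swap.
Context (e : nat -> X) (C c1 : R) (j : nat) (B : seq nat) (w g : nat -> K).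
Context (ue : unc e C).
Context (e1 : forall n, nrm (e n) = 1).
Context (ujB : uniq (j :: B)).
Context (c10 : 0 <= c1).
Context (w_le : nrm (\sum_(i <- B) w i *: e i) <= c1).
Context (g_le : forall a : nat -> K,
  modulus (\sum_(i <- B) g i * a i) <= c1 * nrm (\sum_(i <- B) a i *: e i)).
Context (gw : \sum_(i <- B) g i * w i = 1).

Let W := \sum_(i <- B) w i *: e i.
Let phi (a : nat -> K) := \sum_(i <- B) g i * a i.

(** Exchanges [e j] and the block vector with coefficients [w]; identity on the kernels of
    the two functionals. *)
Definition swap_coef (a : nat -> K) i : K :=
  if i == j then phi a else a i + (a j - phi a) * w i.

Definition swap_vec i : X := if i == j then W else e i - g i *: W + g i *: e j.

Let neqj i : i \in B -> (i == j) = false.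
Proof. by move=> iB; apply/negbTE/eqP => ij; move: ujB; rewrite /= -ij iB. Qed.

Lemma swap_sum a : \sum_(i <- j :: B) a i *: swap_vec i =
  \sum_(i <- j :: B) swap_coef a i *: e i.
Proof.
rewrite !big_cons /swap_vec /swap_coef eqxx.
rewrite (eq_big_seq (fun i => a i *: e i - (g i * a i) *: W + (g i * a i) *: e j)); last first.
  move=> i iB; rewrite neqj// scalerDr scalerBr !scalerA.
  by rewrite [a i * g i]mulrC.
rewrite [in RHS](eq_big_seq (fun i => a i *: e i + (a j - phi a) *: (w i *: e i))); last first.
  by move=> i iB /=; rewrite neqj// scalerA -scalerDl.
rewrite !big_split /= -scaler_sumr sumrN -!scaler_suml -/(phi a) -/W scalerBl.
by rewrite [RHS]addrC addrA; congr (_ + _); rewrite addrCA.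
Qed.

Let phi_swap a : phi (swap_coef a) = a j.
Proof.
rewrite /phi (eq_big_seq (fun i => g i * a i + (a j - phi a) * (g i * w i))); last first.
  by move=> i iB; rewrite /swap_coef neqj// mulrDr mulrCA.
by rewrite big_split /= -mulr_sumr gw mulr1 -/(phi a) addrC subrK.
Qed.

Lemma swap_coefK a i : swap_coef (swap_coef a) i = a i.
Proof.
rewrite {1}/swap_coef phi_swap; case: eqP => [-> //|/eqP ij].
rewrite /swap_coef eqxx (negbTE ij) -addrA -mulrDl.
by rewrite [X in X * _](_ : _ = 0) ?mul0r ?addr0//; ring.
Qed.

Lemma swap_sum_inv a : \sum_(i <- j :: B) a i *: e i =
  \sum_(i <- j :: B) swap_coef a i *: swap_vec i.
Proof. by rewrite swap_sum; apply: eq_bigr => i _; rewrite swap_coefK. Qed.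

Lemma swap_le a : nrm (\sum_(i <- j :: B) swap_coef a i *: e i) <=
  C * (1 + c1 + c1 + c1 * c1) * nrm (\sum_(i <- j :: B) a i *: e i).
Proof.
set N := nrm (\sum_(i <- j :: B) a i *: e i).
have C0 : 0 <= C by have [] := ue.
have N0 : 0 <= N by exact: nrm_ge0.
have hj : modulus (a j) <= C * N.
  by have := unc_coordinate a ue ujB (mem_head _ _); rewrite e1 mulr1.
have hB : nrm (\sum_(i <- B) a i *: e i) <= C * N.
  have := unc_subset a (mem B) ue ujB; rewrite -big_filter /=.
  have -> : (j \in B) = false by apply/negbTE; move: ujB => /andP[].
  by rewrite (_ : [seq x <- B | mem B x] = B)//; apply/all_filterP/allP.
have hphi : modulus (phi a) <= c1 * (C * N).
  by apply: le_trans (g_le a) _; rewrite ler_wpM2l.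
rewrite big_cons {1}/swap_coef eqxx.
rewrite (eq_big_seq (fun i => a i *: e i + (a j - phi a) *: (w i *: e i))); last first.
  by move=> i iB; rewrite /swap_coef neqj// scalerDl scalerA.
rewrite big_split /= -scaler_sumr.
apply: le_trans (nrmD _ _) _; rewrite nrmZ e1 mulr1.
apply: le_trans (lerD hphi (nrmD _ _)) _; rewrite nrmZ.
have haj : modulus (a j - phi a) <= C * N + c1 * (C * N).
  by rewrite (le_trans (modulusD _ _))// modulusN lerD.
have := ler_pM (modulus_ge0 _) (nrm_ge0 _) haj w_le.
by move: hB; lra.
Qed.

End Swap.

(** In every block the vector of index [j q] is swapped with the block vector of coefficients
    [w q]. The new family is unconditional by stability, hence projecting on the vectors of
    index [j q] is bounded, and this projection is [phi q (x) w q] on the span of the blocks. *)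
Lemma rank_one_bounded (e : nat -> X) (C c1 : R) (act : pred nat) (j : nat -> nat)
    (B : nat -> seq nat) (w g : nat -> nat -> K) :
  stable X -> unconditional_basis e -> unc e C -> (forall n, nrm (e n) = 1) -> 0 <= c1 ->
  (forall q, act q -> uniq (j q :: B q)) ->
  (forall q q' i, act q -> act q' -> i \in j q :: B q -> i \in j q' :: B q' -> q = q') ->
  (forall q, act q -> nrm (\sum_(i <- B q) w q i *: e i) <= c1) ->
  (forall q a, act q -> modulus (\sum_(i <- B q) g q i * a i) <=
     c1 * nrm (\sum_(i <- B q) a i *: e i)) ->
  (forall q, act q -> \sum_(i <- B q) g q i * w q i = 1) ->
  exists2 M : R, 0 <= M & forall (s : seq nat) (a : nat -> nat -> K), uniq s -> all act s ->
    nrm (\sum_(q <- s) (\sum_(i <- B q) g q i * a q i) *: \sum_(i <- B q) w q i *: e i) <=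
    M * nrm (\sum_(q <- s) \sum_(i <- B q) a q i *: e i).
Proof.
move=> st eb ue e1 c10 uD disjD w_le g_le gw.
pose D q := if act q then j q :: B q else [::].
have memD q i : i \in D q -> act q /\ i \in j q :: B q.
  by rewrite /D; case: (boolP (act q)).
have Dact q : act q -> D q = j q :: B q by rewrite /D => ->.
have disj q q' i : i \in D q -> i \in D q' -> q = q'.
  by move=> /memD[aq iq] /memD[aq' iq']; exact: disjD iq iq'.
have ex i : exists o : option nat,
    if o is Some q then i \in D q else forall q, i \notin D q.
  have [[q iq]|no] := pselect (exists q, i \in D q); first by exists (Some q).
  by exists None => q; apply/negP => iq; apply: no; exists q.
have [blk hblk] := choice ex.
have blkE q i : i \in D q -> blk i = Some q.
  move=> iq; have := hblk i; case: (blk i) => [q'|/(_ q)]; last by rewrite iq.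
  by move=> /disj /(_ iq) ->.
pose sv q := swap_vec e (j q) (B q) (w q) (g q).
pose sc q := swap_coef (j q) (B q) (w q) (g q).
pose f i := if blk i is Some q then sv q i else e i.
have fE q a : \sum_(i <- D q) a i *: f i = \sum_(i <- D q) a i *: sv q i.
  by apply: eq_big_seq => i iq; rewrite /f (blkE q).
have fsum q a : \sum_(i <- D q) a i *: f i = \sum_(i <- D q) sc q a i *: e i.
  rewrite fE; have [aq|naq] := boolP (act q); last by rewrite /D (negbTE naq) !big_nil.
  by rewrite Dact// swap_sum// uD.
have esum q a : \sum_(i <- D q) a i *: e i = \sum_(i <- D q) sc q a i *: f i.
  rewrite fE; have [aq|naq] := boolP (act q); last by rewrite /D (negbTE naq) !big_nil.
  by rewrite Dact// [LHS](swap_sum_inv _ (g := g q) (w := w q))// ?uD ?gw.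
pose c := C * (1 + c1 + c1 + c1 * c1).
have scle q a : nrm (\sum_(i <- D q) sc q a i *: e i) <= c * nrm (\sum_(i <- D q) a i *: e i).
  have [aq|naq] := boolP (act q); last by rewrite /D (negbTE naq) !big_nil nrm0 mulr0.
  by rewrite Dact//; apply: swap_le; rewrite ?uD ?w_le// => b; exact: g_le.
have single q i (h : nat -> X) : i \in D q ->
    h i = \sum_(l <- D q) (if l == i then 1 : K else 0) *: h l.
  move=> iq; have uq : uniq (D q) by have [/uD + _] := memD _ _ iq; rewrite /D; case: ifP.
  rewrite (bigD1_seq i)//= eqxx scale1r big1 ?addr0// => l /negbTE ->.
  by rewrite scale0r.
have [C' uf] : exists C', unc f C'.
  apply: (stable_blocks (D := D) (c := c) st eb) => //.
  - by move=> q; rewrite /D; case: ifP => // /uD.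
  - move=> i iD; rewrite /f; have := hblk i; case: (blk i) => // q.
    by rewrite (negbTE (iD q)).
  - by move=> q i iq; rewrite (single q i f iq) fsum; eexists.
  - by move=> q i iq; rewrite (single q i e iq) esum; eexists.
  - by move=> q a; rewrite fsum.
  - by move=> q a; have := scle q (sc q a); rewrite -(fsum q (sc q a)) -(esum q a) -(fsum q a).
exists C'; first by have [] := uf.
move=> s a us /allP acts.
pose a' q i := if i == j q then 0 else a q i.
have Bj q i : act q -> i \in B q -> (i == j q) = false.
  by move=> /uD /= /andP[jB _] iB; apply: contraNF jB => /eqP <-.
have aB q : act q -> \sum_(i <- B q) a q i *: e i = \sum_(i <- D q) a' q i *: e i.
  move=> aq; rewrite Dact// big_cons /a' eqxx scale0r add0r.
  by apply: eq_big_seq => i iB; rewrite (Bj q).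
rewrite [X in _ <= _ * nrm X](eq_big_seq (fun q => \sum_(i <- D q) sc q (a' q) i *: f i)); last first.
  by move=> q /acts aq; rewrite aB// esum.
pose be i := odflt 0%N (blk i).
have beE q i : q \in s -> i \in D q -> be i = q by move=> _ /blkE; rewrite /be => ->.
rewrite (sum_blocks (fun q i => sc q (a' q) i *: f i) beE).
have uL : uniq (flatten (map D s)).
  by apply: (uniq_flatten_blocks (be := be)) => // q /acts aq; rewrite Dact// uD.
have := unc_subset (fun i => sc (be i) (a' (be i)) i) (fun i => i == j (be i)) uf uL.
apply: le_trans; rewrite le_eqVlt; apply/orP; left; apply/eqP; congr nrm.
rewrite [RHS]big_mkcond -[RHS](sum_blocks (fun q i =>
  if i == j q then sc q (a' q) i *: f i else 0) beE).
apply: eq_big_seq => q /acts aq; rewrite Dact// big_cons eqxx.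
rewrite [X in _ = _ + X]big_seq [X in _ = _ + X]big1 ?addr0; last by move=> i iB; rewrite (Bj q).
rewrite /f (blkE q); last by rewrite Dact// mem_head.
rewrite /sv /sc /swap_vec /swap_coef eqxx; congr (_ *: _).
by apply: eq_big_seq => i iB; rewrite /a' (Bj q).
Qed.

End RankOne.

(** * Uniformity over all families of blocks *)

Section GlidingHump.
Context (R : realType) (k : scalar_kind).
Local Notation K := (scalars R k).
Local Notation "t %:K" := (@of_real R k t) (at level 2, format "t %:K").
Context (X : completeNormedModType K).

Lemma uniq_flatten_inj (B : nat -> seq nat) (s : seq nat) n m i :
  uniq (flatten (map B s)) -> n \in s -> m \in s -> i \in B n -> i \in B m -> n = m.
Proof.
move=> uf ns ms iB iB'; move: uf ns ms; elim: s => //= q s ih.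
rewrite cat_uniq => /and3P[_ /hasPn disj us]; rewrite !inE.
have no p : p \in s -> i \in B p -> i \in B q -> False.
  move=> ps ip iq; have /disj : i \in flatten (map B s) by apply/flatten_mapP; exists p.
  by rewrite /= iq.
move=> /orP[/eqP nq|ns] /orP[/eqP mq|ms]; first by rewrite nq mq.
- by subst q; case: (no m).
- by subst q; case: (no n).
- exact: ih.
Qed.

Lemma uniq_flatten_block (B : nat -> seq nat) (s : seq nat) n :
  uniq (flatten (map B s)) -> n \in s -> uniq (B n).
Proof.
elim: s => //= q s ih; rewrite cat_uniq => /and3P[uq _ us]; rewrite inE.
by move=> /orP[/eqP ->|/(ih us)].
Qed.

Lemma uniq_flatten_filter (B : nat -> seq nat) (s : seq nat) (p : pred nat) :
  uniq (flatten (map B s)) -> uniq (flatten (map B [seq n <- s | p n])).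
Proof.
elim: s => //= q s ih; rewrite cat_uniq => /and3P[uq disj us].
case: ifP => _; last exact: ih.
rewrite /= cat_uniq uq ih//= andbT; apply/hasPn => i.
move=> /flatten_mapP[n]; rewrite mem_filter => /andP[_ ns] iB.
by have /hasPn/(_ i) := disj; apply; apply/flatten_mapP; exists n.
Qed.

Definition blocks_le (e : nat -> X) (c1 M : R) (L : nat) :=
  forall (s : seq nat) (B : nat -> seq nat) (w g a : nat -> nat -> K),
  uniq s -> uniq (flatten (map B s)) -> all (leq L) (flatten (map B s)) ->
  (forall n, n \in s -> nrm (\sum_(i <- B n) w n i *: e i) <= c1) ->
  (forall n b, n \in s -> modulus (\sum_(i <- B n) g n i * b i) <=
     c1 * nrm (\sum_(i <- B n) b i *: e i)) ->
  (forall n, n \in s -> \sum_(i <- B n) g n i * w n i = 1) ->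
  nrm (\sum_(n <- s) (\sum_(i <- B n) g n i * a n i) *: \sum_(i <- B n) w n i *: e i) <=
  M * nrm (\sum_(n <- s) \sum_(i <- B n) a n i *: e i).

(** At most [L] of the disjoint blocks meet the indices below [L]; each of them contributes a
    bounded rank-one operator. *)
Lemma blocks_le_tail (e : nat -> X) (C c1 M : R) L :
  unc e C -> (forall n, nrm (e n) = 1) -> 0 <= c1 -> 0 <= M ->
  blocks_le e c1 M L -> blocks_le e c1 (M * C + L%:R * (c1 * c1 * C)) 0.
Proof.
move=> ue e1 c10 M0 hM s B w g a us uf _ hw hg gw.
have C0 : 0 <= C by have [] := ue.
pose lo n := has (gtn L) (B n).
pose T n := (\sum_(i <- B n) g n i * a n i) *: \sum_(i <- B n) w n i *: e i.
pose x n := \sum_(i <- B n) a n i *: e i.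
have [be hbe] : exists be : nat -> nat, forall n i, n \in s -> i \in B n -> be i = n.
  have ex i : exists q, forall n, n \in s -> i \in B n -> q = n.
    have [[n [ns iB]]|no] := pselect (exists n, n \in s /\ i \in B n).
      by exists n => m ms im; exact: uniq_flatten_inj uf ns ms iB im.
    by exists 0%N => n ns iB; case: no; exists n.
  by have [be hbe] := choice ex; exists be => n i; exact: hbe.
have sub (p : pred nat) : nrm (\sum_(n <- s | p n) x n) <= C * nrm (\sum_(n <- s) x n).
  have -> : \sum_(n <- s) x n = \sum_(i <- flatten (map B s)) a (be i) i *: e i.
    by rewrite -(sum_blocks (fun n i => a n i *: e i) hbe).
  have -> : \sum_(n <- s | p n) x n =
      \sum_(i <- flatten (map B s) | p (be i)) a (be i) i *: e i.
    rewrite [RHS]big_mkcond.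
    rewrite -[RHS](sum_blocks (fun n i => if p n then a n i *: e i else 0) hbe) big_mkcond.
    by apply: eq_bigr => n _; case: (p n) => //; rewrite big1.
  exact: unc_subset.
have hT n : n \in s -> nrm (T n) <= c1 * c1 * C * nrm (\sum_(n <- s) x n).
  move=> ns; rewrite /T nrmZ.
  apply: le_trans (ler_pM (modulus_ge0 _) (nrm_ge0 _) (hg n (a n) ns) (hw n ns)) _.
  rewrite mulrAC -[leRHS]mulrA ler_wpM2l ?mulr_ge0//.
  by have := sub (pred1 n); rewrite -big_filter filter_pred1_uniq// big_seq1.
rewrite -/(T _) (bigID lo) /= addrC mulrDl.
apply: le_trans (nrmD _ _) _; apply: lerD.
  rewrite -big_filter -mulrA; apply: le_trans (_ : M * nrm (\sum_(n <- s | ~~ lo n) x n) <= _).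
    rewrite -[X in _ <= _ * nrm X]big_filter; apply: hM => //.
    - exact: filter_uniq.
    - exact: uniq_flatten_filter.
    - apply/allP => i /flatten_mapP[n]; rewrite mem_filter => /andP[/hasPn nlo _] /nlo.
      by rewrite -leqNgt.
    - by move=> n; rewrite mem_filter => /andP[_ /hw].
    - by move=> n b; rewrite mem_filter => /andP[_ /hg].
    - by move=> n; rewrite mem_filter => /andP[_ /gw].
  by rewrite ler_wpM2l// sub.
apply: le_trans (nrm_sum _ _ _) _.
set Z := nrm (\sum_(n <- s) x n) in hT *.
apply: (@le_trans _ _ (\sum_(n <- s | lo n) c1 * c1 * C * Z)).
  by rewrite big_seq_cond [leRHS]big_seq_cond; apply: ler_sum => n /andP[/hT].
rewrite big_const_seq iter_addr_0 -[leRHS]mulrA mulr_natl.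
apply: ler_wpMn2l; first by rewrite !mulr_ge0// nrm_ge0.
apply: (@leq_trans (count (gtn L) (flatten (map B s)))).
  elim: (s) => //= n s' ih; rewrite count_cat.
  by apply: leq_add => //; rewrite /lo has_count; case: (count _ _).
rewrite -size_filter -[leqRHS](size_iota 0); apply: uniq_leq_size; first exact: filter_uniq.
by move=> i; rewrite mem_filter mem_iota => /andP[].
Qed.

(** If the constants could be arbitrarily bad, bad families of blocks could be chosen
    successively, each beyond all earlier ones, and used together. *)
Lemma blocks_le_uniform (e : nat -> X) (C c1 : R) :
  stable X -> unconditional_basis e -> unc e C -> (forall n, nrm (e n) = 1) -> 0 <= c1 ->
  exists2 M : R, 0 <= M & blocks_le e c1 M 0.
Proof.
move=> st eb ue e1 c10; have C0 : 0 <= C by have [] := ue.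
have [//|noM] := pselect (exists2 M : R, 0 <= M & blocks_le e c1 M 0).
have bad (p : nat * nat) : ~ blocks_le e c1 p.2%:R p.1.
  move=> h; apply: noM; exists (p.2%:R * C + p.1%:R * (c1 * c1 * C)).
    by rewrite addr_ge0// !mulr_ge0.
  exact: blocks_le_tail h.
pose datum := (seq nat * (nat -> seq nat) * (nat -> nat -> K) * (nat -> nat -> K) *
  (nat -> nat -> K))%type.
have ex (p : nat * nat) : exists d : datum, let: (s, B, w, g, a) := d in
  [/\ uniq s, uniq (flatten (map B s)), all (leq p.1) (flatten (map B s)),
    (forall n, n \in s -> nrm (\sum_(i <- B n) w n i *: e i) <= c1) &
   [/\ (forall n b, n \in s -> modulus (\sum_(i <- B n) g n i * b i) <=
     c1 * nrm (\sum_(i <- B n) b i *: e i)),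
    (forall n, n \in s -> \sum_(i <- B n) g n i * w n i = 1) &
    ~ nrm (\sum_(n <- s) (\sum_(i <- B n) g n i * a n i) *: \sum_(i <- B n) w n i *: e i) <=
      p.2%:R * nrm (\sum_(n <- s) \sum_(i <- B n) a n i *: e i)]].
  apply: contrapT => /forallNP no; apply: (bad p) => s B w g a h1 h2 h3 h4 h5 h6.
  by apply: contrapT => h7; apply: (no (s, B, w, g, a)).
have [F hF] := choice ex.
pose dS (d : datum) := d.1.1.1.1; pose dB (d : datum) := d.1.1.1.2.
pose dw (d : datum) := d.1.1.2; pose dg (d : datum) := d.1.2; pose da (d : datum) := d.2.
pose top d := (\max_(i <- flatten (map (dB d) (dS d))) i).+1.
pose nxt d := (top d + (\max_(n <- dS d) n).+1)%N.
(* The [m]-th family violates the bound [m] and lives beyond the families chosen before;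
   between [top] and [nxt] there is a free index for each of its blocks. *)
pose Lk := fix Lk m := if m is m'.+1 then nxt (F (Lk m', m')) else 0%N.
pose dat m := F (Lk m, m).
have hdat m : [/\ uniq (dS (dat m)), uniq (flatten (map (dB (dat m)) (dS (dat m)))),
    all (leq (Lk m)) (flatten (map (dB (dat m)) (dS (dat m)))),
    (forall n, n \in dS (dat m) -> nrm (\sum_(i <- dB (dat m) n) dw (dat m) n i *: e i) <= c1) &
   [/\ (forall n b, n \in dS (dat m) -> modulus (\sum_(i <- dB (dat m) n) dg (dat m) n i * b i) <=
     c1 * nrm (\sum_(i <- dB (dat m) n) b i *: e i)),
    (forall n, n \in dS (dat m) -> \sum_(i <- dB (dat m) n) dg (dat m) n i * dw (dat m) n i = 1) &
    ~ nrm (\sum_(n <- dS (dat m)) (\sum_(i <- dB (dat m) n) dg (dat m) n i * da (dat m) n i) *: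
        \sum_(i <- dB (dat m) n) dw (dat m) n i *: e i) <=
      m%:R * nrm (\sum_(n <- dS (dat m)) \sum_(i <- dB (dat m) n) da (dat m) n i *: e i)]].
  by have := hF (Lk m, m); rewrite /dat; case: (F _) => [[[[s B] w] g] a].
have LS m : Lk m.+1 = nxt (dat m) by [].
have B_lt m n i : n \in dS (dat m) -> i \in dB (dat m) n -> (Lk m <= i < top (dat m))%N.
  move=> nS iB; have iF : i \in flatten (map (dB (dat m)) (dS (dat m))).
    by apply/flatten_mapP; exists n.
  by have [_ _ /allP h _ _] := hdat m; rewrite h//= ltnS; exact: leq_bigmax_seq.
have topL m : (Lk m <= top (dat m))%N.
  have [_ _ hall _ [_ gw nb]] := hdat m; rewrite /top.
  have [s0|] := boolP (flatten (map (dB (dat m)) (dS (dat m))) == [::]); last first.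
    case E : (flatten _) hall => [//|i l] /andP[Li _] _.
    by rewrite big_cons (leq_trans Li)// leqW// leq_maxl.
  case: nb; have [->|[n nS]] : dS (dat m) = [::] \/ exists n, n \in dS (dat m).
    by case: (dS (dat m)) => [|n l]; [left | right; exists n; rewrite mem_head].
    by rewrite !big_nil nrm0 mulr0.
  have := gw n nS; rewrite big_seq big1 => [/eqP|i iB].
    by rewrite eq_sym oner_eq0.
  have : i \in flatten (map (dB (dat m)) (dS (dat m))) by apply/flatten_mapP; exists n.
  by rewrite (eqP s0).
have L_mono m m' : (m < m')%N -> (nxt (dat m) <= Lk m')%N.
  move=> mm'; rewrite -(subnK mm'); elim: (m' - m.+1)%N => [//|d ih].
  rewrite addSn LS (leq_trans ih)//; apply: leq_trans (topL _) _.
  by rewrite /nxt leq_addr.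
pose dec q := odflt (0%N, 0%N) (@pickle_inv (nat * nat)%type q).
pose act q := if @pickle_inv (nat * nat)%type q is Some p then p.2 \in dS (dat p.1) else false.
have act_dec q : act q -> (dec q).2 \in dS (dat (dec q).1) /\ pickle (dec q) = q.
  rewrite /act /dec; have := @pickle_invK (nat * nat)%type q.
  by case: pickle_inv.
pose jq q := (top (dat (dec q).1) + (dec q).2)%N.
pose Bq q := dB (dat (dec q).1) (dec q).2.
pose wq q := dw (dat (dec q).1) (dec q).2.
pose gq q := dg (dat (dec q).1) (dec q).2.
have in_range q i : act q -> i \in jq q :: Bq q ->
    (Lk (dec q).1 <= i < nxt (dat (dec q).1))%N.
  move=> /act_dec[nS _]; rewrite inE => /orP[/eqP ->|/(B_lt _ _ _ nS)].
    rewrite (leq_trans (topL _)) ?leq_addr//= /jq /nxt ltn_add2l ltnS.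
    exact: leq_bigmax_seq.
  by move=> /andP[-> /leq_trans]; apply; rewrite leq_addr.
have [| | | | |M M0 hM] := rank_one_bounded (act := act) (j := jq) (B := Bq) (w := wq) (g := gq)
    st eb ue e1 c10.
- move=> q /act_dec[nS _] /=; rewrite /Bq; have [_ uf _ _ _] := hdat (dec q).1.
  rewrite (uniq_flatten_block uf nS) andbT; apply/negP => /(B_lt _ _ _ nS).
  by rewrite /jq; lia.
- move=> q q' i aq aq' iq iq'; have := in_range _ _ aq iq; have := in_range _ _ aq' iq'.
  have [nS qE] := act_dec _ aq; have [nS' qE'] := act_dec _ aq'.
  case: (ltngtP (dec q).1 (dec q').1) => [/L_mono| /L_mono|mm]; [lia|lia|].
  move=> _ _; rewrite -qE -qE'; congr pickle.
  suff : (dec q).2 = (dec q').2 by case: (dec q) (dec q') mm => ? ? [? ?] /= -> ->.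
  move: iq iq'; rewrite !inE /jq /Bq -mm.
  rewrite -mm in nS'.
  move=> /orP[/eqP ->|iB] /orP[|iB'].
  + by rewrite eqn_add2l => /eqP.
  + by have := B_lt _ _ _ nS' iB'; lia.
  + by move=> /eqP iE; have := B_lt _ _ _ nS iB; lia.
  + by have [_ uf _ _ _] := hdat (dec q).1; exact: uniq_flatten_inj uf nS nS' iB iB'.
- by move=> q /act_dec[nS _]; have [_ _ _ h _] := hdat (dec q).1; exact: h.
- by move=> q a /act_dec[nS _]; have [_ _ _ _ [h _ _]] := hdat (dec q).1; exact: h.
- by move=> q /act_dec[nS _]; have [_ _ _ _ [_ h _]] := hdat (dec q).1; exact: h.
pose m := Num.bound M; have Mm : M <= m%:R by exact/ltW/archi_boundP.
have [uS _ _ _ [_ _ []]] := hdat m.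
have decE n : dec (pickle (m, n)) = (m, n) by rewrite /dec pickleK_inv.
have := hM (map (fun n => pickle (m, n)) (dS (dat m))) (fun q => da (dat (dec q).1) (dec q).2).
rewrite !big_map map_inj_uniq; last by move=> n n' /(pcan_inj (@pickleK_inv _))[].
have acts : all act [seq pickle (m, n) | n <- dS (dat m)].
  by apply/allP => _ /mapP[n nS ->]; rewrite /act pickleK_inv.
move=> /(_ uS acts) h; apply: le_trans (_ : M * nrm (\sum_(n <- dS (dat m))
    \sum_(i <- dB (dat m) n) da (dat m) n i *: e i) <= _); last first.
  by rewrite ler_wpM2r ?nrm_ge0.
move: h; under eq_bigr do rewrite /gq /wq /Bq decE /=.
by under [X in _ <= _ * nrm X]eq_bigr do rewrite /Bq decE /=.
Qed.

End GlidingHump.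

(** * Symmetry and constant-coefficient blocks *)

Section Symmetry.
Context (R : realType) (k : scalar_kind).
Local Notation K := (scalars R k).
Local Notation "t %:K" := (@of_real R k t) (at level 2, format "t %:K").
Context (X : completeNormedModType K).
Context (e : nat -> X) (C : R).
Context (st : stable X) (eb : unconditional_basis e) (ue : unc e C).
Context (e1 : forall n, nrm (e n) = 1).

Let C0 : 0 <= C. Proof. by have [] := ue. Qed.

(** The projection onto the sums [u n + v n] along a functional living on the blocks of [v]
    sends [v n] to [u n + v n]. *)
Lemma block_transfer (c1 : R) : 0 <= c1 -> exists2 M : R, 0 <= M &
  forall (s : seq nat) (B B' : nat -> seq nat) (u v g : nat -> nat -> K) (a : nat -> K),
  uniq s -> uniq (flatten (map (fun n => B n ++ B' n) s)) ->
  (forall n, n \in s -> nrm (\sum_(i <- B n) u n i *: e i) <= c1) ->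
  (forall n, n \in s -> nrm (\sum_(i <- B' n) v n i *: e i) <= c1) ->
  (forall n b, n \in s -> modulus (\sum_(i <- B' n) g n i * b i) <=
     c1 * nrm (\sum_(i <- B' n) b i *: e i)) ->
  (forall n, n \in s -> \sum_(i <- B' n) g n i * v n i = 1) ->
  nrm (\sum_(n <- s) a n *: \sum_(i <- B n) u n i *: e i) <=
  M * nrm (\sum_(n <- s) a n *: \sum_(i <- B' n) v n i *: e i).
Proof.
move=> c10; have c2 : 0 <= c1 + c1 + c1 * C by rewrite !addr_ge0// mulr_ge0.
have [M M0 hM] := blocks_le_uniform st eb ue e1 c2.
(* The image of [v n] is [u n + v n]; subtracting [v n] costs the 1. *)
exists (M + 1) => [|s B B' u v g a us uf hu hv hg gv]; first by rewrite addr_ge0.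
pose U n := \sum_(i <- B n) u n i *: e i; pose V n := \sum_(i <- B' n) v n i *: e i.
have uBB n : n \in s -> uniq (B n ++ B' n) by exact: (@uniq_flatten_block (fun n => B n ++ B' n)).
have notB n i : n \in s -> i \in B' n -> (i \in B n) = false.
  move=> /uBB; rewrite cat_uniq => /and3P[_ /hasPn h _] /h.
  by move=> /negbTE.
have split_sum (V' : nmodType) n (F G : nat -> V') : n \in s ->
    \sum_(i <- B n ++ B' n) (if i \in B n then F i else G i) =
    \sum_(i <- B n) F i + \sum_(i <- B' n) G i.
  move=> ns; rewrite big_cat /=; congr (_ + _); apply: eq_big_seq => i iB.
    by rewrite iB.
  by rewrite notB.
have gE n b : n \in s ->
    \sum_(i <- B n ++ B' n) (if i \in B n then 0 else g n i) * b i = \sum_(i <- B' n) g n i * b i.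
  move=> ns; have := split_sum _ n (fun=> 0) (fun i => g n i * b i) ns.
  rewrite big1_eq add0r => <-; apply: eq_bigr => i _.
  by case: ifP => _; rewrite ?mul0r.
have := hM s (fun n => B n ++ B' n) (fun n i => if i \in B n then u n i else v n i)
   (fun n i => if i \in B n then 0 else g n i) (fun n i => if i \in B n then 0 else a n * v n i)
   us uf.
have wE n : n \in s -> \sum_(i <- B n ++ B' n) (if i \in B n then u n i else v n i) *: e i = U n + V n.
  by move=> ns; rewrite -split_sum//; apply: eq_bigr => i _; case: ifP.
have aE n : n \in s -> \sum_(i <- B n ++ B' n) (if i \in B n then 0 else a n * v n i) *: e i = a n *: V n.
  move=> ns; have := split_sum _ n (fun=> 0) (fun i => a n *: (v n i *: e i)) ns.
  rewrite big1_eq add0r -scaler_sumr => <-.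
  by apply: eq_bigr => i _; case: ifP => _; rewrite ?scale0r// scalerA.
have phiE n : n \in s ->
    \sum_(i <- B n ++ B' n) (if i \in B n then 0 else g n i) * (if i \in B n then 0 else a n * v n i) = a n.
  move=> ns; rewrite gE// -[RHS]mulr1 -(gv n ns) mulr_sumr; apply: eq_big_seq => i iB.
  by rewrite notB// mulrCA.
rewrite [X in nrm X <= _](eq_big_seq (fun n => a n *: (U n + V n))); last first.
  by move=> n ns /=; rewrite phiE// wE.
rewrite (eq_big_seq _ aE) => h.
have {}h : nrm (\sum_(n <- s) a n *: (U n + V n)) <= M * nrm (\sum_(n <- s) a n *: V n).
  apply: h.
  - by apply/allP.
  - move=> n ns; rewrite wE//; have := nrmD (U n) (V n); have := hu n ns; have := hv n ns.
    have : 0 <= c1 * C by rewrite mulr_ge0.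
    rewrite -/(U n) -/(V n); lra.
  - move=> n b ns; rewrite gE//; apply: le_trans (hg n b ns) _.
    rewrite mulrDl -mulrA; apply: le_trans (_ : c1 * (C * nrm (\sum_(i <- B n ++ B' n) b i *: e i)) <= _).
      rewrite ler_wpM2l//.
      have := unc_subset b (mem (B' n)) ue (uBB n ns).
      rewrite big_cat /= [X in nrm (X + _)]big_seq_cond [X in nrm (X + _)]big1 ?add0r.
        by rewrite -big_filter (_ : [seq x <- B' n | mem (B' n) x] = B' n)//; apply/all_filterP/allP.
      move=> i /andP[iB iB']; have := notB n i ns iB'; by rewrite iB.
    by rewrite lerDr mulr_ge0 ?nrm_ge0// addr_ge0.
  - move=> n ns; rewrite gE//; rewrite -[RHS](gv n ns); apply: eq_big_seq => i iB.
    by rewrite notB.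
have -> : \sum_(n <- s) a n *: U n = \sum_(n <- s) a n *: (U n + V n) - \sum_(n <- s) a n *: V n.
  by rewrite -sumrB; apply: eq_bigr => n _; rewrite scalerDr addrK.
by rewrite (le_trans (nrmB _ _))// mulrDl mul1r lerD.
Qed.

(** Two disjoint sequences of basis vectors are compared by [block_transfer] on single vectors;
    a third sequence, disjoint from both, takes care of overlaps. *)
Lemma symmetric_basis : exists2 D : R, 1 <= D &
  forall (s : seq nat) (h h' : nat -> nat) (a : nat -> K), uniq s ->
  {in s &, injective h} -> {in s &, injective h'} ->
  nrm (\sum_(n <- s) a n *: e (h n)) <= D * nrm (\sum_(n <- s) a n *: e (h' n)).
Proof.
have [M M0 hM] := block_transfer ler01.
have disj (s : seq nat) (h h' : nat -> nat) (a : nat -> K) : uniq s ->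
  {in s &, injective h} -> {in s &, injective h'} ->
  {in s &, forall n m, h n != h' m} ->
  nrm (\sum_(n <- s) a n *: e (h n)) <= M * nrm (\sum_(n <- s) a n *: e (h' n)).
  move=> us ih ih' hh'.
  have := hM s (fun n => [:: h n]) (fun n => [:: h' n]) (fun _ _ => 1) (fun _ _ => 1)
    (fun _ _ => 1) a us.
  have eq (l : nat -> nat) : \sum_(n <- s) a n *: (\sum_(i <- [:: l n]) (1 : K) *: e i) =
      \sum_(n <- s) a n *: e (l n).
    by apply: eq_bigr => n _; rewrite big_seq1 scale1r.
  rewrite !eq; apply => [|n ns|n ns|n b ns|n ns].
  - have uD n : n \in s -> uniq ([:: h n] ++ [:: h' n]).
      by move=> ns /=; rewrite inE hh'.
    have [be hbe] : exists be : nat -> nat,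
        forall q i, q \in s -> i \in [:: h q] ++ [:: h' q] -> be i = q.
      have ex i : exists q, forall n, n \in s -> i \in [:: h n] ++ [:: h' n] -> q = n.
        have [[n [ns iB]]|no] := pselect (exists n, n \in s /\ i \in [:: h n] ++ [:: h' n]).
          exists n => m ms; move: iB; rewrite !inE => /orP[]/eqP -> /orP[]/eqP.
          + by move=> /ih ->.
          + by move=> hm; have := hh' n m ns ms; rewrite hm eqxx.
          + by move=> hm; have := hh' m n ms ns; rewrite hm eqxx.
          + by move=> /ih' ->.
        by exists 0%N => n ns iB; case: no; exists n.
      by have [be hbe] := choice ex; exists be => n i; exact: hbe.
    exact: uniq_flatten_blocks uD hbe us.
  - by rewrite big_seq1 scale1r e1.
  - by rewrite big_seq1 scale1r e1.
  - by rewrite !big_seq1 nrmZ e1 !mul1r mulr1.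
  - by rewrite big_seq1 mulr1.
exists (M * M + 1) => [|s h h' a us ih ih']; first by rewrite lerDr mulr_ge0.
pose N := (\max_(n <- s) maxn (h n) (h' n)).+1.
have hN n : n \in s -> (maxn (h n) (h' n) < N)%N.
  move=> ns; rewrite ltnS.
  exact: (@leq_bigmax_seq _ s xpredT (fun n => maxn (h n) (h' n)) n ns isT).
pose h2 n := (N + n)%N.
have ih2 : {in s &, injective h2} by move=> n m _ _ /addnI.
apply: le_trans (disj s h h2 a us ih ih2 _) _.
  by move=> n m /hN + _; rewrite /h2; case: eqP => // ->; lia.
rewrite mulrDl mul1r -mulrA; apply: le_trans (_ : M * (M * nrm (\sum_(n <- s) a n *: e (h' n))) <= _).
  rewrite ler_wpM2l// disj// => n m _ /hN; rewrite /h2; case: eqP => // <-; lia.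
by rewrite lerDl nrm_ge0.
Qed.

Section ConstantBlocks.
Context (D : R) (D1 : 1 <= D).
Context (sym : forall (s : seq nat) (h h' : nat -> nat) (a : nat -> K), uniq s ->
  {in s &, injective h} -> {in s &, injective h'} ->
  nrm (\sum_(n <- s) a n *: e (h n)) <= D * nrm (\sum_(n <- s) a n *: e (h' n))).

Let D0 : 0 <= D. Proof. exact: le_trans ler01 D1. Qed.

(** Averaging over the cyclic permutations of the block. *)
Lemma averaging (S : seq nat) (b : nat -> K) : uniq S ->
  modulus (\sum_(i <- S) b i) * nrm (\sum_(i <- S) e i) <=
  (size S)%:R * D * nrm (\sum_(i <- S) b i *: e i).
Proof.
case sS : (size S) => [|m] uS.
  by rewrite (size0nil sS) !big_nil modulus0 !mul0r.
have perm_sum (r : nat) : nrm (\sum_(i < m.+1) b (nth 0%N S ((i + r) %% m.+1)) *: e (nth 0%N S i)) <=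
    D * nrm (\sum_(i <- S) b i *: e i).
  have -> : \sum_(i <- S) b i *: e i =
      \sum_(i < m.+1) b (nth 0%N S ((i + r) %% m.+1)) *: e (nth 0%N S ((i + r) %% m.+1)).
    rewrite (big_nth 0%N) sS big_mkord (reindex_inj (addIr (inZp r : 'I_m.+1)))/=.
    by apply: eq_bigr => i _; rewrite modnDmr.
  rewrite -(big_mkord xpredT (fun i => b (nth 0%N S ((i + r) %% m.+1)) *: e (nth 0%N S i))).
  rewrite -(big_mkord xpredT (fun i => b (nth 0%N S ((i + r) %% m.+1)) *:
     e (nth 0%N S ((i + r) %% m.+1)))).
  apply: (sym (h := nth 0%N S) (h' := fun i => nth 0%N S ((i + r) %% m.+1))).
  - exact: iota_uniq.
  - move=> i j; rewrite !mem_index_iota /= => im jm /eqP.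
    by rewrite nth_uniq ?sS// => /eqP.
  - move=> i j; rewrite !mem_index_iota /= => im jm /eqP.
    rewrite nth_uniq ?sS ?ltn_mod// => /eqP h.
    have : (i = j %[mod m.+1])%N by apply/eqP; rewrite -(eqn_modDr r); apply/eqP.
    by rewrite !modn_small.
rewrite -nrmZ.
have -> : (\sum_(i <- S) b i) *: (\sum_(i <- S) e i) =
    \sum_(r < m.+1) \sum_(i < m.+1) b (nth 0%N S ((i + r) %% m.+1)) *: e (nth 0%N S i).
  rewrite exchange_big /= [X in _ *: X](big_nth 0%N) sS big_mkord scaler_sumr.
  apply: eq_bigr => i _; rewrite -scaler_suml; congr (_ *: _).
  rewrite (big_nth 0%N) sS big_mkord (reindex_inj (addrI i)) /=.
  by apply: eq_bigr => r _.
apply: le_trans (nrm_sum _ _ _) _.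
apply: le_trans (_ : \sum_(r < m.+1) D * nrm (\sum_(i <- S) b i *: e i) <= _).
  by apply: ler_sum => r _; exact: perm_sum.
by rewrite sumr_const card_ord -mulrA mulr_natl.
Qed.

(** By [averaging] the normalized sum of coefficients is a bounded functional on each block, so
    [block_transfer] compares the [n]-th block, in both directions, with a basis vector far out. *)
Lemma constant_blocks : exists2 D' : R, 1 <= D' &
  forall (s : seq nat) (S : nat -> seq nat) (a : nat -> K), uniq s ->
  uniq (flatten (map S s)) -> (forall n, n \in s -> S n != [::]) ->
  nrm (\sum_(n <- s) a n *: \sum_(i <- S n) e i) <=
    D' * nrm (\sum_(n <- s) (a n * (nrm (\sum_(i <- S n) e i))%:K) *: e n) /\
  nrm (\sum_(n <- s) (a n * (nrm (\sum_(i <- S n) e i))%:K) *: e n) <=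
    D' * nrm (\sum_(n <- s) a n *: \sum_(i <- S n) e i).
Proof.
have [M M0 hM] := block_transfer D0.
exists (D * M + M * D + 1) => [|s S a us uf S0].
  by rewrite lerDr addr_ge0// mulr_ge0.
pose N := (\max_(i <- flatten (map S s)) i).+1.
have hN n i : n \in s -> i \in S n -> (i < N)%N.
  move=> ns iS; rewrite ltnS; apply: leq_bigmax_seq => //.
  by apply/flatten_mapP; exists n.
pose h n := (N + n)%N.
have ih : {in s &, injective h} by move=> n m _ _ /addnI.
have [be hbe] : exists be : nat -> nat,
    forall q i, q \in s -> i \in h q :: S q -> be i = q.
  have ex i : exists q, forall n, n \in s -> i \in h n :: S n -> q = n.
    have [[n [ns iB]]|no] := pselect (exists n, n \in s /\ i \in h n :: S n).
      exists n => m ms; move: iB; rewrite !inE => /orP[/eqP ->|iS] /orP[/eqP|iS'].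
      + by move=> /ih ->.
      + by have := hN _ _ ms iS'; rewrite /h; lia.
      + by have := hN _ _ ns iS; rewrite /h; lia.
      + exact: uniq_flatten_inj uf ns ms iS iS'.
    by exists 0%N => n ns iB; case: no; exists n.
  by have [be hbe] := choice ex; exists be => n i; exact: hbe.
have uS n : n \in s -> uniq (S n) by exact: uniq_flatten_block.
have hS n : n \in s -> h n \notin S n.
  by move=> ns; apply/negP => /(hN _ _ ns); rewrite /h; lia.
have uf1 : uniq (flatten (map (fun n => [:: h n] ++ S n) s)).
  by apply: (uniq_flatten_blocks (be := be)) => //= n ns; rewrite hS// uS.
have uf2 : uniq (flatten (map (fun n => S n ++ [:: h n]) s)).
  apply: (uniq_flatten_blocks (be := be)) => //= [n ns|q i qs iq].
    by rewrite uniq_catC /= hS// uS.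
  by apply: hbe => //; move: iq; rewrite mem_cat inE orbC inE.
pose t n := nrm (\sum_(i <- S n) e i).
have t0 n : n \in s -> 0 < t n.
  move=> ns; case E : (S n) (S0 n ns) (uS n ns) => [//|i l] _ ul.
  have := unc_coordinate (fun=> 1) ue ul (mem_head _ _).
  rewrite modulus1 e1 mulr1; under eq_bigr do rewrite scale1r.
  move=> h1; rewrite lt_neqAle nrm_ge0 andbT eq_sym; apply/negP => /eqP t0.
  by move: h1; rewrite -E -/(t n) t0 mulr0 ler10.
pose tK n : K := (t n)^-1%:K.
have tKE n : n \in s -> tK n * (t n)%:K = 1.
  by move=> /t0 tn; rewrite /tK -of_realM mulVf ?gt_eqF// of_real1.
have bE n : nrm (\sum_(i <- S n) tK n *: e i) = (t n)^-1 * t n.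
  by rewrite -scaler_sumr nrmZr ger0_norm// invr_ge0 nrm_ge0.
have bE1 n : n \in s -> nrm (\sum_(i <- S n) tK n *: e i) <= D.
  by move=> /t0 tn; rewrite bE mulVf ?gt_eqF.
have vE (c : nat -> K) : \sum_(n <- s) (c n * (t n)%:K) *: (\sum_(i <- S n) tK n *: e i) =
    \sum_(n <- s) c n *: \sum_(i <- S n) e i.
  apply: eq_big_seq => n ns; rewrite -scaler_sumr scalerA -mulrA [_ * tK n]mulrC tKE//.
  by rewrite mulr1.
have uE (c : nat -> K) : \sum_(n <- s) c n *: (\sum_(i <- [:: h n]) (1 : K) *: e i) =
    \sum_(n <- s) c n *: e (h n).
  by apply: eq_bigr => n _; rewrite big_seq1 scale1r.
have gb n b : n \in s -> modulus (\sum_(i <- S n) ((t n) / (size (S n))%:R)%:K * b i) <=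
     D * nrm (\sum_(i <- S n) b i *: e i).
  move=> ns; rewrite -mulr_sumr modulusM modulus_of_real ger0_norm ?divr_ge0 ?nrm_ge0//.
  have sn : 0 < (size (S n))%:R :> R by rewrite ltr0n lt0n size_eq0 S0.
  rewrite mulrAC ler_pdivrMr// mulrC [leRHS]mulrC mulrA; exact: averaging (uS n ns).
have gv n : n \in s -> \sum_(i <- S n) ((t n) / (size (S n))%:R)%:K * tK n = 1.
  move=> ns; have sn : (size (S n))%:R != 0 :> R by rewrite pnatr_eq0 size_eq0 S0.
  have of_realMn (r : R) m : r%:K *+ m = (r *+ m)%:K.
    by elim: m => [|m ihm]; rewrite ?mulr0n ?of_real0// !mulrS of_realD ihm.
  rewrite big_const_seq count_predT iter_addr_0 -of_realM of_realMn mulrAC.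
  by rewrite mulfV ?gt_eqF ?t0// mul1r -(mulr_natr _^-1) mulVf// of_real1.
set y := \sum_(n <- s) a n *: _; set z := \sum_(n <- s) (a n * _) *: e n.
have up : nrm (\sum_(n <- s) (a n * (t n)%:K) *: e (h n)) <= D * nrm z.
  exact: (sym (h := h) (h' := id)).
have down : nrm z <= D * nrm (\sum_(n <- s) (a n * (t n)%:K) *: e (h n)).
  exact: (sym (h := id) (h' := h)).
have h1 := hM s S (fun n => [:: h n]) (fun n _ => tK n) (fun _ _ => 1) (fun _ _ => 1)
  (fun n => a n * (t n)%:K) us uf2 bE1.
have h2 := hM s (fun n => [:: h n]) S (fun _ _ => 1) (fun n _ => tK n)
  (fun n _ => ((t n) / (size (S n))%:R)%:K) (fun n => a n * (t n)%:K) us uf1 _ bE1 gb gv.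
have single n : n \in s -> nrm (\sum_(i <- [:: h n]) (1 : K) *: e i) <= D.
  by rewrite big_seq1 scale1r e1.
rewrite vE uE in h1; rewrite vE uE in h2.
have y0 := nrm_ge0 y; have z0 := nrm_ge0 z.
have [MD DM] : 0 <= M * D /\ 0 <= D * M by rewrite !mulr_ge0.
split.
  have {}h1 : nrm y <= M * nrm (\sum_(n <- s) (a n * (t n)%:K) *: e (h n)).
    apply: h1 => // [n b ns|n ns]; last by rewrite big_seq1 mulr1.
    by rewrite !big_seq1 nrmZ e1 mul1r mulr1 ler_peMl ?modulus_ge0.
  have := ler_wpM2l M0 up; rewrite mulrA.
  have := mulr_ge0 MD z0; have := mulr_ge0 DM z0; move: h1.
  by rewrite !mulrDl mul1r; lra.
have := ler_wpM2l D0 (h2 single); rewrite mulrA -/y.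
have := mulr_ge0 MD y0; have := mulr_ge0 DM y0; move: down.
by rewrite !mulrDl mul1r; lra.
Qed.

End ConstantBlocks.
End Symmetry.

(** * Growth of sums of basis vectors *)

Section PowerLaw.
Context (R : realType).

(** In [n ^ k < m ^ l] choose [l] minimal: the almost additive function [ln \o lam] is then
    compared with [ln] up to an error that disappears as [k] grows. *)
Lemma power_law (lam : nat -> R) (d : R) : 1 <= d -> lam 1%N = 1 ->
  (forall n, (0 < n)%N -> 0 < lam n) ->
  (forall n m, (0 < n)%N -> (0 < m)%N -> lam (n * m)%N <= d * (lam n * lam m)) ->
  (forall n m, (0 < n)%N -> (0 < m)%N -> lam n * lam m <= d * lam (n * m)%N) ->
  (forall n m, (0 < n <= m)%N -> lam n <= d * lam m) ->
  (forall n, (0 < n)%N -> lam n <= n%:R) ->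
  exists2 al : R, 0 <= al <= 1 & forall n, (0 < n)%N ->
    n%:R `^ al <= d * lam n /\ lam n <= d * n%:R `^ al.
Proof.
move=> d1 lam1 lam0 lamM lamM' lam_mono lam_le.
have d0 : 0 < d by exact: lt_le_trans ltr01 d1.
pose mu n := ln (lam n); pose dl := ln d.
have dl0 : 0 <= dl by exact: ln_ge0.
have mu1 : mu 1%N = 0 by rewrite /mu lam1 ln1.
have ln_mul_le x y : 0 < x -> 0 < y -> x <= d * y -> ln x <= dl + ln y.
  by move=> x0 y0 xy; rewrite -lnM ?posrE// ler_ln ?posrE ?mulr_gt0.
have muM n m : (0 < n)%N -> (0 < m)%N -> mu (n * m)%N <= dl + (mu n + mu m).
  move=> n0 m0; rewrite /mu -lnM ?posrE ?lam0//; apply: ln_mul_le; rewrite ?lamM//.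
    by rewrite lam0// muln_gt0 n0.
  by rewrite mulr_gt0 ?lam0.
have muM' n m : (0 < n)%N -> (0 < m)%N -> mu n + mu m <= dl + mu (n * m)%N.
  move=> n0 m0; rewrite /mu -lnM ?posrE ?lam0//; apply: ln_mul_le; rewrite ?lamM'//.
    by rewrite mulr_gt0 ?lam0.
  by rewrite lam0// muln_gt0 n0.
have mu_mono n m : (0 < n <= m)%N -> mu n <= dl + mu m.
  move=> nm; have /andP[n0 nm'] := nm.
  by apply: ln_mul_le; rewrite ?lam0 ?lam_mono// (leq_trans n0).
have muX n k : (0 < n)%N -> mu (n ^ k)%N <= k%:R * (mu n + dl).
  move=> n0; elim: k => [|k ih]; first by rewrite expn0 mu1 mul0r.
  have := muM n (n ^ k)%N n0; rewrite expn_gt0 n0 => /(_ isT); rewrite -expnS.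
  by rewrite -natr1; lra.
have muX' n k : (0 < n)%N -> k%:R * (mu n - dl) <= mu (n ^ k)%N.
  move=> n0; elim: k => [|k ih]; first by rewrite expn0 mu1 mul0r.
  have := muM' n (n ^ k)%N n0; rewrite expn_gt0 n0 => /(_ isT); rewrite -expnS.
  by rewrite -natr1; lra.
have ln_gt n : (1 < n)%N -> 0 < ln n%:R :> R by move=> n1; rewrite ln_gt0// ltr1n.
have mu_ge n : (0 < n)%N -> 0 <= mu n + dl.
  by move=> n0; have := mu_mono 1%N n; rewrite n0 mu1 addrC => /(_ isT).
have arch (x b : R) : (forall k : nat, k%:R * x <= b) -> x <= 0.
  move=> h; rewrite leNgt; apply/negP => x0.
  have b0 : 0 <= b by have := h 0%N; rewrite mul0r.
  have := archi_boundP (divr_ge0 b0 (ltW x0)); rewrite ltr_pdivrMr//.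
  by rewrite ltNge h.
have cross n m : (1 < n)%N -> (1 < m)%N ->
    (mu n - dl) * ln m%:R <= (mu m + dl) * ln n%:R.
  move=> n1 m1; have n0 := ltnW n1; have m0 := ltnW m1.
  rewrite -subr_le0; apply: (arch _ ((mu m + dl + dl) * ln m%:R)) => k.
  (* The least [l] with [n ^ k < m ^ l]. *)
  pose l := (trunc_log m (n ^ k)).+1.
  have nk0 : (0 < n ^ k)%N by rewrite expn_gt0 n0.
  have up : (n ^ k <= m ^ l)%N by rewrite ltnW// trunc_log_ltn.
  have lo : (m ^ l.-1 <= n ^ k)%N by exact: trunc_logP.
  have h1 := muX' n k n0; have h2 := muX m l m0.
  have h3 : mu (n ^ k)%N <= dl + mu (m ^ l)%N by apply: mu_mono; rewrite nk0.
  have h4 : l.-1%:R * ln m%:R <= k%:R * ln n%:R :> R.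
    rewrite ![_%:R * ln _]mulr_natl -!lnXn ?ltr0n// -!natrX ler_ln ?posrE ?ltr0n ?ler_nat//.
    by rewrite expn_gt0 m0.
  have h5 : l%:R = l.-1%:R + 1 :> R by rewrite natr1.
  have h6 : k%:R * (mu n - dl) <= dl + l%:R * (mu m + dl) by lra.
  have h7 := ler_wpM2r (ltW (ln_gt m m1)) h6.
  have h8 := ler_wpM2l (mu_ge m m0) h4.
  rewrite h5 in h7; move: h7 h8; set x := ln m%:R; set y := ln n%:R.
  set K := k%:R; set L := l.-1%:R; set p := mu n; set q := mu m => h7 h8.
  have -> : K * ((p - dl) * x - (q + dl) * y) = K * (p - dl) * x - (q + dl) * (K * y) by ring.
  have -> : (q + dl + dl) * x = (dl + (L + 1) * (q + dl)) * x - (q + dl) * (L * x) by ring.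
  by lra.
pose S := [set z : R | exists2 n, (1 < n)%N & z = (mu n - dl) / ln n%:R].
have S_ub m : (1 < m)%N -> ubound S ((mu m + dl) / ln m%:R).
  move=> m1 _ [n n1 ->]; rewrite ler_pdivrMr ?ln_gt// mulrAC ler_pdivlMr ?ln_gt//.
  exact: cross.
have S0 : S !=set0 by exists ((mu 2 - dl) / ln 2%:R); exists 2%N.
pose al := sup S.
have hS : has_sup S by split=> //; exists ((mu 2 + dl) / ln 2%:R); exact: S_ub.
have al_ge n : (1 < n)%N -> mu n - dl <= al * ln n%:R.
  move=> n1; rewrite -ler_pdivrMr ?ln_gt//; apply: ub_le_sup; first by case: hS.
  by exists n.
have al_le n : (1 < n)%N -> al * ln n%:R <= mu n + dl.
  by move=> n1; rewrite -ler_pdivlMr ?ln_gt//; apply: ge_sup => //; exact: S_ub.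
have ln2X j : ln (2 ^ j)%:R = j%:R * ln 2%:R :> R.
  by rewrite natrX lnXn// mulr_natl.
have l2 := ln_gt 2%N isT.
exists al.
  apply/andP; split.
    rewrite -oppr_le0 -(pmulr_lle0 _ l2).
    apply: (arch _ (dl + dl)) => -[|j]; first by rewrite mul0r addr_ge0.
    rewrite mulNr mulrN mulrCA -ln2X.
    have j1 : (1 < 2 ^ j.+1)%N by rewrite -{1}(expn0 2) ltn_exp2l.
    by have := al_ge _ j1; have := mu_ge (2 ^ j.+1)%N (ltnW j1); lra.
  rewrite -subr_le0 -(pmulr_lle0 _ l2).
  apply: (arch _ dl) => -[|j]; first by rewrite mul0r.
  rewrite mulrBl mul1r mulrBr mulrCA -ln2X.
  have j1 : (1 < 2 ^ j.+1)%N by rewrite -{1}(expn0 2) ltn_exp2l.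
  have := al_le _ j1.
  have : mu (2 ^ j.+1)%N <= ln (2 ^ j.+1)%:R.
    by rewrite /mu ler_ln ?posrE ?lam0 ?lam_le ?ltr0n ?(ltnW j1).
  by lra.
have key n : (0 < n)%N -> mu n - dl <= al * ln n%:R /\ al * ln n%:R <= mu n + dl.
  case: n => // -[|n] _; last by rewrite al_ge// al_le.
  by rewrite ln1 mulr0 mu1 sub0r add0r oppr_le0.
move=> n n0; have [h1 h2] := key n n0.
have nE : n%:R `^ al = expR (al * ln n%:R) by rewrite /powR pnatr_eq0 (gtn_eqF n0).
have lE : lam n = expR (mu n) by rewrite /mu lnK ?posrE ?lam0.
have dE : d = expR dl by rewrite lnK ?posrE.
rewrite nE lE dE -!expRD !ler_expR; split; lra.
Qed.

End PowerLaw.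

Section Zippin.
Context (R : realType) (k : scalar_kind).
Local Notation K := (scalars R k).
Local Notation "t %:K" := (@of_real R k t) (at level 2, format "t %:K").
Context (X : completeNormedModType K).

Definition lp_like (e : nat -> X) (p M : R) := forall (s : seq nat) (a : nat -> K), uniq s ->
  nrm (\sum_(i <- s) a i *: e i) `^ p <= M * \sum_(i <- s) modulus (a i) `^ p /\
  \sum_(i <- s) modulus (a i) `^ p <= M * nrm (\sum_(i <- s) a i *: e i) `^ p.

Definition c0_like (e : nat -> X) (M : R) := forall (s : seq nat) (a : nat -> K) (t : R),
  uniq s -> (forall i, i \in s -> modulus (a i) <= t) -> 0 <= t ->
  nrm (\sum_(i <- s) a i *: e i) <= M * t.

Definition sum_power (e : nat -> X) (al c : R) := forall s : seq nat, uniq s -> s != [::] ->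
  (size s)%:R `^ al <= c * nrm (\sum_(i <- s) e i) /\
  nrm (\sum_(i <- s) e i) <= c * (size s)%:R `^ al.

Lemma sum_const_scale (e : nat -> X) (s : seq nat) :
  \sum_(i <- s) (1 : K) *: e i = \sum_(i <- s) e i.
Proof. by apply: eq_bigr => i _; rewrite scale1r. Qed.

Lemma sum_flatten (e : nat -> X) (S : nat -> seq nat) (s : seq nat) :
  \sum_(n <- s) \sum_(i <- S n) e i = \sum_(i <- flatten (map S s)) e i.
Proof. by elim: s => [|n s ih]; rewrite ?big_nil// big_cons /= big_cat /= ih. Qed.

(** A sum of [n * m] basis vectors is a sum of [m] constant blocks of length [n], so its norm is,
    up to constants, the product of the norms for [n] and [m]. *)
Lemma perfectly_homogeneous_power (e : nat -> X) :
  stable X -> unconditional_basis e -> (forall n, nrm (e n) = 1) ->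
  exists al c : R, [/\ 0 <= al <= 1, 1 <= c & sum_power e al c].
Proof.
move=> st eb e1; have [co [C hco]] := basis_coordinates eb.
have ue := coordinates_unc hco; have C0 : 0 <= C by have [] := ue.
have [D D1 sym] := symmetric_basis st eb ue e1.
have [D' D'1 blk] := constant_blocks st eb ue e1 D1 sym.
have D0 : 0 <= D by exact: le_trans D1.
have D'0 : 0 <= D' by exact: le_trans D'1.
pose lam n := nrm (\sum_(i < n) e i).
have lamE n : lam n = nrm (\sum_(i <- iota 0 n) (1 : K) *: e i).
  by rewrite sum_const_scale /lam -(big_mkord xpredT e) /index_iota subn0.
have sum_nth (s : seq nat) : \sum_(i <- s) e i =
    \sum_(n <- iota 0 (size s)) (1 : K) *: e (nth 0%N s n).
  by rewrite (big_nth 0%N) /index_iota subn0; apply: eq_bigr => n _; rewrite scale1r.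
have inj_nth (s : seq nat) : uniq s -> {in iota 0 (size s) &, injective (nth 0%N s)}.
  move=> us i j; rewrite !mem_iota /= add0n => im jm /eqP.
  by rewrite nth_uniq// => /eqP.
have lam_up s : uniq s -> nrm (\sum_(i <- s) e i) <= D * lam (size s).
  move=> us; rewrite sum_nth lamE.
  apply: (sym _ (nth 0%N s) id (fun=> 1)) => //; [exact: iota_uniq|exact: inj_nth].
have lam_down s : uniq s -> lam (size s) <= D * nrm (\sum_(i <- s) e i).
  move=> us; rewrite sum_nth lamE.
  apply: (sym _ id (nth 0%N s) (fun=> 1)) => //; [exact: iota_uniq|exact: inj_nth].
have lam0' n : 0 <= lam n by exact: nrm_ge0.
have lam1 : lam 1%N = 1 by rewrite /lam big_ord1 e1.
have lam_mono n m : (n <= m)%N -> lam n <= C * lam m.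
  move=> nm; rewrite !lamE.
  have := unc_subset (fun=> 1) (mem (iota 0 n)) ue (iota_uniq 0 m).
  rewrite -big_filter; congr (nrm _ <= _); apply: perm_big; apply: uniq_perm.
  - by rewrite filter_uniq// iota_uniq.
  - exact: iota_uniq.
  - by move=> i; rewrite mem_filter /= !mem_iota; lia.
have C1 : 1 <= C by have := lam_mono 1%N 1%N isT; rewrite lam1 mulr1.
have lam0 n : (0 < n)%N -> 0 < lam n.
  move=> n0; rewrite lt_neqAle lam0' andbT eq_sym; apply/negP => /eqP z.
  by have := lam_mono 1%N n n0; rewrite lam1 z mulr0 ler10.
have lam_le n : lam n <= n%:R.
  rewrite (le_trans (nrm_sum _ _ _))//; under eq_bigr do rewrite e1.
  by rewrite sumr_const card_ord.
pose S n j := iota (j * n) n.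
have uS n m : uniq (flatten (map (S n) (iota 0 m))).
  apply: (uniq_flatten_blocks (be := fun i => i %/ n)%N); rewrite ?iota_uniq//.
    by move=> j _; exact: iota_uniq.
  move=> j i _.
  rewrite mem_iota => /andP[h1 h2]; have n0 : (0 < n)%N by lia.
  apply/eqP; rewrite eqn_leq leq_divRL// h1 andbT -ltnS ltn_divLR//.
  by rewrite mulSn addnC.
have sizeS n m : size (flatten (map (S n) (iota 0 m))) = (n * m)%N.
  elim: m => [|m ih]; first by rewrite muln0.
  rewrite -addn1 iotaD map_cat flatten_cat size_cat ih /= cats0 size_iota.
  by rewrite addn1 mulnS addnC.
have S0 n m : (0 < n)%N -> forall j, j \in iota 0 m -> S n j != [::].
  by move=> n0 j _; rewrite -size_eq0 size_iota -lt0n.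
pose T n m := \sum_(j <- iota 0 m) (1 * (nrm (\sum_(i <- S n j) e i))%:K) *: e j.
have blkT n m : (0 < n)%N -> nrm (\sum_(i <- flatten (map (S n) (iota 0 m))) e i) <= D' * nrm (T n m)
    /\ nrm (T n m) <= D' * nrm (\sum_(i <- flatten (map (S n) (iota 0 m))) e i).
  move=> n0; have := blk (iota 0 m) (S n) (fun=> 1) (iota_uniq 0 m) (uS n m) (S0 n m n0).
  by rewrite -sum_flatten; under eq_bigr do rewrite scale1r.
have scl (t : R) (c : nat -> K) m : 0 <= t ->
    nrm (\sum_(j <- iota 0 m) (t%:K * c j) *: e j) = t * nrm (\sum_(j <- iota 0 m) c j *: e j).
  move=> t0; under eq_bigr do rewrite -scalerA.
  by rewrite -scaler_sumr nrmZr ger0_norm.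
have T_le n m : (0 < n)%N -> nrm (T n m) <= C * (D * lam n) * lam m.
  move=> n0; have := @unc_le _ _ X _ e C (iota 0 m) (fun j => 1 * (nrm (\sum_(i <- S n j) e i))%:K)
    (fun=> (D * lam n)%:K * 1) ue (iota_uniq 0 m).
  rewrite (scl _ (fun=> 1)) ?mulr_ge0// -lamE mulrA; apply => j _.
  rewrite mul1r mulr1 !modulus_of_real !ger0_norm ?mulr_ge0 ?nrm_ge0//.
  by have := lam_up (S n j) (iota_uniq _ _); rewrite size_iota.
have T_ge n m : (0 < n)%N -> lam n * lam m <= C * D * nrm (T n m).
  move=> n0; have := @unc_le _ _ X _ e C (iota 0 m) (fun=> (lam n)%:K * 1)
    (fun j => D%:K * (1 * (nrm (\sum_(i <- S n j) e i))%:K)) ue (iota_uniq 0 m).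
  rewrite (scl _ (fun=> 1))// -lamE scl// mulrA; apply => j _.
  rewrite mul1r mulr1 -of_realM !modulus_of_real !ger0_norm ?mulr_ge0 ?nrm_ge0//.
  by have := lam_down (S n j) (iota_uniq _ _); rewrite size_iota.
pose d := C * D * D * D'.
have CD1 : 1 <= C * D by rewrite mulr_ege1.
have DD1 : 1 <= D * D' by rewrite mulr_ege1.
have d1 : 1 <= d by rewrite /d -mulrA mulr_ege1.
have [|||||al al01 hal] := @power_law R lam d d1 lam1.
- exact: lam0.
- move=> n m n0 m0; rewrite -sizeS; apply: le_trans (lam_down _ (uS n m)) _.
  apply: le_trans (ler_wpM2l D0 (blkT n m n0).1) _.
  apply: le_trans (ler_wpM2l D0 (ler_wpM2l D'0 (T_le n m n0))) _.
  by rewrite [leLHS](_ : _ = d * (lam n * lam m))// /d; ring.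
- move=> n m n0 m0; apply: le_trans (T_ge n m n0) _; rewrite -[in leRHS]sizeS.
  have CD0 : 0 <= C * D by rewrite mulr_ge0.
  apply: le_trans (ler_wpM2l CD0 (blkT n m n0).2) _.
  apply: le_trans (ler_wpM2l CD0 (ler_wpM2l D'0 (lam_up _ (uS n m)))) _.
  by rewrite [leLHS](_ : _ = d * lam (size (flatten (map (S n) (iota 0 m)))))// /d; ring.
- move=> n m /andP[_ nm]; rewrite (le_trans (lam_mono n m nm))// ler_wpM2r//.
  by rewrite /d -!mulrA ler_peMr// mulr_ege1// mulr_ege1.
- by move=> n _.
exists al, (d * D); split=> //; first by rewrite mulr_ege1.
move=> s us s0; have sz : (0 < size s)%N by rewrite lt0n size_eq0.
have [h1 h2] := hal _ sz; have d0 : 0 <= d by exact: le_trans d1.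
split.
  by rewrite (le_trans h1)// -mulrA ler_wpM2l// lam_down.
by rewrite (le_trans (lam_up s us))// [d * D]mulrC -mulrA ler_wpM2l.
Qed.

End Zippin.

(** * Bases with power growth *)

Section ZippinTheorem.
Context (R : realType) (k : scalar_kind).
Local Notation K := (scalars R k).
Local Notation "t %:K" := (@of_real R k t) (at level 2, format "t %:K").
Context (X : completeNormedModType K).

(** By unconditionality the coefficients may all be replaced by the bound [t]. *)
Lemma sum_power_c0_like (e : nat -> X) (C c : R) :
  unc e C -> 1 <= c -> sum_power e 0 c -> exists2 M : R, 0 <= M & c0_like e M.
Proof.
move=> ue c1 hc; have C0 : 0 <= C by have [] := ue.
have c0 : 0 <= c by exact: le_trans c1.
exists (C * c) => [|s a t us at_ t0]; first by rewrite mulr_ge0.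
have := @unc_le _ _ X _ e C s a (fun=> t%:K) ue us.
rewrite -scaler_sumr nrmZr ger0_norm// => h.
apply: le_trans (h _) _.
  by move=> i si; rewrite modulus_of_real ger0_norm// at_.
rewrite -mulrA ler_wpM2l// mulrC ler_wpM2r//.
have [->|s0] := eqVneq s [::]; first by rewrite big_nil nrm0.
by have [_] := hc s us s0; rewrite powRr0 mulr1.
Qed.

(** Up to constants, a coefficient that is the [al]-th power of an integer stands for a sum of
    that many basis vectors; rounding reduces to that case, at the cost of a factor 2. *)
Lemma sum_power_lp_like (e : nat -> X) (C c al : R) :
  stable X -> unconditional_basis e -> (forall n, nrm (e n) = 1) ->
  unc e C -> 0 < al <= 1 -> 1 <= c -> sum_power e al c ->
  exists2 M : R, 0 <= M & lp_like e al^-1 M.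
Proof.
move=> st eb e1 ue /andP[al0 al1] c1 hc; have C0 : 0 <= C by have [] := ue.
have c0 : 0 <= c by exact: le_trans c1.
have [D D1 sym] := symmetric_basis st eb ue e1.
have [D' D'1 blk] := constant_blocks st eb ue e1 D1 sym.
have D'0 : 0 <= D' by exact: le_trans D'1.
set p := al^-1; have p0 : 0 < p by rewrite invr_gt0.
have al_n0 : al != 0 by rewrite gt_eqF.
have p_n0 : p != 0 by rewrite gt_eqF.
pose M0 := 2 * c * c * C * D'.
have M00 : 0 <= M0 by rewrite !mulr_ge0.
have powK (x : R) : 0 <= x -> (x `^ p) `^ al = x.
  by move=> x0; rewrite -powRrM mulVf// powRr1.
have powK' (x : R) : 0 <= x -> (x `^ al) `^ p = x.
  by move=> x0; rewrite -powRrM mulfV// powRr1.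
suff main (s : seq nat) (a : nat -> K) : uniq s -> s != [::] -> (forall i, i \in s -> a i != 0) ->
    nrm (\sum_(i <- s) a i *: e i) <= M0 * (\sum_(i <- s) modulus (a i) `^ p) `^ al /\
    (\sum_(i <- s) modulus (a i) `^ p) `^ al <= M0 * nrm (\sum_(i <- s) a i *: e i).
  exists (M0 `^ p) => [|s a us]; first exact: powR_ge0.
  pose s' := [seq i <- s | a i != 0].
  have -> : \sum_(i <- s) a i *: e i = \sum_(i <- s') a i *: e i.
    rewrite big_filter [RHS]big_mkcond; apply: eq_bigr => i _.
    by case: eqP => [->|//]; rewrite scale0r.
  have -> : \sum_(i <- s) modulus (a i) `^ p = \sum_(i <- s') modulus (a i) `^ p.
    rewrite big_filter [RHS]big_mkcond; apply: eq_bigr => i _.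
    by case: eqP => [->|//]; rewrite modulus0 powR0.
  set A := \sum_(i <- s') modulus _ `^ _.
  have A0 : 0 <= A by apply: sumr_ge0 => i _; exact: powR_ge0.
  have [s'0|s'0] := eqVneq s' [::].
    by rewrite /A s'0 !big_nil nrm0 powR0// !mulr0.
  have [|h1 h2] := main s' a (filter_uniq _ us) s'0.
    by move=> i; rewrite mem_filter => /andP[].
  split.
    apply: le_trans (ge0_ler_powR (ltW p0) _ _ h1) _; rewrite ?nnegrE ?nrm_ge0 ?mulr_ge0 ?powR_ge0//.
    by rewrite powRM ?powR_ge0// powK'.
  rewrite -[leLHS]powK' -/A//.
  apply: le_trans (ge0_ler_powR (ltW p0) _ _ h2) _; rewrite ?nnegrE ?nrm_ge0 ?mulr_ge0 ?powR_ge0 ?nrm_ge0//.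
  by rewrite powRM ?nrm_ge0.
move=> us s0 a0.
pose t i := modulus (a i); pose tp i := t i `^ p.
have t0 i : i \in s -> 0 < t i.
  move=> /a0 ai; rewrite lt_neqAle modulus_ge0 andbT eq_sym.
  by apply: contra_neq ai => /modulus_eq0.
have tp0 i : i \in s -> 0 < tp i by move=> /t0 ti; rewrite powR_gt0.
(* After scaling by [kp] all powers are at least 1, so rounding them down loses at most half. *)
have [kp kp0 hkp] : exists2 kp : nat, (0 < kp)%N & forall i, i \in s -> 1 <= kp%:R * tp i.
  have S0 : 0 <= \sum_(i <- s) (tp i)^-1.
    by apply: sumr_ge0 => i _; rewrite invr_ge0 powR_ge0.
  exists (Num.bound (\sum_(i <- s) (tp i)^-1)).+1 => // i si.
  rewrite -ler_pdivrMr ?tp0// div1r -natr1.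
  apply: le_trans (_ : \sum_(i <- s) (tp i)^-1 <= _).
    rewrite (perm_big _ (perm_to_rem si)) big_cons lerDl sumr_ge0// => j _.
    by rewrite invr_ge0 powR_ge0.
  by rewrite (le_trans (ltW (archi_boundP S0)))// lerDl.
pose n i := Num.truncn (kp%:R * tp i).
have kt0 i : 0 <= kp%:R * tp i by rewrite mulr_ge0// powR_ge0.
have n_le i : (n i)%:R <= kp%:R * tp i by have /andP[] := truncn_itv (kt0 i).
have n_gt0 i : i \in s -> (0 < n i)%N.
  move=> /hkp h; have /andP[_ lt] := truncn_itv (kt0 i).
  by have := le_lt_trans h lt; rewrite ltr1n ltnS.
have n_ge i : i \in s -> kp%:R * tp i <= 2 * (n i)%:R.
  move=> si; have /andP[_ /ltW h] := truncn_itv (kt0 i); apply: le_trans h _.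
  rewrite -natr1 mulrDl mul1r lerD2l ler1n; exact: n_gt0.
(* A private set of [n i] indices for each [i]. *)
pose S i := [seq pickle (i, j) | j <- iota 0 (n i)].
have inj_pk (x y : nat * nat) : pickle x = pickle y -> x = y by exact: (pcan_inj pickleK).
have uS i : uniq (S i) by rewrite map_inj_uniq ?iota_uniq// => j j' /inj_pk[].
have uf : uniq (flatten (map S s)).
  apply: (uniq_flatten_blocks (be := fun l => (odflt (0%N, 0%N) (unpickle l)).1)) => //.
  by move=> q i _ /mapP[j _ ->]; rewrite pickleK.
have Sn i : i \in s -> S i != [::].
  by move=> /n_gt0 ni; rewrite -size_eq0 size_map size_iota -lt0n.
have [b1 b2] := blk s S (fun=> 1) us uf Sn.
pose T i := nrm (\sum_(l <- S i) e l).
have hT i : i \in s -> (n i)%:R `^ al <= c * T i /\ T i <= c * (n i)%:R `^ al.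
  by move=> si; have := hc (S i) (uS i) (Sn i si); rewrite size_map size_iota.
have fn0 : flatten (map S s) != [::].
  case: (s) s0 Sn => // i l _ /(_ i (mem_head _ _)); rewrite -!size_eq0 /= size_cat.
  by case: (size (S i)).
have := hc _ uf fn0.
have -> : size (flatten (map S s)) = (\sum_(i <- s) n i)%N.
  elim: (s) => [|i l ih]; first by rewrite big_nil.
  by rewrite /= size_cat size_map size_iota ih big_cons.
set N := (\sum_(i <- s) n i)%N; rewrite -sum_flatten.
pose y := \sum_(i <- s) \sum_(l <- S i) e l.
pose z := \sum_(i <- s) (T i)%:K *: e i.
have {}b1 : nrm y <= D' * nrm z.
  by move: b1; under eq_bigr do rewrite scale1r; under [X in _ <= _ * nrm X]eq_bigr do rewrite mul1r.
have {}b2 : nrm z <= D' * nrm y.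
  by move: b2; under eq_bigr do rewrite mul1r; under [X in _ <= _ * nrm X]eq_bigr do rewrite scale1r.
rewrite -/y => -[hN1 hN2].
pose q := kp%:R `^ al; have q0 : 0 < q by rewrite powR_gt0 ?ltr0n.
have qt i : (kp%:R * tp i) `^ al = q * t i.
  by rewrite powRM ?powR_ge0// powK ?modulus_ge0.
have two_al (u : R) : 0 <= u -> (2 * u) `^ al <= 2 * u `^ al.
  move=> u0; rewrite powRM// ler_wpM2r ?powR_ge0// -[leRHS](@powRr1 _ 2)//.
  by rewrite ler_powR// ler1n.
have qt_le i : i \in s -> q * t i <= 2 * c * T i.
  move=> si; rewrite -qt; apply: le_trans (ge0_ler_powR (ltW al0) _ _ (n_ge i si)) _.
  - by rewrite nnegrE.
  - by rewrite nnegrE mulr_ge0.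
  - by rewrite (le_trans (two_al _ _))// -mulrA ler_wpM2l//; have [] := hT i si.
have T_le i : i \in s -> T i <= c * (q * t i).
  move=> si; have [_ h] := hT i si; rewrite (le_trans h)// ler_wpM2l// -qt.
  by apply: ge0_ler_powR; rewrite ?nnegrE ?(ltW al0)//.
set x := \sum_(i <- s) a i *: e i; set A := \sum_(i <- s) modulus (a i) `^ p.
have A0 : 0 <= A by apply: sumr_ge0 => i _; exact: powR_ge0.
have N_le : N%:R <= kp%:R * A.
  by rewrite /N natr_sum /A mulr_sumr; apply: ler_sum => i _; exact: n_le.
have N_ge : kp%:R * A <= 2 * N%:R.
  rewrite /N natr_sum /A !mulr_sumr big_seq [leRHS]big_seq.
  by apply: ler_sum => i; exact: n_ge.
have qA : (kp%:R * A) `^ al = q * A `^ al by rewrite powRM.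
have T0 i : 0 <= T i by exact: nrm_ge0.
have scl (r : R) (b : nat -> K) : 0 <= r ->
    nrm (\sum_(i <- s) (r%:K * b i) *: e i) = r * nrm (\sum_(i <- s) b i *: e i).
  move=> r0; under eq_bigr do rewrite -scalerA.
  by rewrite -scaler_sumr nrmZr ger0_norm.
have xz : q * nrm x <= C * (2 * c * nrm z).
  rewrite -(scl q a (ltW q0)) -(scl (2 * c) (fun i => (T i)%:K)) ?mulr_ge0//.
  apply: unc_le => // i si.
  rewrite !modulusM !modulus_of_real !ger0_norm ?mulr_ge0 ?(ltW q0)//.
  exact: qt_le.
have zx : nrm z <= C * (c * q * nrm x).
  rewrite -(scl (c * q) a) ?mulr_ge0 ?(ltW q0)//; apply: unc_le => // i si.
  rewrite !modulusM !modulus_of_real !ger0_norm ?mulr_ge0 ?(ltW q0)// -mulrA.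
  exact: T_le.
have NA : N%:R `^ al <= q * A `^ al.
  by rewrite -qA; apply: ge0_ler_powR; rewrite ?nnegrE ?(ltW al0) ?mulr_ge0.
have AN : q * A `^ al <= 2 * N%:R `^ al.
  rewrite -qA (le_trans (ge0_ler_powR (ltW al0) _ _ N_ge)) ?nnegrE ?mulr_ge0//.
  exact: two_al.
have C2c : 0 <= 2 * c * C by rewrite !mulr_ge0.
split; rewrite -(ler_pM2l q0).
  have h1 := ler_wpM2l C2c b1.
  have h2 := ler_wpM2l (mulr_ge0 C2c D'0) hN2.
  have h3 := ler_wpM2l (mulr_ge0 (mulr_ge0 C2c D'0) c0) NA.
  by rewrite /M0; move: xz h1 h2 h3; rewrite -/x -/A; nra.
have h1 := ler_wpM2l (ler0n R 2) hN1.
have h2 := ler_wpM2l (mulr_ge0 (ler0n R 2) c0) b1.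
have h3 := ler_wpM2l (mulr_ge0 (mulr_ge0 (ler0n R 2) c0) D'0) zx.
by rewrite /M0; move: AN h1 h2 h3; rewrite -/x -/A; nra.
Qed.

End ZippinTheorem.

(** * Rademacher averages and the Khintchine inequalities *)

Section Rademacher.
Context (R : realType).

Fixpoint signs (n : nat) : finType :=
  if n is n'.+1 then (bool * signs n')%type else unit.

Fixpoint rad (n : nat) : signs n -> nat -> R :=
  match n with
  | 0%N => fun _ _ => 1
  | n'.+1 => fun w i => if i == n' then (-1) ^+ w.1 else rad w.2 i
  end.

Definition avg (n : nat) (F : signs n -> R) : R := (2 ^ n)%:R^-1 * \sum_w F w.

Lemma rad_sqr n (w : signs n) i : rad w i * rad w i = 1.
Proof.
elim: n w i => [|n ih] w i /=; first by rewrite mulr1.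
by case: eqP => // _; rewrite -expr2 sqrr_sign.
Qed.

Lemma card_signs n : #|signs n| = (2 ^ n)%N.
Proof. by elim: n => [|n ih] /=; rewrite ?card_unit// card_prod card_bool ih expnS. Qed.

Lemma sum_signsS (V : nmodType) n (F : signs n.+1 -> V) :
  \sum_w F w = \sum_(w : signs n) F (false, w) + \sum_(w : signs n) F (true, w).
Proof.
rewrite (eq_bigr (fun p : bool * signs n => F (p.1, p.2))); last by case.
by rewrite -(pair_bigA _ (fun b w => F (b, w))) /= big_bool addrC.
Qed.

Lemma avgS n (F : signs n.+1 -> R) :
  avg F = (avg (fun w => F (false, w)) + avg (fun w => F (true, w))) / 2.
Proof. by rewrite /avg sum_signsS expnS natrM invfM; field; rewrite pnatr_eq0 expn_eq0. Qed.

Lemma avg0 (F : signs 0 -> R) : avg F = F tt.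
Proof.
by rewrite /avg expn0 invr1 mul1r (big_pred1 tt) //; case.
Qed.

Lemma avg_le n (F G : signs n -> R) : (forall w, F w <= G w) -> avg F <= avg G.
Proof. by move=> FG; rewrite /avg ler_wpM2l ?invr_ge0// ler_sum. Qed.

Lemma avgD n (F G : signs n -> R) : avg (fun w => F w + G w) = avg F + avg G.
Proof. by rewrite /avg big_split mulrDr. Qed.

Lemma avgZ n (t : R) (F : signs n -> R) : avg (fun w => t * F w) = t * avg F.
Proof. by rewrite /avg -mulr_sumr mulrCA. Qed.

Lemma avg_cst n (t : R) : avg (fun _ : signs n => t) = t.
Proof.
by rewrite /avg sumr_const card_signs -(mulr_natl t) mulrA mulVf ?mul1r//.
Qed.

Lemma avg_ge0 n (F : signs n -> R) : (forall w, 0 <= F w) -> 0 <= avg F.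
Proof. by move=> F0; rewrite -(avg_cst n 0); apply: avg_le. Qed.

Lemma avg_sum n I (s : seq I) (F : I -> signs n -> R) :
  avg (fun w => \sum_(i <- s) F i w) = \sum_(i <- s) avg (F i).
Proof. by rewrite /avg exchange_big mulr_sumr. Qed.

Lemma eq_avg n (F G : signs n -> R) : (forall w, F w = G w) -> avg F = avg G.
Proof. by move=> FG; congr avg; apply/funext. Qed.

Context (k : scalar_kind).
Local Notation K := (scalars R k).
Local Notation "t %:K" := (@of_real R k t) (at level 2, format "t %:K").

Definition rsum n (a : nat -> K) (w : signs n) : K := \sum_(i < n) (rad w i)%:K * a i.

Lemma rsumS n (a : nat -> K) b (w : signs n) :
  rsum a ((b, w) : signs n.+1) = rsum a w + (-1) ^+ b * a n.
Proof.
rewrite /rsum big_ord_recr /= eqxx; congr (_ + _ * _).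
  by apply: eq_bigr => i _; rewrite ltn_eqF.
by case: b; rewrite ?expr1 ?expr0 ?of_realN of_real1.
Qed.

Lemma rsum_even n (F : K -> R) (a : nat -> K) :
  avg (fun w : signs n.+1 => F (rsum a w)) =
  avg (fun w : signs n => (F (rsum a w + a n) + F (rsum a w - a n)) / 2).
Proof.
rewrite avgS -avgD mulrC -avgZ; apply: eq_avg => w.
by rewrite !rsumS expr0 expr1 mul1r mulN1r mulrC.
Qed.

Definition sqsum n (a : nat -> K) : R := \sum_(i < n) modulus (a i) ^+ 2.

Lemma sqsum_ge0 n a : 0 <= sqsum n a.
Proof. by apply: sumr_ge0 => i _; exact: sqr_ge0. Qed.

Lemma rsum_sqr n (a : nat -> K) : avg (fun w : signs n => modulus (rsum a w) ^+ 2) = sqsum n a.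
Proof.
elim: n => [|n ih]; first by rewrite avg0 /rsum /sqsum !big_ord0 modulus0 expr0n.
rewrite (rsum_even _ (fun x => modulus x ^+ 2)) /sqsum big_ord_recr /= -/(sqsum n a) -ih.
rewrite -(avg_cst n (modulus (a n) ^+ 2)) -avgD; apply: eq_avg => w.
by rewrite modulus_parallelogram; field.
Qed.

(** Two-point inequality: expanding [(A + x) ^ j + (A - x) ^ j], only even powers of [x]
    survive, and they are dominated by the powers of [A + N * (4 a^2)]. *)
Lemma two_point (A x a : R) (N j : nat) : 0 <= A -> x ^+ 2 <= 4 * A * a ^+ 2 -> (j <= N)%N ->
  ((A + x) ^+ j + (A - x) ^+ j) / 2 <= (A + N%:R * (4 * a ^+ 2)) ^+ j.
Proof.
move=> A0 xA; set h := 4 * a ^+ 2; set W := A + _ * h.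
have h0 : 0 <= h by rewrite mulr_ge0// sqr_ge0.
have W0 : 0 <= W by rewrite addr_ge0// mulr_ge0.
have AW : A <= W by rewrite lerDl mulr_ge0.
pose P i := ((A + x) ^+ i + (A - x) ^+ i) / 2.
pose Q i := ((A + x) ^+ i - (A - x) ^+ i) / 2.
have PS i : P i.+1 = A * P i + x * Q i by rewrite /P /Q !exprS; field.
have QS i : Q i.+1 = A * Q i + x * P i by rewrite /P /Q !exprS; field.
have key i : (i <= N)%N -> P i <= W ^+ i /\ x * Q i <= i%:R * h * W ^+ i.
  elim: i => [_|i ih iN]; first by rewrite /P /Q !expr0 subrr !mul0r mulr0; split => //; lra.
  have [h1 h2] := ih (ltnW iN); have Wi : 0 <= W ^+ i by rewrite exprn_ge0.
  have iNR : i%:R <= N%:R :> R by rewrite ler_nat ltnW.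
  split.
    rewrite PS exprS; have e1 := ler_wpM2l A0 h1.
    have e2 : i%:R * h * W ^+ i <= N%:R * h * W ^+ i by rewrite !ler_wpM2r.
    have e3 : W * W ^+ i = A * W ^+ i + N%:R * h * W ^+ i by rewrite -mulrDl.
    by rewrite e3; apply: lerD e1 (le_trans h2 e2).
  have e0 : x * Q i.+1 = A * (x * Q i) + x ^+ 2 * P i by rewrite QS; ring.
  have e1 := ler_wpM2l A0 h2.
  have e2 : x ^+ 2 * P i <= A * h * W ^+ i.
    have x0 := sqr_ge0 x.
    apply: le_trans (ler_wpM2l x0 h1) _; rewrite ler_wpM2r// /h; move: xA; lra.
  have e3 : A * (i.+1%:R * h * W ^+ i) <= W * (i.+1%:R * h * W ^+ i).
    exact: ler_wpM2r (mulr_ge0 (mulr_ge0 (ler0n _ _) h0) Wi) _ _ AW.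
  rewrite e0 [W ^+ i.+1]exprS [leRHS](_ : _ = W * (i.+1%:R * h * W ^+ i)); last by ring.
  by apply: le_trans _ e3; rewrite -natr1; move: e1 e2; lra.
by move=> jN; have [] := key j jN.
Qed.

(** Induction on the number of signs; the induction runs with a constant [l] added to the square,
    which absorbs the contribution of the last sign. *)
Lemma khintchine_moments n (a : nat -> K) (N j : nat) : (j <= N)%N ->
  avg (fun w : signs n => modulus (rsum a w) ^+ (2 * j)) <=
  ((4 * N + 1)%:R * sqsum n a) ^+ j.
Proof.
suff main (l : R) : 0 <= l -> (j <= N)%N ->
    avg (fun w : signs n => (modulus (rsum a w) ^+ 2 + l) ^+ j) <=
    ((4 * N + 1)%:R * sqsum n a + l) ^+ j.
  move=> jN; have := main 0 (lexx _) jN; rewrite addr0; apply: le_trans.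
  by apply: avg_le => w; rewrite addr0 exprM.
elim: n l => [|n ih] l l0 jN.
  by rewrite avg0 /rsum /sqsum !big_ord0 modulus0 expr0n /= mulr0.
rewrite (rsum_even _ (fun x => (modulus x ^+ 2 + l) ^+ j)).
rewrite /sqsum big_ord_recr /= -/(sqsum n a) mulrDr -addrA.
set z := modulus (a n).
apply: le_trans (ih _ _ jN); last by rewrite addr_ge0// mulr_ge0// sqr_ge0.
apply: avg_le => w; set s := rsum a w.
pose A := modulus s ^+ 2 + z ^+ 2.
pose x := modulus (s + a n) ^+ 2 - A.
have e1 : modulus (s + a n) ^+ 2 = A + x by rewrite /x; ring.
have e2 : modulus (s - a n) ^+ 2 = A - x.
  by have := modulus_parallelogram s (a n); rewrite /x -/z /A; lra.
have ms := modulus_ge0 s; have mz : 0 <= z := modulus_ge0 _.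
have xle : x <= 2 * (modulus s * z).
  have := modulusD s (a n); rewrite -/z => h.
  have := lerXn2r 2 (modulus_ge0 _ : _ \is Num.nneg) (addr_ge0 ms mz : _ \is Num.nneg) h.
  by rewrite e1 /A sqrrD -mulr_natl; lra.
have xge : - x <= 2 * (modulus s * z).
  have := modulusD s (- a n); rewrite modulusN -/z => h.
  have := lerXn2r 2 (modulus_ge0 _ : _ \is Num.nneg) (addr_ge0 ms mz : _ \is Num.nneg) h.
  by rewrite e2 /A sqrrD -mulr_natl; lra.
have A0 : 0 <= A by rewrite addr_ge0 ?sqr_ge0.
have x2 : x ^+ 2 <= 4 * (A + l) * z ^+ 2.
  have : x ^+ 2 <= (2 * (modulus s * z)) ^+ 2.
    rewrite -[x ^+ 2]real_normK ?num_real// lerXn2r ?nnegrE ?normr_ge0 ?mulr_ge0//.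
    by rewrite ler_norml; apply/andP; split; [move: xge; lra|].
  move/le_trans; apply; rewrite !exprMn [leLHS](_ : _ = 4 * (modulus s ^+ 2) * z ^+ 2); last by ring.
  rewrite ler_wpM2r ?sqr_ge0// ler_wpM2l// /A -addrA lerDl addr_ge0 ?sqr_ge0//.
have := @two_point (A + l) x z N j (addr_ge0 A0 l0) x2 jN.
rewrite e1 e2 [A + x + l]addrAC [A - x + l]addrAC => /le_trans; apply.
rewrite le_eqVlt; apply/orP; left; apply/eqP; congr (_ ^+ _).
by rewrite /A natrD natrM; ring.
Qed.

(** The [L^1] norm controls the [L^2] norm because the [L^4] norm does not exceed it by much. *)
Lemma khintchine_L1 n (a : nat -> K) :
  Num.sqrt (sqsum n a) <= 26 * avg (fun w : signs n => modulus (rsum a w)).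
Proof.
set s := Num.sqrt _; have s0 : 0 <= s by exact: sqrtr_ge0.
have ss : s ^+ 2 = sqsum n a by rewrite sqr_sqrtr// sqsum_ge0.
have A0 : 0 <= avg (fun w : signs n => modulus (rsum a w)).
  by apply: avg_ge0 => w; exact: modulus_ge0.
have [->|sn0] := eqVneq s 0; first by rewrite mulr_ge0.
have sp : 0 < s by rewrite lt_neqAle eq_sym sn0.
have pt (l t : R) : 0 < l -> 0 <= t -> t ^+ 2 <= l * t + (l ^+ 2)^-1 * t ^+ (2 * 2).
  move=> l0 t0; have [tl|/ltW lt] := leP t l.
    rewrite expr2 (le_trans (ler_wpM2r t0 tl))// lerDl mulr_ge0 ?exprn_ge0// invr_ge0 sqr_ge0//.
  have : t ^+ 2 <= (l ^+ 2)^-1 * t ^+ (2 * 2).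
    rewrite mulrC ler_pdivlMr ?exprn_gt0// exprM [leRHS]expr2 ler_wpM2l ?sqr_ge0//.
    by rewrite lerXn2r ?nnegrE ?(ltW l0).
  by move/le_trans; apply; rewrite lerDr mulr_ge0// ltW.
(* The fourth moment is at most [81 s^4], which is less than half of [(13 s)^2 s^2]. *)
have l0 : 0 < 13 * s by rewrite mulr_gt0.
have := avg_le (fun w : signs n => pt _ _ l0 (modulus_ge0 (rsum a w))).
rewrite avgD !avgZ rsum_sqr -ss.
have := khintchine_moments n a (leqnn 2); rewrite -ss => h4.
have h : ((13 * s) ^+ 2)^-1 * avg (fun w : signs n => modulus (rsum a w) ^+ (2 * 2)) <= 2^-1 * s ^+ 2.
  rewrite mulrC ler_pdivrMr ?exprn_gt0//; apply: le_trans h4 _.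
  rewrite -[(4 * 2 + 1)%N]/9%N [leLHS](_ : _ = 81 * s ^+ 4); last by ring.
  rewrite [leRHS](_ : _ = 169 / 2 * s ^+ 4); last by field.
  by rewrite ler_wpM2r ?exprn_ge0//; lra.
set B := avg _ in A0 h *; move=> h1.
have : s * s <= s * (26 * B) by move: h1 h; rewrite expr2; lra.
by rewrite ler_pM2l.
Qed.

End Rademacher.

(** * The Rademacher projection *)

Section RademacherProjection.
Context (R : realType) (k : scalar_kind).
Local Notation K := (scalars R k).
Local Notation "t %:K" := (@of_real R k t) (at level 2, format "t %:K").

Lemma one_powR (x : R) : 1 `^ x = 1.
Proof. by rewrite powR1. Qed.

Lemma of_real_sum I (s : seq I) (P : pred I) (F : I -> R) :
  (\sum_(i <- s | P i) F i)%:K = \sum_(i <- s | P i) (F i)%:K.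
Proof. by elim/big_rec2 : _ => [|i x y _ <-]; rewrite ?of_real0// of_realD. Qed.

Definition l2 n (b : nat -> K) : R := Num.sqrt (sqsum n b).

Lemma l2_ge0 n b : 0 <= l2 n b. Proof. exact: sqrtr_ge0. Qed.

Lemma l2_eq0 n b : l2 n b = 0 -> forall i, (i < n)%N -> b i = 0.
Proof.
move=> /eqP; rewrite sqrtr_eq0 => le0 i ni.
have := sqsum_ge0 n b; rewrite le_eqVlt ltNge le0 orbF eq_sym => /eqP /psumr_eq0P h.
have /eqP := h (fun i _ => sqr_ge0 _) (Ordinal ni) isT.
by rewrite sqrf_eq0 => /eqP /modulus_eq0.
Qed.

Lemma rsum_eq0 n (b : nat -> K) (w : signs n) : (forall i, (i < n)%N -> b i = 0) -> rsum b w = 0.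
Proof. by move=> b0; rewrite /rsum big1// => i _; rewrite b0// mulr0. Qed.

(** After scaling to [l2] norm 1, a power of [t] is at most 1 plus an even power that dominates it. *)
Lemma khintchine_power (q : R) : 0 < q -> exists2 C : R, 1 <= C &
  forall n (b : nat -> K), avg (fun w : signs n => modulus (rsum b w) `^ q) <= C * l2 n b `^ q.
Proof.
move=> q0; pose N := Num.bound q.
have qN : q <= (2 * N)%:R.
  by rewrite (le_trans (ltW (archi_boundP (ltW q0))))// ler_nat leq_pmull.
exists (1 + (4 * N + 1)%:R ^+ N) => [|n b]; first by rewrite lerDl exprn_ge0.
have [r0|r0] := eqVneq (l2 n b) 0.
  rewrite r0 powR0 ?gt_eqF// mulr0 -(avg_cst n 0); apply: avg_le => w.
  by rewrite (rsum_eq0 w (l2_eq0 r0)) modulus0 powR0 ?gt_eqF.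
set r := l2 n b in r0 *.
have rp : 0 < r by rewrite lt_neqAle eq_sym r0 l2_ge0.
have pt (w : signs n) : modulus (rsum b w) `^ q <=
    r `^ q * (1 + (r ^+ (2 * N))^-1 * modulus (rsum b w) ^+ (2 * N)).
  set t := modulus _; have t0 : 0 <= t by exact: modulus_ge0.
  rewrite -{1}(mulVKf r0 t) powRM ?mulr_ge0 ?invr_ge0 ?(ltW rp)//.
  rewrite ler_wpM2l ?powR_ge0// -exprVn -exprMn.
  set u := r^-1 * t; have u0 : 0 <= u by rewrite mulr_ge0 ?invr_ge0// ltW.
  have [u1|/ltW u1] := leP u 1.
    rewrite (@le_trans _ _ 1)//; last by rewrite lerDl exprn_ge0.
    by rewrite -[leRHS](one_powR q) ge0_ler_powR ?nnegrE ?(ltW q0).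
  by rewrite (le_trans (ler_powR u1 qN))// powR_mulrn// lerDr.
apply: le_trans (avg_le pt) _; rewrite avgZ avgD avgZ avg_cst mulrC ler_wpM2r ?powR_ge0//.
rewrite lerD2l mulrC ler_pdivrMr ?exprn_gt0//.
apply: le_trans (khintchine_moments n b (leqnn N)) _.
by rewrite exprMn exprM /r /l2 sqr_sqrtr// sqsum_ge0.
Qed.

Definition rcoef n (c : signs n -> K) (i : nat) : K :=
  ((2 ^ n)%:R^-1)%:K * \sum_w (rad R w i)%:K * c w.

Lemma rad_orthogonal n i j : (i < n)%N -> (j < n)%N -> i != j ->
  \sum_(w : signs n) (rad R w i) * rad R w j = 0.
Proof.
elim: n => // n ih; rewrite !ltnS => iN jN ij; rewrite sum_signsS /=.
have [iE|in_] := eqVneq i n; have [jE|jn] := eqVneq j n.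
- by rewrite iE jE eqxx in ij.
- by rewrite expr0 expr1 -big_split /= big1// => w _; rewrite mul1r mulN1r subrr.
- by rewrite expr0 expr1 -big_split /= big1// => w _; rewrite mulr1 mulrN1 subrr.
- by rewrite ih ?addr0// ltn_neqAle ?in_ ?jn.
Qed.

Lemma rcoef_rsum n (b : nat -> K) i : (i < n)%N -> rcoef (fun w : signs n => rsum b w) i = b i.
Proof.
move=> iN; rewrite /rcoef /rsum; under eq_bigr do rewrite mulr_sumr.
rewrite exchange_big /= (bigD1 (Ordinal iN))//= [X in _ + X]big1 ?addr0.
  under eq_bigr do rewrite mulrA -of_realM rad_sqr of_real1 mul1r.
  rewrite sumr_const card_signs mulrnAr -mulrnAl.
  have -> : ((2 ^ n)%:R^-1)%:K *+ (2 ^ n) = 1 :> K.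
    have of_realMn (r : R) m : r%:K *+ m = (r *+ m)%:K.
      by elim: m => [|m ihm]; rewrite ?mulr0n ?of_real0// !mulrS of_realD ihm.
    by rewrite of_realMn -(mulr_natr _^-1) mulVf ?of_real1// pnatr_eq0 expn_eq0.
  by rewrite mul1r.
move=> j ji; under eq_bigr do rewrite mulrA -of_realM.
by rewrite -mulr_suml -of_real_sum rad_orthogonal ?of_real0 ?mul0r// eq_sym.
Qed.

(** Duality: pairing with the function whose coefficients are conjugate to those of [c]. *)
Lemma rcoef_power (p : R) : 1 < p -> exists2 C : R, 1 <= C &
  forall n (c : signs n -> K), l2 n (rcoef c) `^ p <= C * avg (fun w => modulus (c w) `^ p).
Proof.
move=> p1; have p0 : 0 < p by exact: lt_trans p1.
have pm : 0 < p - 1 by rewrite subr_gt0.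
have [q qE] : exists q, q = p / (p - 1) by exists (p / (p - 1)).
have q1 : 1 <= q by rewrite qE ler_pdivlMr// mul1r gerBl.
have q0 : 0 < q by exact: lt_le_trans ltr01 q1.
have pq : p^-1 + q^-1 = 1 by rewrite qE; field; rewrite !gt_eqF.
have [Cq Cq1 hCq] := khintchine_power q0.
have [l lE] : exists l, l = 2 * Cq by exists (2 * Cq).
have l1 : 1 <= l by rewrite lE; lra.
have l0 : 0 < l by exact: lt_le_trans ltr01 l1.
exists (2 * l `^ p) => [|n c].
  have : 1 <= l `^ p by rewrite -[leLHS](one_powR p) ge0_ler_powR ?nnegrE ?(ltW p0) ?(ltW l0).
  by lra.
set U := avg _; have U0 : 0 <= U by apply: avg_ge0 => w; exact: powR_ge0.
set rho := rcoef c; set r := l2 n rho.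
have [->|r0] := eqVneq r 0; first by rewrite powR0 ?gt_eqF// mulr_ge0// mulr_ge0// powR_ge0.
have rp : 0 < r by rewrite lt_neqAle eq_sym r0 l2_ge0.
have [z hz] : exists z : nat -> K, forall i, modulus (z i) = modulus (rho i) /\
    z i * rho i = (modulus (rho i) ^+ 2)%:K.
  have ex i : exists z : K, modulus z = modulus (rho i) /\ z * rho i = (modulus (rho i) ^+ 2)%:K.
    have [u u1 rhoE] := of_real_modulus_sign (rho i).
    have u0 : u != 0 by apply/negP => /eqP uz; move: u1; rewrite uz modulus0 => /eqP; rewrite eq_sym oner_eq0.
    exists ((modulus (rho i))%:K * u^-1); split.
      rewrite modulusM modulus_of_real modulusV u1 invr1 mulr1 ger0_norm//.
      exact: modulus_ge0.
    by rewrite [X in _ * X]rhoE mulrACA -of_realM mulVf// mulr1 expr2.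
  by have [z hz] := choice ex; exists z.
have rr : r ^+ 2 = sqsum n rho by rewrite sqr_sqrtr// sqsum_ge0.
have l2z : l2 n z = r.
  by rewrite /r /l2 /sqsum; congr Num.sqrt; apply: eq_bigr => i _; rewrite (hz i).1.
have h1 : r ^+ 2 <= avg (fun w => modulus (c w) * modulus (rsum z w)).
  have -> : r ^+ 2 = modulus ((2 ^ n)%:R^-1%:K * \sum_w c w * rsum z w).
    rewrite -[LHS]ger0_norm ?sqr_ge0// -(modulus_of_real k) rr; congr modulus.
    rewrite /sqsum of_real_sum; under eq_bigr do rewrite -(hz _).2 /rho /rcoef mulrCA.
    rewrite -mulr_sumr; congr (_ * _); under eq_bigr do rewrite mulr_sumr.
    rewrite exchange_big /=; apply: eq_bigr => w _; rewrite /rsum mulr_sumr.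
    by apply: eq_bigr => i _; ring.
  rewrite modulusM modulus_of_real ger0_norm ?invr_ge0// /avg ler_wpM2l ?invr_ge0//.
  apply: le_trans (modulus_sum _ _ _) _.
  by apply: ler_sum => w _; rewrite modulusM.
(* The weight [l] makes the second term of Young's inequality average to 1/2. *)
have young w : (r ^+ 2)^-1 * (modulus (c w) * modulus (rsum z w)) <=
    l `^ p * (r `^ p)^-1 * modulus (c w) `^ p + (l * r `^ q)^-1 * modulus (rsum z w) `^ q.
  set s := modulus (c w); set t := modulus (rsum z w).
  have s0 : 0 <= s := modulus_ge0 _; have t0 : 0 <= t := modulus_ge0 _.
  have ri : 0 <= r^-1 by rewrite invr_ge0 ltW.
  have li : 0 <= l^-1 by rewrite invr_ge0 ltW.
  have inv_pow (x y : R) : 0 < x -> x^-1 `^ y = (x `^ y)^-1.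
    by move=> x0; rewrite -powR_inv1 ?(ltW x0)// powRAC powR_inv1 ?powR_ge0.
  have -> : (r ^+ 2)^-1 * (s * t) = (l * (r^-1 * s)) * (l^-1 * (r^-1 * t)).
    by field; rewrite r0 gt_eqF.
  have := conjugate_powR (mulr_ge0 (ltW l0) (mulr_ge0 ri s0)) (mulr_ge0 li (mulr_ge0 ri t0)) p0 q0 pq.
  move/le_trans; apply; apply: lerD.
    rewrite !powRM ?mulr_ge0 ?(ltW l0)// inv_pow// mulrA ler_pdivrMr//.
    rewrite ler_peMr ?mulr_ge0 ?invr_ge0 ?powR_ge0//; exact: ltW.
  rewrite !powRM ?mulr_ge0// invfM.
  rewrite !inv_pow// ler_pdivrMr// -[l^-1 / _ * _]mulrA.
  have lq : (l `^ q)^-1 <= l^-1 by rewrite lef_pV2 ?posrE ?powR_gt0// le1r_powR.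
  set v := _^-1 * t `^ q; have v0 : 0 <= v by rewrite mulr_ge0 ?invr_ge0 ?powR_ge0.
  apply: le_trans (ler_wpM2r v0 lq) _; rewrite ler_peMr//.
  by rewrite mulr_ge0.
have h2 : 1 <= l `^ p * (r `^ p)^-1 * U + (l * r `^ q)^-1 * (Cq * r `^ q).
  have e1 : 1 <= avg (fun w => (r ^+ 2)^-1 * (modulus (c w) * modulus (rsum z w))).
    by rewrite avgZ mulrC ler_pdivlMr ?exprn_gt0// mul1r.
  apply: le_trans e1 (le_trans (avg_le young) _).
  rewrite avgD !avgZ -/U lerD2l ler_wpM2l ?invr_ge0 ?mulr_ge0 ?powR_ge0 ?(ltW l0)//.
  by rewrite -[X in _ * X `^ q]l2z hCq.
have rq0 : r `^ q != 0 by rewrite gt_eqF// powR_gt0.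
have e2 : (l * r `^ q)^-1 * (Cq * r `^ q) = 1 / 2.
  by rewrite lE; field; rewrite rq0 gt_eqF//; lra.
rewrite e2 in h2.
have rpp : 0 < r `^ p by exact: powR_gt0.
have : 1 / 2 <= l `^ p * (r `^ p)^-1 * U by lra.
rewrite mulrAC ler_pdivlMr//; lra.
Qed.

Definition proj n (c : signs n -> K) (w : signs n) : K := rsum (rcoef c) w.

(** The factor turns the average of [p]-th powers over the cube into their sum. *)
Definition lift (p : R) n (b : nat -> K) (w : signs n) : K :=
  ((2 ^ n)%:R `^ (- p^-1))%:K * rsum b w.

Definition pnorm (p : R) n (c : signs n -> K) : R := \sum_w modulus (c w) `^ p.

Lemma pnorm_avg p n (c : signs n -> K) :
  pnorm p c = (2 ^ n)%:R * avg (fun w => modulus (c w) `^ p).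
Proof. by rewrite /avg mulVKf// pnatr_eq0 expn_eq0. Qed.

Lemma pnorm_ge0 p n (c : signs n -> K) : 0 <= pnorm p c.
Proof. by apply: sumr_ge0 => w _; exact: powR_ge0. Qed.

(** The coefficients are controlled by [rcoef_power], their Rademacher sum by [khintchine_power]. *)
Lemma proj_bounded (p : R) : 1 < p -> exists2 C : R, 1 <= C &
  forall n (c : signs n -> K), pnorm p (proj c) <= C * pnorm p c.
Proof.
move=> p1; have p0 : 0 < p by exact: lt_trans p1.
have [C1 C11 h1] := khintchine_power p0; have [C2 C21 h2] := rcoef_power p1.
exists (C1 * C2) => [|n c]; first exact: mulr_ege1.
rewrite !pnorm_avg [leRHS]mulrCA ler_wpM2l//.
apply: le_trans (h1 n (rcoef c)) _; rewrite -mulrA ler_wpM2l ?h2//.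
exact: le_trans C11.
Qed.

Lemma lift_bounded (p : R) : 1 < p -> exists2 C : R, 1 <= C &
  forall n (b : nat -> K), pnorm p (@lift p n b) <= C * l2 n b `^ p /\
     l2 n b `^ p <= C * pnorm p (@lift p n b).
Proof.
move=> p1; have p0 : 0 < p by exact: lt_trans p1.
have [C1 C11 h1] := khintchine_power p0; have [C2 C21 h2] := rcoef_power p1.
exists (C1 + C2) => [|n b]; first by lra.
have n0 : 0 <= (2 ^ n)%:R :> R by [].
have -> : pnorm p (@lift p n b) = avg (fun w : signs n => modulus (rsum b w) `^ p).
  rewrite /pnorm /avg mulr_sumr; apply: eq_bigr => w _.
  rewrite modulusM modulus_of_real ger0_norm ?powR_ge0// powRM ?powR_ge0 ?modulus_ge0//.
  by rewrite -powRrM mulNr mulVf ?gt_eqF// powR_inv1.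
have l0 : 0 <= l2 n b `^ p by exact: powR_ge0.
split; first by have := h1 n b; nra.
have -> : l2 n b = l2 n (rcoef (fun w : signs n => rsum b w)).
  by rewrite /l2 /sqsum; congr Num.sqrt; apply: eq_bigr => i _; rewrite rcoef_rsum.
have := h2 n (fun w : signs n => rsum b w).
have : 0 <= avg (fun w : signs n => modulus (rsum b w) `^ p).
  by apply: avg_ge0 => w; exact: powR_ge0.
by nra.
Qed.

Lemma rcoef_linear n (x : K) (c c' : signs n -> K) i :
  rcoef (fun w => x * c w + c' w) i = x * rcoef c i + rcoef c' i.
Proof.
rewrite /rcoef mulrCA -mulrDr; congr (_ * _); rewrite mulr_sumr -big_split /=.
by apply: eq_bigr => w _; rewrite mulrDr mulrCA.
Qed.

Lemma rsum_linear n (x : K) (b b' : nat -> K) (w : signs n) :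
  rsum (fun i => x * b i + b' i) w = x * rsum b w + rsum b' w.
Proof.
rewrite /rsum mulr_sumr -big_split /=.
by apply: eq_bigr => i _; rewrite mulrDr mulrCA.
Qed.

Lemma proj_linear n (x : K) (c c' : signs n -> K) w :
  proj (fun w => x * c w + c' w) w = x * proj c w + proj c' w.
Proof.
rewrite /proj -rsum_linear; congr rsum; apply/funext => i; exact: rcoef_linear.
Qed.

Lemma proj_rsum n (b : nat -> K) (w : signs n) : proj (fun w => rsum b w) w = rsum b w.
Proof. by rewrite /proj /rsum; apply: eq_bigr => i _; rewrite rcoef_rsum. Qed.

Lemma projK n (c : signs n -> K) w : proj (proj c) w = proj c w.
Proof. exact: proj_rsum. Qed.

End RademacherProjection.

(** * The shift of the Rademacher parts *)

Section Enumeration.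

Lemma nat_bijection (I : countType) (f : nat -> I) : injective f ->
  exists s : I -> nat, bijective s.
Proof.
move=> inj_f; have /card_set_bijP[s] : ([set: I] #= [set: nat])%card.
  rewrite card_eq_le; apply/andP; split; first exact: countableP.
  rewrite -(card_le_eql (inj_card_eq (in2W inj_f))); exact: subset_card_le.
by rewrite setTT_bijective; exists s.
Qed.

End Enumeration.

Section Chains.
Context (R : realType) (k : scalar_kind).
Local Notation K := (scalars R k).
Local Notation "t %:K" := (@of_real R k t) (at level 2, format "t %:K").

Lemma pnormD (p : R) n (c c' : signs n -> K) : 0 < p ->
  pnorm p (fun w => c w + c' w) <= 2 `^ p * (pnorm p c + pnorm p c').
Proof.
move=> p0; rewrite /pnorm -big_split mulr_sumr; apply: ler_sum => w _.
set x := modulus (c w); set y := modulus (c' w).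
have x0 : 0 <= x := modulus_ge0 _; have y0 : 0 <= y := modulus_ge0 _.
have h : modulus (c w + c' w) <= 2 * Num.max x y.
  rewrite (le_trans (modulusD _ _))// -/x -/y; case: (leP x y); lra.
have m0 : 0 <= Num.max x y by rewrite le_max x0.
apply: le_trans (ge0_ler_powR (ltW p0) _ _ h) _; rewrite ?nnegrE ?modulus_ge0 ?mulr_ge0//.
rewrite powRM// ler_wpM2l ?powR_ge0//=; case: (leP x y) => _.
  by rewrite lerDr powR_ge0.
by rewrite lerDl powR_ge0.
Qed.

Lemma pnormN (p : R) n (c : signs n -> K) : pnorm p (fun w => - c w) = pnorm p c.
Proof. by apply: eq_bigr => w _; rewrite modulusN. Qed.

Definition coproj n (c : signs n -> K) (w : signs n) : K := c w - proj c w.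

(** One step of the shift: the Rademacher part of each function moves to the next copy. *)
Definition chain n (d : nat -> signs n -> K) (m : nat) (w : signs n) : K :=
  coproj (d m.+1) w + proj (d m) w.

Lemma proj_coproj n (c : signs n -> K) w : proj (coproj c) w = 0.
Proof.
have -> : coproj c = fun w => (-1) * proj c w + c w.
  by apply/funext => v; rewrite mulN1r addrC.
by rewrite proj_linear projK mulN1r addNr.
Qed.

Lemma projD n (c c' : signs n -> K) w : proj (fun w => c w + c' w) w = proj c w + proj c' w.
Proof.
have -> : (fun w => c w + c' w) = fun w => 1 * c w + c' w by apply/funext => v; rewrite mul1r.
by rewrite proj_linear mul1r.
Qed.

Lemma proj_chain n (d : nat -> signs n -> K) m w : proj (chain d m) w = proj (d m) w.
Proof. by rewrite projD proj_coproj projK add0r. Qed.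

Lemma chain_inv n (d : nat -> signs n -> K) m w :
  d m.+1 w = coproj (chain d m) w + proj (chain d m.+1) w.
Proof.
rewrite /coproj !proj_chain /chain /coproj; ring.
Qed.

(** Each term of the chain, and by [chain_inv] each term of the original sequence, involves at
    most two consecutive terms of the other one, transformed by bounded projections. *)
Lemma chain_bounds (p : R) : 1 < p -> exists2 C : R, 1 <= C &
  forall n (d : nat -> signs n -> K) (M : nat),
  (forall w, proj (d 0%N) w = d 0%N w) -> (forall m, (M < m)%N -> forall w, d m w = 0) ->
  \sum_(m < M.+1) pnorm p (chain d m) <= C * \sum_(m < M.+1) pnorm p (d m) /\
  \sum_(m < M.+1) pnorm p (d m) <= C * \sum_(m < M.+1) pnorm p (chain d m).
Proof.
move=> p1; have p0 : 0 < p by exact: lt_trans p1.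
have [C C1 hC] := proj_bounded k p1.
have C0 : 0 <= C by exact: le_trans C1.
pose T := 2 `^ p : R; have T1 : 1 <= T.
  by rewrite -[leLHS](one_powR p) ge0_ler_powR ?nnegrE ?(ltW p0)// ler1n.
have T0 : 0 <= T by exact: le_trans T1.
have coproj_le n (c : signs n -> K) : pnorm p (coproj c) <= T * ((1 + C) * pnorm p c).
  apply: le_trans (pnormD _ _ p0) _; rewrite pnormN ler_wpM2l// mulrDl mul1r lerD2l.
  exact: hC.
pose D := T * (T * (1 + C) + C).
have step n (c c' : signs n -> K) :
    pnorm p (fun w => coproj c w + proj c' w) <= D * (pnorm p c + pnorm p c').
  apply: le_trans (pnormD _ _ p0) _; rewrite /D -mulrA ler_wpM2l//.
  have := coproj_le n c; have := hC n c'; have := pnorm_ge0 p c; have := pnorm_ge0 p c'.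
  have : 0 <= T * (1 + C) by rewrite mulr_ge0// addr_ge0.
  by nra.
have D0 : 0 <= D by rewrite mulr_ge0// addr_ge0// mulr_ge0// addr_ge0.
have DC0 : 0 <= D * 2 + C by rewrite addr_ge0// mulr_ge0.
exists (D * 2 + C + 1) => [|n d M d0 dM]; first by rewrite lerDr.
have S0 (h : nat -> signs n -> K) N : 0 <= \sum_(m < N) pnorm p (h m).
  by apply: sumr_ge0 => m _; exact: pnorm_ge0.
have zero (h : signs n -> K) : (forall w, h w = 0) -> pnorm p h = 0.
  by move=> h0; rewrite /pnorm big1// => w _; rewrite h0 modulus0 powR0 ?gt_eqF.
have proj0 (h : signs n -> K) : (forall w, h w = 0) -> forall w, proj h w = 0.
  move=> h0 w; rewrite /proj /rsum big1// => i _.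
  by rewrite /rcoef big1 ?mulr0// => v _; rewrite h0 mulr0.
split.
  have h1 : \sum_(m < M.+1) pnorm p (chain d m) <=
      D * (\sum_(m < M.+1) pnorm p (d m.+1) + \sum_(m < M.+1) pnorm p (d m)).
    by rewrite -big_split mulr_sumr; apply: ler_sum => m _; exact: step.
  have h2 : \sum_(m < M.+1) pnorm p (d m.+1) <= \sum_(m < M.+1) pnorm p (d m).
    rewrite big_ord_recr /= [X in _ + X]zero ?addr0; last by move=> w; exact: dM.
    rewrite [leRHS]big_ord_recl /=.
    by rewrite lerDr pnorm_ge0.
  apply: le_trans h1 _; have := ler_wpM2l D0 h2; have := S0 d M.+1.
  by move=> s0 h; have := mulr_ge0 DC0 s0; have := mulr_ge0 D0 s0; nra.
have h0 : pnorm p (d 0%N) <= C * \sum_(m < M.+1) pnorm p (chain d m).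
  have -> : pnorm p (d 0%N) = pnorm p (proj (chain d 0%N)).
    by apply: eq_bigr => w _; rewrite proj_chain d0.
  apply: le_trans (hC _ _) _; rewrite ler_wpM2l// big_ord_recl lerDl.
  by apply: sumr_ge0 => m _; exact: pnorm_ge0.
have chain0 m : (M < m)%N -> pnorm p (chain d m) = 0.
  move=> Mm; apply: zero => w; rewrite /chain /coproj !proj0 ?subr0 ?addr0; last 2 first.
  - exact: dM.
  - by apply: dM; exact: ltnW.
  by apply: dM; exact: ltnW.
have h1 : \sum_(m < M) pnorm p (d m.+1) <=
    D * (\sum_(m < M) pnorm p (chain d m) + \sum_(m < M) pnorm p (chain d m.+1)).
  rewrite -big_split mulr_sumr; apply: ler_sum => m _.
  have -> : pnorm p (d m.+1) = pnorm p (fun w => coproj (chain d m) w + proj (chain d m.+1) w).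
    by apply: eq_bigr => w _; rewrite -chain_inv.
  exact: step.
set S := \sum_(m < M.+1) pnorm p (chain d m) in h0 *.
have h2 : \sum_(m < M) pnorm p (chain d m) <= S by rewrite /S big_ord_recr lerDl pnorm_ge0.
have h3 : \sum_(m < M) pnorm p (chain d m.+1) <= S.
  by rewrite /S big_ord_recl lerDr pnorm_ge0.
rewrite big_ord_recl /=; have SS : 0 <= S := S0 _ _.
have := ler_wpM2l D0 h2; have := ler_wpM2l D0 h3; move: h1 h0.
by rewrite !mulrDl mul1r; lra.
Qed.

End Chains.

Section SpanOfPairs.
Context (R : realType) (k : scalar_kind) (X : normedModType (scalars R k)).
Local Notation K := (scalars R k).
Context (I : eqType) (f : I -> X).

(** Lists of coefficient-index pairs, possibly with repeated indices, make closure
    under sums immediate. *)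
Definition in_span (x : X) := exists l : seq (K * I), x = \sum_(q <- l) q.1 *: f q.2.

Lemma in_span_gen i : in_span (f i).
Proof. by exists [:: (1, i)]; rewrite big_seq1 scale1r. Qed.

Lemma in_span0 : in_span 0.
Proof. by exists [::]; rewrite big_nil. Qed.

Lemma in_spanD x y : in_span x -> in_span y -> in_span (x + y).
Proof. by move=> [l ->] [l' ->]; exists (l ++ l'); rewrite big_cat. Qed.

Lemma in_spanZ (a : K) x : in_span x -> in_span (a *: x).
Proof.
move=> [l ->]; exists [seq (a * q.1, q.2) | q <- l]; rewrite big_map scaler_sumr.
by apply: eq_bigr => q _; rewrite scalerA.
Qed.

Lemma in_span_sum (J : Type) (s : seq J) (F : J -> X) :
  (forall j, in_span (F j)) -> in_span (\sum_(j <- s) F j).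
Proof.
move=> h; elim: s => [|j s ih]; first by rewrite big_nil; exact: in_span0.
by rewrite big_cons; apply: in_spanD.
Qed.

Lemma in_span_coef x : in_span x ->
  exists (s : seq I) (a : I -> K), uniq s /\ x = \sum_(i <- s) a i *: f i.
Proof.
move=> [l ->]; exists (undup (map snd l)), (fun i => \sum_(q <- l | q.2 == i) q.1).
split; first exact: undup_uniq.
under [RHS]eq_bigr do rewrite scaler_suml big_mkcond.
rewrite exchange_big /=; rewrite big_seq [RHS]big_seq; apply: eq_bigr => q ql.
have qu : q.2 \in undup (map snd l) by rewrite mem_undup map_f.
rewrite (bigD1_seq q.2) ?undup_uniq//= eqxx big1 ?addr0// => i /negbTE.
by rewrite eq_sym => ->.
Qed.

End SpanOfPairs.

(** * A basis containing long Hilbertian pieces *)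

Section ShiftedBasis.
Context (R : realType) (k : scalar_kind).
Local Notation K := (scalars R k).
Local Notation "t %:K" := (@of_real R k t) (at level 2, format "t %:K").
Context (X : completeNormedModType K).

(** Copies of the cubes: copy [m] of the [n]-dimensional one, and a sign vector. *)
Definition cubes : Type := {n : nat & (nat * signs n)%type}.
HB.instance Definition _ := Countable.on cubes.
Definition cube n m (w : signs n) : cubes := Tagged (fun n => (nat * signs n)%type) (m, w).

Definition new_index : Type := ({n : nat & 'I_n} + cubes)%type.
HB.instance Definition _ := Countable.on new_index.
Definition rademacher_index n (i : 'I_n) : new_index := inl (Tagged (fun n => 'I_n) i).

Context (e : nat -> X) (p M0 : R) (sg : cubes -> nat).
Context (p1 : 1 < p) (M01 : 1 <= M0) (elp : lp_like e p M0) (sg_bij : bijective sg).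

Definition cube_sum n m (c : signs n -> K) : X := \sum_w c w *: e (sg (cube m w)).

Lemma cube_sumD n m (c c' : signs n -> K) :
  cube_sum m (fun w => c w + c' w) = cube_sum m c + cube_sum m c'.
Proof. by rewrite /cube_sum -big_split; apply: eq_bigr => w _; rewrite scalerDl. Qed.

Lemma cube_sum0 n m (c : signs n -> K) : (forall w, c w = 0) -> cube_sum m c = 0.
Proof. by move=> c0; rewrite /cube_sum big1// => w _; rewrite c0 scale0r. Qed.

Lemma cube_sum_comb n m I (s : seq I) (a : I -> K) (F : I -> signs n -> K) :
  cube_sum m (fun w => \sum_(i <- s) a i * F i w) = \sum_(i <- s) a i *: cube_sum m (F i).
Proof.
rewrite /cube_sum; under eq_bigr do rewrite scaler_suml.
rewrite exchange_big; apply: eq_bigr => i _; rewrite scaler_sumr.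
by apply: eq_bigr => w _; rewrite scalerA.
Qed.

Definition delta n (u w : signs n) : K := if w == u then 1 else 0.

Lemma delta_comb n (c : signs n -> K) w : \sum_u c u * delta u w = c w.
Proof.
rewrite (bigD1 w)//= /delta eqxx mulr1 big1 ?addr0// => u.
by rewrite eq_sym => /negbTE ->; rewrite mulr0.
Qed.

Lemma proj_comb n I (s : seq I) (a : I -> K) (F : I -> signs n -> K) w :
  proj (fun w => \sum_(i <- s) a i * F i w) w = \sum_(i <- s) a i * proj (F i) w.
Proof.
elim: s => [|i s ih].
  rewrite big_nil (_ : (fun w => _) = fun=> 0); last by apply/funext => v; rewrite big_nil.
  rewrite /proj /rsum big1// => j _; rewrite /rcoef big1 ?mulr0// => v _.
  by rewrite mulr0.
rewrite big_cons -ih -proj_linear; congr proj; apply/funext => v.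
by rewrite big_cons.
Qed.

(** The Rademacher vectors of copy 0, and the unit vectors with their Rademacher part moved to
    the next copy. Moving these parts along makes room, in the same space, for vectors that
    span long Euclidean spaces. *)
Definition new_vec (j : new_index) : X :=
  match j with
  | inl (existT n i) => cube_sum 0 (lift p (fun l => if l == i :> nat then 1 else 0) : signs n -> K)
  | inr (existT n (m, u)) => cube_sum m (coproj (delta u)) + cube_sum m.+1 (proj (delta u))
  end.

Lemma rsum_delta n (i : 'I_n) (w : signs n) :
  rsum (fun l => if l == i :> nat then 1 else 0) w = (rad R w i)%:K.
Proof.
rewrite /rsum (bigD1 i)//= eqxx mulr1 big1 ?addr0// => j ji.
by rewrite (_ : (j == i :> nat) = false) ?mulr0//; apply/negbTE.
Qed.

Lemma rademacher_sum n (b : nat -> K) :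
  \sum_(i < n) b i *: new_vec (rademacher_index i) = cube_sum 0 (lift p b : signs n -> K).
Proof.
rewrite /= -cube_sum_comb; congr cube_sum; apply/funext => w.
rewrite /lift; under eq_bigr do rewrite rsum_delta mulrCA.
by rewrite -mulr_sumr; congr (_ * _); apply: eq_bigr => i _; rewrite mulrC.
Qed.

Lemma shifted_sum n m (c : signs n -> K) :
  \sum_u c u *: new_vec (inr (cube m u)) = cube_sum m (coproj c) + cube_sum m.+1 (proj c).
Proof.
rewrite /=; under eq_bigr do rewrite scalerDr.
rewrite big_split /= -!cube_sum_comb.
have pr w : \sum_(u : signs n) c u * proj (delta u) w = proj c w.
  by rewrite -proj_comb; congr proj; apply/funext => v; exact: delta_comb.
congr (_ + _); congr cube_sum; apply/funext => w; last exact: pr.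
by rewrite /coproj; under eq_bigr do rewrite mulrBr; rewrite sumrB delta_comb pr.
Qed.

Definition chain_input n (b : nat -> K) (c : nat -> signs n -> K) M (m : nat) (w : signs n) : K :=
  if m is m'.+1 then (if (m' < M)%N then c m' w else 0) else lift p b w.

Lemma chain_sum n (b : nat -> K) (c : nat -> signs n -> K) M :
  \sum_(i < n) b i *: new_vec (rademacher_index i) +
  \sum_(m < M) \sum_u c m u *: new_vec (inr (cube m u)) =
  \sum_(m < M.+1) cube_sum m (chain (chain_input b c M) m).
Proof.
set d := chain_input b c M.
under [X in _ + X]eq_bigr do rewrite shifted_sum.
rewrite rademacher_sum /chain; under [RHS]eq_bigr do rewrite cube_sumD.
rewrite !big_split /= [X in _ = X + _]big_ord_recr [X in _ = _ + X]big_ord_recl /=.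
have -> : cube_sum M (coproj (d M.+1)) = 0.
  apply: cube_sum0 => w; rewrite /coproj /d /= ltnn.
  rewrite (_ : chain_input b c M M.+1 = fun=> 0) ?sub0r; last first.
    by apply/funext => v; rewrite /= ltnn.
  rewrite /proj /rsum big1 ?oppr0// => i _; rewrite /rcoef big1 ?mulr0// => v _.
  by rewrite mulr0.
rewrite addr0 addrCA; congr (_ + (_ + _)).
- by apply: eq_bigr => m _; congr cube_sum; congr coproj; apply/funext => v; rewrite /d /= ltn_ord.
- congr cube_sum; apply/funext => w; rewrite /d /=.
  have -> : chain_input b c M 0 = fun w => ((2 ^ n)%:R `^ (- p^-1))%:K * rsum b w + 0.
    by apply/funext => v; rewrite addr0.
  rewrite proj_linear proj_rsum /proj /rsum [X in _ + X]big1 ?addr0// => i _.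
  by rewrite /rcoef big1 ?mulr0// => v _; rewrite mulr0.
- by apply: eq_bigr => m _; congr cube_sum; congr proj; apply/funext => v; rewrite /d /= ltn_ord.
Qed.

Lemma cubes_norm_list (L : seq cubes) (Y : cubes -> K) : uniq L ->
  nrm (\sum_(j <- L) Y j *: e (sg j)) `^ p <= M0 * \sum_(j <- L) modulus (Y j) `^ p /\
  \sum_(j <- L) modulus (Y j) `^ p <= M0 * nrm (\sum_(j <- L) Y j *: e (sg j)) `^ p.
Proof.
move=> uL; have [tau st ts] := sg_bij.
have -> : Y = (Y \o tau) \o sg by apply/funext => j /=; rewrite st.
have := elp (s := map sg L) (Y \o tau); rewrite map_inj_uniq; last exact: bij_inj.
by move=> /(_ uL); rewrite !big_map.
Qed.

Definition cube_list N M : seq cubes :=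
  [seq cube x.1 x.2 | n <- iota 0 N, x <- [seq (m, w) | m <- iota 0 M, w <- enum (signs n)]].

Lemma sum_cube_list (V : nmodType) N M (F : cubes -> V) :
  \sum_(j <- cube_list N M) F j = \sum_(n < N) \sum_(m < M) \sum_(w : signs n) F (cube m w).
Proof.
rewrite big_allpairs_dep -(big_mkord xpredT (fun n => \sum_(m < M) \sum_(w : signs n) F (cube m w))).
rewrite /index_iota subn0; apply: eq_bigr => n _.
rewrite big_allpairs_dep -(big_mkord xpredT (fun m => \sum_(w : signs n) F (cube m w))).
rewrite /index_iota subn0; apply: eq_bigr => m _.
by rewrite big_enum.
Qed.

Lemma cube_list_uniq N M : uniq (cube_list N M).
Proof.
apply: allpairs_uniq_dep; rewrite ?iota_uniq//.
  move=> n _; apply: allpairs_uniq; rewrite ?iota_uniq ?enum_uniq//.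
  by move=> [? ?] [? ?] _ _ [-> ->].
move=> [n [m w]] [n' [m' w']] _ _ /= h.
by rewrite /cube /= in h.
Qed.

Lemma mem_cube_list N M n m (w : signs n) :
  (cube m w \in cube_list N M) = (n < N)%N && (m < M)%N.
Proof.
apply/allpairsPdep/andP => [[n' [[m' w'] [nN]]]|[nN mM]].
  move=> /allpairsP[[m2 w2] /= [mM _ [-> ->]]] h; move: nN mM; rewrite !mem_iota /= !add0n.
  have nn : n = n' by exact: (congr1 (@tag _ _) h).
  move: w2 h; rewrite -nn => w2 h; have /eqP := h; rewrite -tag_eqE /tag_eq /= eqxx /=.
  by rewrite tagged_asE => /eqP[-> _].
exists n, (m, w); rewrite mem_iota; split=> //.
by apply/allpairsP; exists (m, w); rewrite mem_iota mem_enum.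
Qed.

Lemma cubes_norm N M (y : forall n, nat -> signs n -> K) :
  nrm (\sum_(n < N) \sum_(m < M) cube_sum m (@y n m)) `^ p <=
    M0 * \sum_(n < N) \sum_(m < M) pnorm p (@y n m) /\
  \sum_(n < N) \sum_(m < M) pnorm p (@y n m) <=
    M0 * nrm (\sum_(n < N) \sum_(m < M) cube_sum m (@y n m)) `^ p.
Proof.
have := cubes_norm_list (fun j => y (tag j) (tagged j).1 (tagged j).2) (cube_list_uniq N M).
by rewrite !sum_cube_list.
Qed.

Definition rad_coef (a : new_index -> K) n (l : nat) : K :=
  if insub l is Some i then a (@rademacher_index n i) else 0.

Lemma rad_coefE a n (i : 'I_n) : rad_coef a n i = a (rademacher_index i).
Proof.
rewrite /rad_coef insubT// => il; congr (a (rademacher_index _)).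
exact: val_inj.
Qed.

Definition cube_coef (a : new_index -> K) n (m : nat) (u : signs n) : K := a (inr (cube m u)).

Definition box (a : new_index -> K) N M : X := \sum_(n < N)
  (\sum_(i < n) a (rademacher_index i) *: new_vec (rademacher_index i) +
   \sum_(m < M) \sum_(u : signs n) a (inr (cube m u)) *: new_vec (inr (cube m u))).

Definition box_power (a : new_index -> K) N M : R := \sum_(n < N)
  (pnorm p (lift p (rad_coef a n) : signs n -> K) + \sum_(m < M) pnorm p (@cube_coef a n m)).

(** By [chain_sum] a combination of the new vectors is, cube by cube, a chain started by a
    Rademacher sum; [chain_bounds] then undoes the shift. *)
Lemma box_norm : exists2 C : R, 1 <= C & forall a N M,
  nrm (box a N M) `^ p <= C * box_power a N M /\ box_power a N M <= C * nrm (box a N M) `^ p.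
Proof.
have [C C1 hC] := chain_bounds k p1; have C0 : 0 <= C by exact: le_trans C1.
have M00 : 0 <= M0 by exact: le_trans M01.
exists (M0 * C) => [|a N M]; first exact: mulr_ege1.
pose d n := chain_input (rad_coef a n) (@cube_coef a n) M.
have boxE : box a N M = \sum_(n < N) \sum_(m < M.+1) cube_sum m (chain (@d n) m).
  apply: eq_bigr => n _; rewrite -chain_sum; congr (_ + _).
  by apply: eq_bigr => i _; rewrite rad_coefE.
have powE : box_power a N M = \sum_(n < N) \sum_(m < M.+1) pnorm p (@d n m).
  apply: eq_bigr => n _; rewrite [RHS]big_ord_recl; congr (_ + _).
  by apply: eq_bigr => m _; apply: eq_bigr => w _; rewrite /d /= ltn_ord.
have proj0 n w : proj (@d n 0%N) w = @d n 0%N w.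
  rewrite {2}/d /= /lift -[RHS]addr0 -(proj_rsum (rad_coef a n) w).
  have -> : @d n 0%N = fun w => ((2 ^ n)%:R `^ (- p^-1))%:K * rsum (rad_coef a n) w + 0.
    by apply/funext => v; rewrite addr0.
  rewrite proj_linear proj_rsum; congr (_ + _).
  rewrite /proj /rsum big1// => i _; rewrite /rcoef big1 ?mulr0// => v _.
  by rewrite mulr0.
have dM n m : (M < m)%N -> forall w, @d n m w = 0.
  by case: m => // m; rewrite ltnS => Mm w; rewrite /d /= ltnNge Mm.
have [h1 h2] := cubes_norm N M.+1 (fun n m => chain (@d n) m).
rewrite boxE powE; split.
  apply: le_trans h1 _; rewrite -mulrA ler_wpM2l// mulr_sumr; apply: ler_sum => n _.
  by have [] := hC n (@d n) M (@proj0 n) (@dM n).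
apply: le_trans (_ : C * \sum_(n < N) \sum_(m < M.+1) pnorm p (chain (@d n) m) <= _).
  rewrite mulr_sumr; apply: ler_sum => n _.
  by have [] := hC n (@d n) M (@proj0 n) (@dM n).
by rewrite [M0 * C]mulrC -mulrA ler_wpM2l.
Qed.

(** The Rademacher part is comparable with a Euclidean norm, and the rest is a sum of powers of
    moduli: both depend on the moduli of the coefficients only. *)
Lemma box_power_le : exists2 C : R, 1 <= C & forall (a a' : new_index -> K) N M,
  (forall j, modulus (a j) <= modulus (a' j)) -> box_power a N M <= C * box_power a' N M.
Proof.
have p0 : 0 < p by exact: lt_trans p1.
have [C C1 hC] := lift_bounded k p1; have C0 : 0 <= C by exact: le_trans C1.
exists (C * C) => [|a a' N M aa']; first exact: mulr_ege1.
rewrite mulr_sumr; apply: ler_sum => n _; rewrite mulrDr; apply: lerD.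
  have [h1 _] := hC n (rad_coef a n); have [_ h2] := hC n (rad_coef a' n).
  apply: le_trans h1 _; rewrite -mulrA ler_wpM2l//; apply: le_trans h2.
  apply: ge0_ler_powR; rewrite ?nnegrE ?l2_ge0 ?(ltW p0)//.
  apply: ler_wsqrtr; apply: ler_sum => i _.
  by rewrite lerXn2r ?nnegrE ?modulus_ge0// !rad_coefE.
rewrite mulr_sumr; apply: ler_sum => m _; apply: (@le_trans _ _ (pnorm p (@cube_coef a' n m))).
  apply: ler_sum => w _; apply: ge0_ler_powR; rewrite ?nnegrE ?modulus_ge0 ?(ltW p0)//.
  exact: aa'.
by rewrite ler_peMl ?pnorm_ge0// mulr_ege1.
Qed.

Definition new_list N M : seq new_index :=
  [seq @rademacher_index n i | n <- iota 0 N, i <- enum 'I_n] ++ map inr (cube_list N M).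

Lemma sum_new_list (V : nmodType) N M (F : new_index -> V) :
  \sum_(j <- new_list N M) F j = \sum_(n < N) (\sum_(i < n) F (rademacher_index i) +
    \sum_(m < M) \sum_(u : signs n) F (inr (cube m u))).
Proof.
rewrite big_cat big_map sum_cube_list big_split /=; congr (_ + _).
rewrite big_allpairs_dep -(big_mkord xpredT (fun n => \sum_(i < n) F (rademacher_index i))).
by rewrite /index_iota subn0; apply: eq_bigr => n _; rewrite big_enum.
Qed.

Lemma new_list_uniq N M : uniq (new_list N M).
Proof.
rewrite cat_uniq map_inj_uniq ?cube_list_uniq ?andbT; last by move=> ? ? [].
apply/andP; split.
  apply: allpairs_uniq_dep; rewrite ?iota_uniq//.
    by move=> n _; exact: enum_uniq.
  by move=> [n i] [n' i'] _ _ /= [].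
by apply/hasPn => j /mapP[x _ ->]; apply/negP => /allpairsPdep[n [i []]].
Qed.

Lemma mem_new_list (s : seq new_index) : exists N M, {subset s <= new_list N M}.
Proof.
pose bound (j : new_index) : nat :=
  match j with inl (existT n _) => n.+1 | inr (existT n (m, _)) => (n + m).+1 end.
pose B := \max_(j <- s) bound j; exists B, B => j js.
have : (bound j <= B)%N by exact: (@leq_bigmax_seq _ s xpredT bound j js isT).
rewrite mem_cat; case: j js => [[n i]|[n [m u]]] _ /= jB; apply/orP; [left|right].
  by apply/allpairsPdep; exists n, i; rewrite mem_iota mem_enum; split.
have -> : inr (existT _ n (m, u)) = inr (cube m u) :> new_index by [].
rewrite mem_map; last by move=> ? ? [].
by rewrite mem_cube_list; apply/andP; split; lia.
Qed.

Lemma box_of_list (s : seq new_index) : uniq s -> exists N M, forall a : new_index -> K,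
  \sum_(j <- s) a j *: new_vec j = box (fun j => if j \in s then a j else 0) N M.
Proof.
move=> us; have [N [M sub]] := mem_new_list s; exists N, M => a.
rewrite /box -(sum_new_list N M (fun j => (if j \in s then a j else 0) *: new_vec j)).
rewrite [RHS](eq_bigr (fun j => if j \in s then a j *: new_vec j else 0)); last first.
  by move=> j _; case: (j \in s); rewrite ?scale0r.
rewrite -[RHS]big_mkcond -[RHS]big_filter; apply: perm_big; apply: uniq_perm => //.
  by rewrite filter_uniq// new_list_uniq.
move=> j; rewrite mem_filter; case: (boolP (j \in s)) => //= /sub ->.
by [].
Qed.

Lemma new_vec_unc : exists C, unc new_vec C.
Proof.
have p0 : 0 < p by exact: lt_trans p1.
have [C C1 hC] := box_norm; have [D D1 hD] := box_power_le.
have C0 : 0 <= C by exact: le_trans C1.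
have D0 : 0 <= D by exact: le_trans D1.
pose B := (C * (D * C)) `^ p^-1; have B0 : 0 <= B by exact: powR_ge0.
exists B; split=> // s a th us th1.
have [N [M hb]] := box_of_list us; rewrite (hb a) (hb (fun i => th i * a i)).
set a1 := fun j => _; set a2 := fun j => _.
have le12 j : modulus (a1 j) <= modulus (a2 j).
  rewrite /a1 /a2; case: ifP => // _; rewrite modulusM ler_piMl ?modulus_ge0//.
have [h1 _] := hC a1 N M; have [_ h2] := hC a2 N M.
have h3 := hD a1 a2 N M le12.
have h : nrm (box a1 N M) `^ p <= C * (D * C) * nrm (box a2 N M) `^ p.
  apply: le_trans h1 _; rewrite -!mulrA ler_wpM2l//; apply: le_trans h3 _.
  by rewrite ler_wpM2l.
have root (x : R) : 0 <= x -> x = (x `^ p) `^ p^-1.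
  by move=> x0; rewrite -powRrM mulfV ?gt_eqF// powRr1.
rewrite (root (nrm (box a1 N M)))// ?nrm_ge0// [nrm (box a2 N M)]root ?nrm_ge0//.
rewrite -powRM ?powR_ge0 ?mulr_ge0//.
by apply: ge0_ler_powR; rewrite ?nnegrE ?mulr_ge0 ?powR_ge0 ?invr_ge0 ?(ltW p0).
Qed.

(** The Rademacher part of a unit vector of copy [m] comes from the shifted vectors of copy [m - 1],
    and for copy 0 from the Rademacher vectors themselves. *)
Lemma cube_vec_in_span n m (w : signs n) : in_span new_vec (e (sg (cube m w))).
Proof.
have -> : e (sg (cube m w)) = cube_sum m (delta w).
  rewrite /cube_sum (bigD1 w)//= /delta eqxx scale1r big1 ?addr0// => u /negbTE ->.
  by rewrite scale0r.
have dE : (delta w : signs n -> K) = fun v => coproj (delta w) v + proj (delta w) v.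
  by apply/funext => v; rewrite subrK.
have co_span : in_span new_vec (cube_sum m (coproj (delta w))).
  have := shifted_sum m (coproj (delta w : signs n -> K)).
  rewrite (_ : coproj (coproj (delta w)) = coproj (delta w)); last first.
    by apply/funext => v; rewrite {1}/coproj proj_coproj subr0.
  rewrite [cube_sum m.+1 _]cube_sum0 ?addr0 => [<-|v]; last exact: proj_coproj.
  by apply: in_span_sum => u; apply: in_spanZ; exact: in_span_gen.
have pr_span : in_span new_vec (cube_sum m (proj (delta w))).
  case: m {co_span} => [|m].
    have := @rademacher_sum n (fun i => ((2 ^ n)%:R `^ (p^-1))%:K * rcoef (delta w) i).
    rewrite (_ : lift p _ = proj (delta w)) => [<-|].
      by apply: in_span_sum => i; apply: in_spanZ; exact: in_span_gen.
    apply/funext => v; rewrite /lift /proj -[LHS]addr0.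
    rewrite (_ : rsum _ _ = ((2 ^ n)%:R `^ (p^-1))%:K * rsum (rcoef (delta w)) v); last first.
      by rewrite /rsum mulr_sumr; apply: eq_bigr => i _; rewrite mulrCA.
    rewrite addr0 mulrA -of_realM -powRD ?addNr ?powRr0 ?of_real1 ?mul1r//.
    by rewrite eqxx implyTb pnatr_eq0 expn_eq0.
  have := shifted_sum m (proj (delta w : signs n -> K)).
  rewrite [cube_sum m _]cube_sum0 ?add0r; last first.
    by move=> v; rewrite /coproj projK subrr.
  rewrite (_ : proj (proj (delta w)) = proj (delta w)); last by apply/funext => v; exact: projK.
  by move=> <-; apply: in_span_sum => u; apply: in_spanZ; exact: in_span_gen.
by rewrite dE cube_sumD; apply: in_spanD.
Qed.

Lemma new_vec_dense : dense_span e -> dense_span new_vec.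
Proof.
move=> de x eps e0; have [s [a h]] := de x eps e0; have [tau st ts] := sg_bij.
have /in_span_coef[s' [b [_ E]]] : in_span new_vec (\sum_(i <- s) a i *: e i).
  apply: in_span_sum => i; apply: in_spanZ; rewrite -(ts i).
  by case: (tau i) => n [m w]; exact: cube_vec_in_span.
by exists s', b; rewrite -E.
Qed.

End ShiftedBasis.

(** * Norms of the new basis vectors *)

Section Exponent.
Context (R : realType) (k : scalar_kind).
Local Notation K := (scalars R k).
Local Notation "t %:K" := (@of_real R k t) (at level 2, format "t %:K").
Local Notation delta := (@delta R k _).

Lemma power_le_exponent (a b C : R) :
  (forall n, (0 < n)%N -> n%:R `^ a <= C * n%:R `^ b) -> a <= b.
Proof.
move=> h; rewrite leNgt; apply/negP => ab; have d0 : 0 < a - b by rewrite subr_gt0.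
have C0 : 0 < C by have := h 1%N isT; rewrite !one_powR mulr1 => /(lt_le_trans ltr01).
pose x := (C + 1) `^ (a - b)^-1.
have x0 : 0 <= x by exact: powR_ge0.
have := archi_boundP x0; set n := Num.bound x => xn.
have n0 : (0 < n)%N by rewrite -(ltr0n R) (le_lt_trans x0).
have nR : n%:R != 0 :> R by rewrite pnatr_eq0 -lt0n.
have := h n n0; rewrite -[a in n%:R `^ a](subrK b) powRD ?nR ?implybT//.
rewrite ler_pM2r ?powR_gt0 ?ltr0n// leNgt => /negP; apply.
have : x `^ (a - b) <= n%:R `^ (a - b).
  by apply: ge0_ler_powR; rewrite ?nnegrE ?(ltW d0)// ltW.
rewrite /x -powRrM mulVf ?gt_eqF// powRr1; last by rewrite addr_ge0// ltW.
by apply: lt_le_trans; rewrite ltrDl.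
Qed.

Section Normalize.
Context (X : completeNormedModType K).

Definition normalize (f : nat -> X) (n : nat) : X := (nrm (f n))^-1%:K *: f n.

Lemma nrm_normalize (f : nat -> X) n : f n != 0 -> nrm (normalize f n) = 1.
Proof. by move=> f0; rewrite nrmZr ger0_norm ?invr_ge0 ?nrm_ge0// mulVf// gt_eqF// nrm_gt0. Qed.

Lemma normalize_basis (f : nat -> X) : unconditional_basis f -> unconditional_basis (normalize f).
Proof.
move=> fb; have [co [C hco]] := basis_coordinates fb.
have f0 n : f n != 0 by have [_ h _ _ _] := hco.
have fK n : (nrm (f n))%:K *: normalize f n = f n.
  by rewrite scalerA -of_realM mulfV ?of_real1 ?scale1r// gt_eqF// nrm_gt0.
apply: (basis_criterion (C := C)).
- by move=> n; rewrite -nrm_gt0 nrm_normalize// ltr01.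
- have [C0 hC] := coordinates_unc hco; split=> // s a th us th1.
  have := hC s (fun i => a i * (nrm (f i))^-1%:K) th us th1.
  under eq_bigr do rewrite mulrA -scalerA.
  by under [X in _ <= _ * nrm X -> _]eq_bigr do rewrite -scalerA.
- move=> x eps /(coordinates_dense hco x)[s [a h]].
  exists s, (fun i => a i * (nrm (f i))%:K).
  by under eq_bigr do rewrite -scalerA fK.
Qed.

End Normalize.

Section CubeNorms.
Context (X : completeNormedModType K).
Context (e : nat -> X) (p M0 : R) (sg : cubes -> nat).
Context (p1 : 1 < p) (M01 : 1 <= M0) (elp : lp_like e p M0) (sg_bij : bijective sg).

Let p0 : 0 < p. Proof. exact: lt_trans p1. Qed.

Lemma cube_inj n m m' (w w' : signs n) : cube m w = cube m' w' -> m = m' /\ w = w'.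
Proof.
move=> /eqP; rewrite -tag_eqE /tag_eq /= eqxx /= tagged_asE.
by move=> /eqP[-> ->].
Qed.

Lemma fixed_cubes_norm n M (y : nat -> signs n -> K) :
  nrm (\sum_(m < M) cube_sum e sg m (y m)) `^ p <= M0 * \sum_(m < M) pnorm p (y m) /\
  \sum_(m < M) pnorm p (y m) <= M0 * nrm (\sum_(m < M) cube_sum e sg m (y m)) `^ p.
Proof.
have ex (j : cubes) : exists t : K, forall m w, j = cube m w -> t = y m w.
  have [[m [w ->]]|no] := pselect (exists m (w : signs n), j = cube m w).
    by exists (y m w) => m' w' /cube_inj[-> ->].
  by exists 0 => m w jE; case: no; exists m, w.
have [Y hY] := choice ex.
pose L := [seq cube m w | m <- iota 0 M, w <- enum (signs n)].
have sumL (V : nmodType) (F : cubes -> V) :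
    \sum_(j <- L) F j = \sum_(m < M) \sum_(w : signs n) F (cube m w).
  rewrite big_allpairs_dep -(big_mkord xpredT (fun m => \sum_(w : signs n) F (cube m w))).
  by rewrite /index_iota subn0; apply: eq_bigr => m _; rewrite big_enum.
have uL : uniq L.
  apply: allpairs_uniq; rewrite ?iota_uniq ?enum_uniq//.
  by move=> [m w] [m' w'] _ _ /= /cube_inj[-> ->].
have := cubes_norm_list elp sg_bij Y uL; rewrite !sumL.
have -> : \sum_(m < M) \sum_(w : signs n) modulus (Y (cube m w)) `^ p = \sum_(m < M) pnorm p (y m).
  by apply: eq_bigr => m _; apply: eq_bigr => w _; rewrite (hY _ m w).
have -> // : \sum_(m < M) \sum_(w : signs n) Y (cube m w) *: e (sg (cube m w)) =
  \sum_(m < M) cube_sum e sg m (y m).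
by apply: eq_bigr => m _; apply: eq_bigr => w _; rewrite (hY _ m w).
Qed.

Lemma rademacher_norm : exists2 C : R, 1 <= C & forall n (b : nat -> K),
  nrm (cube_sum e sg 0 (lift p b : signs n -> K)) `^ p <= C * l2 n b `^ p /\
  l2 n b `^ p <= C * nrm (cube_sum e sg 0 (lift p b : signs n -> K)) `^ p.
Proof.
have [C C1 hC] := lift_bounded k p1; have C0 : 0 <= C by exact: le_trans C1.
have M00 : 0 <= M0 by exact: le_trans M01.
exists (M0 * C) => [|n b]; first exact: mulr_ege1.
have [h1 h2] := hC n b.
have := @fixed_cubes_norm n 1 (fun _ => lift p b); rewrite !big_ord1 => -[h3 h4]; split.
  by rewrite (le_trans h3)// -mulrA ler_wpM2l.
by rewrite (le_trans h2)// [M0 * C]mulrC -mulrA ler_wpM2l.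
Qed.

Lemma pnorm_delta n (u : signs n) : pnorm p (delta u : signs n -> K) = 1.
Proof.
rewrite /pnorm (bigD1 u)//= /delta eqxx modulus1 one_powR big1 ?addr0// => w /negbTE ->.
by rewrite modulus0 powR0 ?gt_eqF.
Qed.

Lemma new_vec_norm : exists2 C : R, 1 <= C & forall j,
  nrm (new_vec e p sg j) `^ p <= C /\ 1 <= C * nrm (new_vec e p sg j) `^ p.
Proof.
have [C C1 hC] := rademacher_norm; have C0 : 0 <= C by exact: le_trans C1.
have [D D1 hD] := proj_bounded k p1; have D0 : 0 <= D by exact: le_trans D1.
have M00 : 0 <= M0 by exact: le_trans M01.
pose T := 2 `^ p : R; have T1 : 1 <= T.
  by rewrite -[leLHS](one_powR p) ge0_ler_powR ?nnegrE ?(ltW p0)// ler1n.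
have T0 : 0 <= T by exact: le_trans T1.
pose B := C + M0 * (T * (1 + D) + D) + T * M0.
have B1 : 0 <= M0 * (T * (1 + D) + D) by rewrite mulr_ge0// addr_ge0// mulr_ge0// addr_ge0.
have B2 : 0 <= T * M0 by rewrite mulr_ge0.
exists B => [|[[n i]|[n [m u]]]]; first by rewrite /B; lra.
  pose b : nat -> K := fun l => if l == i then 1 else 0.
  have l2b : l2 n b = 1.
    rewrite /l2 /sqsum (bigD1 i)//= /b eqxx modulus1 expr1n big1 ?addr0 ?sqrtr1// => j ji.
    by rewrite (_ : (j == i :> nat) = false) ?modulus0 ?expr0n//; apply/negbTE.
  have := hC n b; rewrite l2b one_powR mulr1 => -[h1 h2].
  have z0 : 0 <= nrm (new_vec e p sg (inl (existT _ n i))) `^ p by exact: powR_ge0.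
  split; first by rewrite (le_trans h1)// /B; lra.
  by rewrite (le_trans h2)// ler_wpM2r// /B; lra.
pose y m' : signs n -> K := if m' == m then coproj (delta u)
  else if m' == m.+1 then proj (delta u) else fun=> 0.
have ym : y m = coproj (delta u) by rewrite /y eqxx.
have ym1 : y m.+1 = proj (delta u) by rewrite /y eqxx gtn_eqF.
have y0 (l : 'I_m) : y l = fun=> 0 by rewrite /y !ltn_eqF// ltnW// ltnS.
have := fixed_cubes_norm m.+2 y; rewrite !big_ord_recr /= ym ym1.
rewrite [X in nrm (X + _ + _)]big1 ?add0r; last by move=> l _; rewrite y0 cube_sum0.
rewrite [X in _ * (X + _ + _)]big1 ?add0r; last first.
  by move=> l _; rewrite y0 /pnorm big1// => w _; rewrite modulus0 powR0 ?gt_eqF.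
rewrite big1 ?add0r; last first.
  by move=> l _; rewrite y0 /pnorm big1// => w _; rewrite modulus0 powR0 ?gt_eqF.
move=> [h1 h2].
have e1 : pnorm p (proj (delta u : signs n -> K)) <= D.
  by have := hD n (delta u); rewrite pnorm_delta mulr1.
have e2 : pnorm p (coproj (delta u : signs n -> K)) <= T * (1 + D).
  apply: le_trans (pnormD _ _ p0) _; rewrite pnormN ler_wpM2l// pnorm_delta.
  by rewrite lerD2l.
have e3 : 1 <= T * (pnorm p (coproj (delta u : signs n -> K)) + pnorm p (proj (delta u : signs n -> K))).
  rewrite -(pnorm_delta u) (le_trans _ (pnormD _ _ p0))// le_eqVlt; apply/orP; left; apply/eqP.
  by apply: eq_bigr => w _; rewrite subrK.
split.
  have := ler_wpM2l M00 (lerD e2 e1); move: h1; rewrite /new_vec /B; lra.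
have := ler_wpM2l T0 h2; rewrite mulrA => h3.
apply: le_trans e3 (le_trans h3 _); rewrite ler_wpM2r ?powR_ge0// /B; lra.
Qed.

End CubeNorms.
End Exponent.

(** * The exponent is 2 *)

Section ExponentTwo.
Context (R : realType) (k : scalar_kind).
Local Notation K := (scalars R k).
Local Notation "t %:K" := (@of_real R k t) (at level 2, format "t %:K").
Local Notation delta := (@delta R k _).
Context (X : completeNormedModType K).

(** The growth exponent of the shifted basis is 1/2 along the Rademacher vectors of one cube, and
    [1 / p] along the copies of the cube of dimension 0. *)
Lemma stable_exponent (e : nat -> X) (p M0 : R) :
  stable X -> unconditional_basis e -> 1 < p -> 1 <= M0 -> lp_like e p M0 -> p = 2.
Proof.
move=> st eb p1 M01 elp; have p0 : 0 < p by exact: lt_trans p1.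
have pi0 : 0 < p^-1 by rewrite invr_gt0.
have [sg sg_bij] : exists sg : cubes -> nat, bijective sg.
  apply: (@nat_bijection _ (fun m => @cube 0 m tt)) => m m' mm'.
  by have [] := cube_inj mm'.
have [rk rk_bij] : exists rk : new_index -> nat, bijective rk.
  by apply: (@nat_bijection _ (fun m => inr (@cube 0 m tt))) => m m' [].
have [kr rkK krK] := rk_bij.
(* The shifted basis of [cubes], enumerated. *)
pose h := new_vec e p sg; pose f := h \o kr.
have [C uh] := new_vec_unc p1 M01 elp sg_bij.
have [co [C' hco]] := basis_coordinates eb.
have dh : dense_span h by apply: new_vec_dense => //; exact: coordinates_dense hco.
have [B B1 hB] := new_vec_norm p1 M01 elp sg_bij.
have B0 : 0 < B by exact: lt_le_trans ltr01 B1.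
have h0 j : h j != 0.
  apply/negP => /eqP hj; have [_] := hB j; rewrite -/(h j) hj nrm0 powR0 ?gt_eqF// mulr0.
  by rewrite ler10.
have fb : unconditional_basis f.
  apply: (basis_criterion (C := C)).
  - by move=> n; exact: h0.
  - by apply: (unc_inj (h := kr)) => //; exact: can_inj krK.
  - move=> x eps e0; have [s [a hs]] := dh x eps e0.
    exists (map rk s), (a \o kr); rewrite big_map.
    by under eq_bigr do rewrite /= /f /= rkK.
have f0 n : f n != 0 by exact: h0.
have [al [c [al01 c1 pow]]] :=
  perfectly_homogeneous_power st (normalize_basis fb) (fun n => nrm_normalize (f0 n)).
pose r := B `^ p^-1; have r0 : 0 < r by rewrite powR_gt0.
have root (x : R) : 0 <= x -> (x `^ p) `^ p^-1 = x.
  by move=> x0; rewrite -powRrM mulfV ?gt_eqF// powRr1.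
have h_le j : nrm (h j) <= r.
  rewrite -(root (nrm (h j))) ?nrm_ge0//; apply: ge0_ler_powR; rewrite ?nnegrE ?powR_ge0 ?(ltW pi0)//.
    exact: ltW.
  by have [] := hB j.
have h_ge j : 1 <= r * nrm (h j).
  rewrite -(root (nrm (h j))) ?nrm_ge0// -powRM ?powR_ge0 ?(ltW B0)// -[leLHS](one_powR p^-1).
  by apply: ge0_ler_powR; rewrite ?nnegrE ?mulr_ge0 ?powR_ge0 ?(ltW pi0) ?(ltW B0)//; have [] := hB j.
have C0 : 0 <= C by have [] := uh.
have uf : unc f C by apply: (unc_inj (h := kr)) => //; exact: can_inj krK.
have norm_sum (s : seq nat) : uniq s ->
    nrm (\sum_(i <- s) f i) <= C * r * nrm (\sum_(i <- s) normalize f i) /\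
    nrm (\sum_(i <- s) normalize f i) <= C * r * nrm (\sum_(i <- s) f i).
  move=> us; split.
    have := @unc_le _ _ X _ f C s (fun=> 1) (fun i => r%:K * (nrm (f i))^-1%:K) uf us.
    have -> : \sum_(i <- s) (r%:K * (nrm (f i))^-1%:K) *: f i =
        r%:K *: \sum_(i <- s) normalize f i.
      by rewrite scaler_sumr; apply: eq_bigr => i _; rewrite scalerA.
    rewrite sum_const_scale nrmZr gtr0_norm// mulrA; apply => i _.
    rewrite modulus1 -of_realM modulus_of_real ger0_norm ?mulr_ge0 ?invr_ge0 ?nrm_ge0 ?(ltW r0)//.
    by rewrite ler_pdivlMr ?nrm_gt0 ?f0// mul1r; exact: h_le.
  have := @unc_le _ _ X _ f C s (fun i => (nrm (f i))^-1%:K) (fun=> r%:K) uf us.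
  rewrite -scaler_sumr nrmZr gtr0_norm// mulrA; apply => i _.
  rewrite !modulus_of_real !ger0_norm ?invr_ge0 ?nrm_ge0 ?(ltW r0)//.
  by rewrite -[leLHS]mul1r ler_pdivrMr ?nrm_gt0 ?f0//; exact: h_ge.
have c0 : 0 <= c by exact: le_trans c1.
have Cr0 : 0 <= C * r by rewrite mulr_ge0// ltW.
have growth (s : seq new_index) (b Q : R) : uniq s -> s != [::] -> 0 <= Q ->
    nrm (\sum_(j <- s) h j) `^ p <= Q * ((size s)%:R `^ b) `^ p ->
    ((size s)%:R `^ b) `^ p <= Q * nrm (\sum_(j <- s) h j) `^ p ->
    (size s)%:R `^ al <= (c * (C * r) * Q `^ p^-1) * (size s)%:R `^ b /\
    (size s)%:R `^ b <= (c * (C * r) * Q `^ p^-1) * (size s)%:R `^ al.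
  move=> us s0 Q0 q1 q2; have us' : uniq (map rk s) by rewrite map_inj_uniq//; exact: bij_inj.
  have s0' : map rk s != [::] by case: (s) s0.
  have := norm_sum _ us'; have := pow _ us' s0'; rewrite size_map.
  have -> : \sum_(i <- map rk s) f i = \sum_(j <- s) h j.
    by rewrite big_map; apply: eq_bigr => j _; rewrite /f /= rkK.
  set u := nrm (\sum_(j <- s) h j) in q1 q2 *; set v := nrm (\sum_(i <- _) _).
  have u0 : 0 <= u := nrm_ge0 _; have v0 : 0 <= v := nrm_ge0 _.
  set na := _ `^ al; set nb := _ `^ b in q1 q2 *.
  have nb0 : 0 <= nb by exact: powR_ge0.
  have na0 : 0 <= na by exact: powR_ge0.
  set q := Q `^ p^-1; have q0 : 0 <= q by exact: powR_ge0.
  have {}q1 : u <= q * nb.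
    rewrite -(root u u0) -(root nb nb0) -powRM ?powR_ge0//.
    by apply: ge0_ler_powR; rewrite ?nnegrE ?mulr_ge0 ?powR_ge0 ?(ltW pi0).
  have {}q2 : nb <= q * u.
    rewrite -(root u u0) -(root nb nb0) -powRM ?powR_ge0//.
    by apply: ge0_ler_powR; rewrite ?nnegrE ?mulr_ge0 ?powR_ge0 ?(ltW pi0).
  move=> [a1 a2] [b1 b2]; split.
    apply: le_trans a1 _; rewrite -!mulrA ler_wpM2l//.
    by apply: le_trans b2 _; rewrite -mulrA !ler_wpM2l// ltW.
  apply: le_trans q2 _; apply: le_trans (ler_wpM2l q0 b1) _.
  apply: le_trans (ler_wpM2l q0 (ler_wpM2l Cr0 a2)) _.
  by rewrite [leLHS](_ : _ = c * (C * r) * q * na)//; ring.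
(* The [n] Rademacher vectors of a cube span a space uniformly isomorphic to the Euclidean one. *)
have al2 : al = 2^-1.
  have [Q Q1 hQ] := rademacher_norm p1 M01 elp sg_bij; have Q0 : 0 <= Q by exact: le_trans Q1.
  have key n : (0 < n)%N ->
      n%:R `^ al <= (c * (C * r) * Q `^ p^-1) * n%:R `^ (2^-1) /\
      n%:R `^ (2^-1) <= (c * (C * r) * Q `^ p^-1) * n%:R `^ al.
    move=> n0; pose s := [seq @rademacher_index n i | i <- enum 'I_n].
    have us : uniq s.
      rewrite map_inj_uniq ?enum_uniq// => i j [/eqP].
      by rewrite -tag_eqE /tag_eq /= eqxx /= tagged_asE => /eqP.
    have s0 : s != [::] by rewrite -size_eq0 size_map size_enum_ord -lt0n.
    have hE : \sum_(j <- s) h j = cube_sum e sg 0 (lift p (fun=> 1) : signs n -> K).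
      rewrite big_map big_enum -rademacher_sum.
      by apply: eq_bigr => i _; rewrite scale1r.
    have l2n : l2 n (fun=> 1 : K) = n%:R `^ 2^-1.
      rewrite powR12_sqrt// /l2 /sqsum.
      by under eq_bigr do rewrite modulus1 expr1n; rewrite sumr_const card_ord.
    have := growth s 2^-1 Q us s0 Q0; rewrite hE size_map size_enum_ord -l2n.
    by have [h1 h2] := hQ n (fun=> 1); apply.
  by apply/le_anti/andP; split; apply: power_le_exponent => n /key[]; eauto.
(* The cube of dimension 0 has no Rademacher part, so its copies are original basis vectors. *)
have alp : al = p^-1.
  have key n : (0 < n)%N ->
      n%:R `^ al <= (c * (C * r) * M0 `^ p^-1) * n%:R `^ (p^-1) /\
      n%:R `^ (p^-1) <= (c * (C * r) * M0 `^ p^-1) * n%:R `^ al.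
    move=> n0; pose s := [seq inr (@cube 0 m tt) : new_index | m <- iota 0 n].
    have hE : \sum_(j <- s) h j = \sum_(m < n) cube_sum e sg m (delta (tt : signs 0)).
      rewrite big_map -(big_mkord xpredT (fun m => cube_sum e sg m (delta (tt : signs 0)))).
      rewrite /index_iota subn0; apply: eq_bigr => m _; rewrite /h /new_vec /=.
      have pr0 : proj (delta (tt : signs 0)) = fun=> 0.
        by apply/funext => w; rewrite /proj /rsum big_ord0.
      rewrite pr0 [cube_sum e sg m.+1 _]cube_sum0 ?addr0//; congr cube_sum.
      by apply/funext => w; rewrite /coproj pr0 subr0.
    have := fixed_cubes_norm elp sg_bij n (fun m => delta (tt : signs 0)).
    have -> : \sum_(m < n) pnorm p (delta (tt : signs 0)) = n%:R.
      by under eq_bigr do rewrite pnorm_delta//; rewrite sumr_const card_ord.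
    rewrite -hE => -[h1 h2].
    have nE : (n%:R `^ p^-1) `^ p = n%:R :> R by rewrite -powRrM mulVf ?gt_eqF// powRr1.
    have us : uniq s by rewrite map_inj_uniq ?iota_uniq// => m m' [].
    have s0 : s != [::] by rewrite -size_eq0 size_map size_iota -lt0n.
    have := growth s p^-1 M0 us s0 (le_trans ler01 M01).
    by rewrite size_map size_iota nE; apply.
  by apply/le_anti/andP; split; apply: power_le_exponent => n /key[]; eauto.
by rewrite -[p]invrK -alp al2 invrK.
Qed.

End ExponentTwo.

(** * Isomorphisms *)

Section Isomorphisms.
Context (R : realType) (k : scalar_kind).
Local Notation K := (scalars R k).
Local Notation "t %:K" := (@of_real R k t) (at level 2, format "t %:K").

Lemma lipschitz_continuous (X Y : normedModType K) (f : X -> Y) (B : R) : 0 <= B ->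
  (forall x y, nrm (f x - f y) <= B * nrm (x - y)) -> continuous f.
Proof.
move=> B0 fB x; apply/cvgrPdist_le => eps eps0.
have em : eps = (modulus eps)%:K by rewrite modulusE gtr0_norm.
have m0 : 0 < modulus eps by rewrite -(of_real_lt k) -em of_real0.
have B1 : 0 < B + 1 by rewrite ltr_wpDl.
have d0 : 0 < (modulus eps / (B + 1))%:K :> K by rewrite -(of_real0 R k) of_real_lt divr_gt0.
near=> y.
have h : `|x - y| <= (modulus eps / (B + 1))%:K.
  by near: y; apply: cvgr_dist_le => //; exact: cvg_id.
rewrite -nrmE em of_real_le; move: h; rewrite -nrmE of_real_le ler_pdivlMr// => h.
apply: le_trans (fB x y) _; apply: le_trans h; rewrite mulrC ler_wpM2l ?nrm_ge0// lerDl//.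
Unshelve. all: by end_near. Qed.

Lemma continuous_bounded (X Y : normedModType K) (f : X -> Y) :
  (forall (a : K) x, f (a *: x) = a *: f x) -> continuous f ->
  exists2 B : R, 0 <= B & forall x, nrm (f x) <= B * nrm x.
Proof.
move=> fZ fc; have f0 : f 0 = 0 by have := fZ 0 0; rewrite !scale0r.
have /cvgrPdist_le/(_ 1 ltr01) := fc 0.
rewrite f0 => /nbhs_ballP[d /= d0 hd].
have dm : d = (modulus d)%:K by rewrite modulusE gtr0_norm.
have m0 : 0 < modulus d by rewrite -(of_real_lt k) -dm of_real0.
have small x : nrm x < modulus d -> nrm (f x) <= 1.
  move=> xd; have := hd x; rewrite -ball_normE /ball_ /= !sub0r !normrN.
  by rewrite dm -!nrmE of_real_lt -of_real1 of_real_le; apply.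
exists (2 / modulus d) => [|x]; first by rewrite divr_ge0// ltW.
have [->|x0] := eqVneq x 0; first by rewrite f0 !nrm0 mulr0.
have nx : 0 < nrm x by rewrite nrm_gt0.
pose t := modulus d / 2 / nrm x; have t0 : 0 < t by rewrite !divr_gt0.
have : nrm (f (t%:K *: x)) <= 1.
  apply: small; rewrite nrmZr gtr0_norm// /t divfK ?gt_eqF//.
  by rewrite ltr_pdivrMr// ltr_pMr// ltr1n.
rewrite fZ nrmZr gtr0_norm// /t -ler_pdivlMl ?divr_gt0// => h; apply: le_trans h _.
by rewrite mulr1 !invfM !invrK le_eqVlt; apply/orP; left; apply/eqP; field; rewrite !gt_eqF.
Qed.

Lemma isomorphic_of_bounds (X Y : normedModType K) (f : X -> Y) (B : R) : 0 <= B ->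
  (forall (a : K) x y, f (a *: x + y) = a *: f x + f y) ->
  (forall x, nrm (f x) <= B * nrm x) -> (forall x, nrm x <= B * nrm (f x)) ->
  (forall y, exists x, f x = y) -> isomorphic X Y.
Proof.
move=> B0 flin fB Bf fsurj.
pose T : {linear X -> Y} := HB.pack f (GRing.isLinear.Build K X Y *:%R f flin).
have TB x y : f (x - y) = f x - f y by exact: (linearB T).
have [S fS] := choice fsurj.
have inj_f x y : f x = f y -> x = y.
  move=> fxy; apply/eqP; rewrite -subr_eq0; apply/eqP/nrm_eq0/le_anti.
  by rewrite nrm_ge0 andbT; have := Bf (x - y); rewrite TB fxy subrr nrm0 mulr0.
exists T, S; split => //.
- by move=> x; apply: inj_f; exact: fS.
- by apply: (lipschitz_continuous B0) => x y /=; rewrite -TB.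
- by apply: (lipschitz_continuous B0) => x y; have := Bf (S x - S y); rewrite TB !fS.
Qed.

Lemma coordinates_truncation (X : completeNormedModType K) (e : nat -> X) c C x N : coordinates e c C ->
  nrm (\sum_(n < N) c n x *: e n) <= C * nrm x.
Proof.
move=> [_ _ _ _ [_ cC]]; have := cC (iota 0 N) (fun=> 1) x (iota_uniq _ _).
under eq_bigr do rewrite mul1r.
rewrite -(big_mkord xpredT (fun n => c n x *: e n)) /index_iota subn0.
by apply => n; rewrite modulus1.
Qed.

(** The map with the same coordinates in both spaces. It is onto because the two-sided estimate
    turns the expansion of a point of [Y] into a Cauchy sequence of [X]. *)
Lemma iso_of_coordinates (X : completeNormedModType K) (Y : normedModType K)
    (e : nat -> X) (c : nat -> X -> K) (C B : R) (de : nat -> Y) (pi : nat -> Y -> K) :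
  coordinates e c C -> 0 <= B ->
  (forall n a x y, pi n (a *: x + y) = a * pi n x + pi n y) ->
  (forall y, tends (fun N => \sum_(n < N) pi n y *: de n) y) ->
  (forall N (a : nat -> K),
     nrm (\sum_(n < N) a n *: e n) <= B * nrm (\sum_(n < N) a n *: de n)) ->
  (forall N (a : nat -> K),
     nrm (\sum_(n < N) a n *: de n) <= B * nrm (\sum_(n < N) a n *: e n)) ->
  (forall x, exists y, forall n, pi n y = c n x) ->
  isomorphic X Y.
Proof.
move=> hc B0 pilin piy eB deB mem; have [C0 e0 cx clin [csum cC]] := hc.
have [T hT] := choice mem.
have pi_inj y y' : (forall n, pi n y = pi n y') -> y = y'.
  move=> h; apply: (tends_unique (piy y)).
  by under [X in tends X]eq_fun do under eq_bigr do rewrite h; exact: piy.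
have lim_le (Z W : normedModType K) (u : nat -> Z) z (v : nat -> W) w D : 0 <= D ->
    tends u z -> tends v w -> (forall n, nrm (u n) <= D * nrm (v n)) -> nrm z <= D * nrm w.
  move=> D0 uz vw uv; apply/ler_addgt0Pl => eps eps0.
  have D1 : 0 < D + 1 by rewrite ltr_wpDl.
  have d0 : 0 < eps / (D + 1) by rewrite divr_gt0.
  have [N1 h1] := uz _ d0; have [N2 h2] := vw _ d0.
  have := h1 _ (leq_maxl N1 N2); have := h2 _ (leq_maxr N1 N2).
  set n := maxn N1 N2 => {}h2 {}h1; have := uv n.
  have a1 : nrm z <= eps / (D + 1) + nrm (u n).
    by rewrite (le_trans (nrm_le_split z (u n)))// nrmBC lerD2r.
  have a2 : nrm (v n) <= eps / (D + 1) + nrm w.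
    by rewrite (le_trans (nrm_le_split (v n) w))// lerD2r.
  move=> a3; apply: le_trans a1 _; apply: le_trans (lerD (lexx _) (le_trans a3 (ler_wpM2l D0 a2))) _.
  rewrite mulrDr addrA lerD2r -[X in X + _]mul1r -mulrDl addrC mulrC divfK ?gt_eqF//.
have piT x : tends (fun N => \sum_(n < N) c n x *: de n) (T x).
  by have := piy (T x); under [X in tends X]eq_fun do under eq_bigr do rewrite hT.
apply: (@isomorphic_of_bounds X Y T (B * C + B)).
- by rewrite addr_ge0// mulr_ge0.
- move=> a x x'; apply: pi_inj => n.
  by rewrite hT clin pilin !hT.
- move=> x; apply: (tends_nrm_le (N := 0) (piT x)) => N _.
  apply: le_trans (deB N (c^~ x)) _; apply: le_trans (ler_wpM2l B0 (coordinates_truncation x N hc)) _.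
  by rewrite mulrA mulrDl lerDl mulr_ge0// nrm_ge0.
- move=> x; apply: le_trans (lim_le _ _ _ _ _ _ B B0 (cx x) (piT x) _) _.
    by move=> N; exact: (eB N (c^~ x)).
  by rewrite mulrDl lerDr !mulr_ge0// nrm_ge0.
move=> y; pose u N := \sum_(n < N) pi n y *: e n; pose v N := \sum_(n < N) pi n y *: de n.
have cut (Z : normedModType K) (g : nat -> Z) N N' : (N <= N')%N ->
    \sum_(n < N') pi n y *: g n - \sum_(n < N) pi n y *: g n =
    \sum_(n < N') (if (n < N)%N then 0 else pi n y) *: g n.
  move=> NN'; rewrite -!(big_mkord xpredT (fun n => pi n y *: g n)).
  rewrite -(big_mkord xpredT (fun n => (if (n < N)%N then 0 else pi n y) *: g n)).
  rewrite (big_cat_nat (leq0n N) NN') [RHS](big_cat_nat (leq0n N) NN') /=.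
  rewrite [X in _ = X + _]big_nat_cond [X in _ = X + _]big1 ?add0r; last first.
    by move=> n /andP[/andP[_ ->] _]; rewrite scale0r.
  rewrite addrAC subrr add0r; apply: eq_big_nat => n /andP[Nn _].
  by rewrite ltnNge Nn.
have cauchy_u : cauchy_nrm u.
  have step N N' : (N <= N')%N -> nrm (u N' - u N) <= B * nrm (v N' - v N).
    by move=> NN'; rewrite !cut//; exact: (eB N' (fun n => if (n < N)%N then 0 else pi n y)).
  move=> eps eps0; have B1 : 0 < B + 1 by rewrite ltr_wpDl.
  have [N hN] := tends_cauchy (piy y) (divr_gt0 eps0 B1); exists N.
  have main m n : (N <= m)%N -> (m <= n)%N -> nrm (u n - u m) <= eps.
    move=> Nm mn; apply: le_trans (step m n mn) _.
    have := hN n m (leq_trans Nm mn) Nm; rewrite ler_pdivlMr// mulrC; apply: le_trans.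
    by rewrite mulrDl mul1r lerDl nrm_ge0.
  move=> m n Nm Nn; have [mn|/ltnW nm] := leqP m n; last exact: main.
  by rewrite nrmBC; exact: main.
have [x ux] := tends_complete cauchy_u.
exists x; apply: pi_inj => n; rewrite hT.
have cB a b : c n (a - b) = c n a - c n b.
  by rewrite addrC -scaleN1r clin mulN1r addrC.
have ne : 0 < nrm (e n) by rewrite nrm_gt0.
apply/eqP; rewrite -subr_eq0; apply/eqP/modulus_eq0/le_anti; rewrite modulus_ge0 andbT.
rewrite -(pmulr_lle0 _ ne); apply/ler_addgt0Pl => eps eps0; rewrite addr0.
have C1 : 0 < C + 1 by rewrite ltr_wpDl.
have [N hN] := ux _ (divr_gt0 eps0 C1).
have := hN _ (leq_maxl N n.+1); set m := maxn N n.+1 => h.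
have cu : c n (u m) = pi n y.
  rewrite /u -(big_mkord xpredT (fun n => pi n y *: e n)) csum ?iota_uniq//.
  by rewrite mem_index_iota /= leq_maxr.
rewrite -cu -cB; have := cC [:: n] (fun=> 1) (x - u m) isT.
rewrite big_seq1 mul1r nrmZ modulus1 => /(_ (fun=> lexx 1)) h'; apply: le_trans h' _.
move: h; rewrite nrmBC ler_pdivlMr// mulrC; apply: le_trans.
by rewrite mulrDl mul1r lerDl nrm_ge0.
Qed.

End Isomorphisms.

(** * The sequence spaces with a power norm *)

Section LpSpace.
Context (R : realType) (k : scalar_kind) (p : R) (hp : 1 <= p).
Local Notation K := (scalars R k).
Local Notation "t %:K" := (@of_real R k t) (at level 2, format "t %:K").
Let Y : normedModType K := lp k hp.

Lemma nrm_lpE (a : lp k hp) : ((nrm (a : Y))%:E = lpnorm p a)%E.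
Proof.
rewrite -[RHS]fineK ?lpnorm_fin_num//; congr EFin; apply: (@of_real_inj R k).
by rewrite nrmE.
Qed.
Let p0 : 0 < p. Proof. exact: lt_le_trans ltr01 hp. Qed.

Lemma lp_power_sum (a : lp k hp) :
  ((nrm (a : Y) `^ p)%:E = \sum_(0 <= n <oo) (modulus (a n) `^ p)%:E)%E.
Proof.
rewrite -poweR_EFin nrm_lpE lpnormE// -poweRrM mulVf ?gt_eqF// poweRe1//.
by apply: nneseries_ge0 => n _ _; rewrite lee_fin powR_ge0.
Qed.

Let term (a : nat -> K) n : (0 <= (modulus (a n) `^ p)%:E)%E.
Proof. by rewrite lee_fin powR_ge0. Qed.

Lemma eseries_le (a : nat -> K) (B : R) : (forall N, \sum_(n < N) modulus (a n) `^ p <= B) ->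
  (\sum_(0 <= n <oo) (modulus (a n) `^ p)%:E <= B%:E)%E.
Proof.
move=> h; apply: lime_le; first by apply: is_cvg_nneseries => n _ _; exact: term.
by apply: nearW => N; rewrite sumEFin big_mkord lee_fin.
Qed.

Lemma lp_mem (a : nat -> K) (B : R) : (forall N, \sum_(n < N) modulus (a n) `^ p <= B) ->
  a \in lp_finite hp.
Proof.
move=> /eseries_le h; apply/lp_finiteP; rewrite lpnormE//.
by apply: poweR_lty; exact: le_lt_trans h (ltry _).
Qed.

Lemma lp_partial (a : lp k hp) N : \sum_(n < N) modulus (a n) `^ p <= nrm (a : Y) `^ p.
Proof.
rewrite -lee_fin lp_power_sum -sumEFin -(big_mkord xpredT (fun n => (modulus (a n) `^ p)%:E)).
by apply: nneseries_lim_ge => n _ _; exact: term.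
Qed.

Lemma lp_norm_finite (a : lp k hp) N : (forall n, (N <= n)%N -> a n = 0) ->
  nrm (a : Y) `^ p = \sum_(n < N) modulus (a n) `^ p.
Proof.
move=> aN; apply: EFin_inj; rewrite lp_power_sum.
rewrite (nneseries_split 0 N); last by move=> n _; exact: term.
rewrite !add0n eseries0 ?adde0; last first.
  by move=> n Nn _; rewrite aN// modulus0 powR0 ?gt_eqF.
by rewrite sumEFin big_mkord.
Qed.

Lemma lp_unit_mem j : (fun n => (n == j)%:R : K) \in lp_finite hp.
Proof.
apply: (@lp_mem _ 1) => N; have [jN|Nj] := ltnP j N; last first.
  rewrite big1 ?ler01// => n _; have -> : (n == j :> nat) = false.
    by apply/negbTE/eqP => nj; move: (leq_trans (ltn_ord n) Nj); rewrite nj ltnn.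
  by rewrite modulus0 powR0 ?gt_eqF.
rewrite (bigD1 (Ordinal jN))//= eqxx modulus1 one_powR big1 ?addr0// => n.
by rewrite -val_eqE /= => /negbTE ->; rewrite modulus0 powR0 ?gt_eqF.
Qed.

Definition lp_unit j : lp k hp := Lp (lp_unit_mem j).

Lemma lp_eval_linear n (a : K) (x y : lp k hp) : (a *: x + y) n = a * x n + y n.
Proof. by []. Qed.

Lemma lp_sumE (s : seq nat) (a : nat -> K) m :
  (\sum_(n <- s) a n *: lp_unit n) m = \sum_(n <- s | n == m) a n.
Proof.
elim: s => [|n s ih]; first by rewrite !big_nil.
rewrite !big_cons lp_eval_linear ih /= eq_sym.
by case: eqP; rewrite ?mulr1// mulr0 add0r.
Qed.

Lemma lp_sum_ord N (a : nat -> K) m :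
  (\sum_(n < N) a n *: lp_unit n) m = if (m < N)%N then a m else 0.
Proof.
rewrite -(big_mkord xpredT (fun n => a n *: lp_unit n)) lp_sumE; case: ifPn => [mN|].
  rewrite -big_filter filter_pred1_uniq ?iota_uniq ?big_seq1// mem_index_iota; exact: mN.
rewrite -leqNgt => Nm; rewrite big_seq_cond big1// => n.
by rewrite mem_index_iota => /andP[/andP[_ nN] /eqP nm]; lia.
Qed.

Lemma lp_like_unit N (a : nat -> K) :
  nrm (\sum_(n < N) a n *: lp_unit n : Y) `^ p = \sum_(n < N) modulus (a n) `^ p.
Proof.
rewrite (@lp_norm_finite _ N) => [|n Nn]; last by rewrite lp_sum_ord ltnNge Nn.
by apply: eq_bigr => n _; rewrite lp_sum_ord ltn_ord.
Qed.

(** The tail of a convergent series of positive terms is estimated through partial sums only. *)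
Lemma lp_tends (y : lp k hp) : tends (fun N => \sum_(n < N) y n *: lp_unit n : Y) y.
Proof.
have [s sE] : exists s, s = nrm (y : Y) `^ p by eexists.
have approx (eps : R) : 0 < eps -> exists N, s - eps <= \sum_(n < N) modulus (y n) `^ p.
  move=> eps0; apply: contrapT => /forallNP no.
  have := @eseries_le y (s - eps); rewrite -lp_power_sum -sE lee_fin => h.
  have : s <= s - eps by apply: h => N; have /negP := no N; rewrite -ltNge => /ltW.
  by rewrite lerBrDl -lerBrDr subrr leNgt eps0.
have dist N : nrm ((\sum_(n < N) y n *: lp_unit n : Y) - y) `^ p <=
    s - \sum_(n < N) modulus (y n) `^ p.
  rewrite -lee_fin lp_power_sum; apply: eseries_le => M.
  have ev m : modulus (((\sum_(n < N) y n *: lp_unit n : lp k hp) - y) m) `^ p =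
      if (m < N)%N then 0 else modulus (y m) `^ p.
    rewrite -[(_ - y) m]/((\sum_(n < N) y n *: lp_unit n : lp k hp) m - y m) lp_sum_ord.
    by case: ifP => _; rewrite ?subrr ?modulus0 ?powR0 ?gt_eqF// sub0r modulusN.
  rewrite lerBrDl sE; apply: le_trans (lp_partial y (N + M)).
  rewrite -!(big_mkord xpredT (fun n => modulus (y n) `^ p)).
  rewrite (big_cat_nat (leq0n N) (leq_addr M N)) lerD2l.
  rewrite -(big_mkord xpredT (fun n => modulus (((\sum_(n < N) y n *: lp_unit n : lp k hp) - y) n) `^ p)).
  rewrite (eq_bigr _ (fun m _ => ev m)).
  apply: (@le_trans _ _ (\sum_(0 <= m < N + M) (if (m < N)%N then 0 else modulus (y m) `^ p))).
    rewrite [leRHS](big_cat_nat (leq0n M) (leq_addl N M)) lerDl sumr_ge0// => m _.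
    by case: ifP => _; rewrite ?powR_ge0.
  rewrite (big_cat_nat (leq0n N) (leq_addr M N)) /=.
  rewrite big_nat_cond big1 ?add0r; last by move=> m /andP[/andP[_ ->]].
  by apply: ler_sum_nat => m /andP[Nm _]; rewrite ltnNge Nm.
move=> eps eps0; have [N hN] := approx _ (powR_gt0 p eps0).
exists N => n Nn; rewrite leNgt; apply/negP => h.
have /lt_geF : eps `^ p < nrm ((\sum_(i < n) y i *: lp_unit i : Y) - y) `^ p.
  by rewrite gt0_ltr_powR// ?nnegrE ?nrm_ge0 ?ltW.
suff -> : nrm ((\sum_(i < n) y i *: lp_unit i : Y) - y) `^ p <= eps `^ p by [].
apply: le_trans (dist n) _; rewrite lerBlDr -lerBlDl; apply: le_trans hN _.
by rewrite -!(big_mkord xpredT (fun n => modulus (y n) `^ p)) (big_cat_nat (leq0n N) Nn) /= lerDl sumr_ge0// => i _; rewrite powR_ge0.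
Qed.

End LpSpace.

(** * Null sequences, and bases transported from the models *)

Section NullSequences.
Context (R : realType) (k : scalar_kind).
Local Notation K := (scalars R k).
Local Notation "t %:K" := (@of_real R k t) (at level 2, format "t %:K").
Let Y : normedModType K := c0 R k.

Lemma nrm_c0E (a : c0 R k) : nrm (a : Y) = sup (range (fun n => modulus (a n))).
Proof. by apply: (@of_real_inj R k); rewrite nrmE. Qed.

Lemma c0_entry_le (a : c0 R k) n : modulus (a n) <= nrm (a : Y).
Proof. by rewrite nrm_c0E c0_norm_ub. Qed.

Lemma c0_nrm_le (a : c0 R k) t : (forall n, modulus (a n) <= t) -> nrm (a : Y) <= t.
Proof.
by move=> h; rewrite nrm_c0E; apply: ge_sup => [|_ [n _ <-]//]; have [] := c0_has_sup a.
Qed.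

Lemma c0_memP (a : nat -> K) : a \in @c0_null R k <->
  forall eps : R, 0 < eps -> exists N, forall n, (N <= n)%N -> modulus (a n) <= eps.
Proof.
split=> [/c0_nullP/cvgrPdist_le h eps eps0|h].
  have [N _ hN] := h eps eps0; exists N => n Nn; have /= := hN n Nn.
  by rewrite sub0r normrN ger0_norm ?modulus_ge0.
apply/c0_nullP/cvgrPdist_le => eps /h[N hN]; exists N => // n /= Nn.
by rewrite sub0r normrN ger0_norm ?modulus_ge0// hN.
Qed.

Lemma c0_unit_mem j : (fun n => (n == j)%:R : K) \in @c0_null R k.
Proof.
apply/c0_memP => eps eps0; exists j.+1 => n jn.
by rewrite gtn_eqF// modulus0 ltW.
Qed.

Definition c0_unit j : c0 R k := C0 (c0_unit_mem j).

Lemma c0_eval_linear n (a : K) (x y : c0 R k) : (a *: x + y) n = a * x n + y n.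
Proof. by []. Qed.

Lemma c0_sum_ord N (a : nat -> K) m :
  (\sum_(n < N) a n *: c0_unit n) m = if (m < N)%N then a m else 0.
Proof.
have ev (s : seq nat) : (\sum_(n <- s) a n *: c0_unit n) m = \sum_(n <- s | n == m) a n.
  elim: s => [|n s ih]; first by rewrite !big_nil.
  rewrite !big_cons c0_eval_linear ih /= eq_sym.
  by case: eqP; rewrite ?mulr1// mulr0 add0r.
rewrite -(big_mkord xpredT (fun n => a n *: c0_unit n)) ev; case: ifPn => [mN|].
  rewrite -big_filter filter_pred1_uniq ?iota_uniq ?big_seq1// mem_index_iota; exact: mN.
rewrite -leqNgt => Nm; rewrite big_seq_cond big1// => n.
by rewrite mem_index_iota => /andP[/andP[_ nN] /eqP nm]; lia.
Qed.

Lemma c0_tends (y : c0 R k) : tends (fun N => \sum_(n < N) y n *: c0_unit n : Y) y.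
Proof.
move=> eps eps0; have /c0_memP/(_ eps eps0)[N hN] := valP y.
exists N => n Nn; apply: c0_nrm_le => m.
rewrite -[(_ - y) m]/((\sum_(i < n) y i *: c0_unit i : c0 R k) m - y m) c0_sum_ord.
by case: ltnP => nm; rewrite ?subrr ?modulus0 ?(ltW eps0)// sub0r modulusN hN// (leq_trans Nn).
Qed.

Lemma c0_sum_le N (a : nat -> K) t : 0 <= t -> (forall n, (n < N)%N -> modulus (a n) <= t) ->
  nrm (\sum_(n < N) a n *: c0_unit n : Y) <= t.
Proof.
move=> t0 h; apply: c0_nrm_le => m; rewrite c0_sum_ord.
by case: ltnP => [/h|]//; rewrite modulus0.
Qed.

Lemma c0_sum_ge N (a : nat -> K) n : (n < N)%N ->
  modulus (a n) <= nrm (\sum_(n < N) a n *: c0_unit n : Y).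
Proof.
move=> nN; have := c0_entry_le (\sum_(n < N) a n *: c0_unit n) n.
by rewrite c0_sum_ord nN.
Qed.

End NullSequences.

Section ModelBases.
Context (R : realType) (k : scalar_kind).
Local Notation K := (scalars R k).
Local Notation "t %:K" := (@of_real R k t) (at level 2, format "t %:K").
Context (X : completeNormedModType K).

Lemma sum_seq_ord (V : nmodType) (s : seq nat) N (G : nat -> V) : uniq s ->
  (forall n, n \in s -> (n < N)%N) ->
  \sum_(n <- s) G n = \sum_(n < N) (if (n : nat) \in s then G n else 0).
Proof.
move=> us sN; rewrite -(big_mkord xpredT (fun n => if n \in s then G n else 0)).
rewrite -big_mkcond -big_filter; apply: perm_big; apply: uniq_perm => //.
  by rewrite filter_uniq ?iota_uniq.
move=> n; rewrite mem_filter mem_index_iota /=.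
by case: (boolP (n \in s)) => // /sN.
Qed.

Lemma seq_bound (s : seq nat) : exists N, forall n, n \in s -> (n < N)%N.
Proof. by exists (\max_(i <- s) i).+1 => n ns; rewrite ltnS leq_bigmax_seq. Qed.

(** The basis vectors are the images of the unit vectors under the inverse isomorphism. *)
Lemma isomorphic_model (Y : normedModType K) (de : nat -> Y) (pi : nat -> Y -> K) :
  (forall y, tends (fun N => \sum_(n < N) pi n y *: de n) y) ->
  isomorphic X Y ->
  exists (e : nat -> X) (B : R), [/\ 1 <= B, dense_span e,
    (forall N (a : nat -> K),
      nrm (\sum_(n < N) a n *: e n) <= B * nrm (\sum_(n < N) a n *: de n)) &
    (forall N (a : nat -> K),
      nrm (\sum_(n < N) a n *: de n) <= B * nrm (\sum_(n < N) a n *: e n))].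
Proof.
move=> piy [T [S [TK SK Tc Sc]]].
have Slin a x y : S (a *: x + y) = a *: S x + S y.
  by rewrite -[RHS]TK linearP !SK.
have S0 : S 0 = 0 by rewrite -(linear0 T) TK.
have SZ a x : S (a *: x) = a *: S x by have := Slin a x 0; rewrite S0 !addr0.
have TZ (a : K) x : T (a *: x) = a *: T x by rewrite linearZ.
have [B1 B10 hB1] := continuous_bounded TZ Tc.
have [B2 B20 hB2] := continuous_bounded SZ Sc.
have Ssum (a : nat -> K) N : S (\sum_(n < N) a n *: de n) = \sum_(n < N) a n *: S (de n).
  elim: N => [|N ih]; first by rewrite !big_ord0 S0.
  by rewrite !big_ord_recr /= addrC Slin ih addrC.
exists (S \o de), (1 + B1 + B2); split.
- by rewrite -addrA lerDl addr_ge0.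
- move=> x eps eps0; have B21 : 0 < B2 + 1 by rewrite ltr_wpDl.
  have [N hN] := piy (T x) _ (divr_gt0 eps0 B21).
  exists (iota 0 N), (fun n => pi n (T x)); move: (hN N (leqnn N)).
  rewrite -[X in iota _ X]subn0 -[iota _ _]/(index_iota 0 N) big_mkord ler_pdivlMr// mulrC => h.
  rewrite -(Ssum (fun n => pi n (T x))).
  have -> z : x - S z = S (- 1 *: z + T x) by rewrite Slin scaleN1r TK addrC.
  rewrite scaleN1r addrC; apply: le_trans (hB2 _) _; rewrite nrmBC; apply: le_trans h.
  by rewrite ler_wpM2r ?nrm_ge0// lerDl.
- move=> N a; rewrite -(Ssum a); apply: le_trans (hB2 _) _.
  by rewrite ler_wpM2r ?nrm_ge0// lerDr addr_ge0.
move=> N a; rewrite -(Ssum a) -[X in nrm X <= _]SK; apply: le_trans (hB1 _) _.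
by rewrite ler_wpM2r ?nrm_ge0// addrAC lerDr addr_ge0.
Qed.

Definition sup_like (e : nat -> X) M := c0_like e M /\
  forall s a i, uniq s -> i \in s -> modulus (a i) <= M * nrm (\sum_(j <- s) a j *: e j).

Lemma lp_model p (hp : 1 <= p) : isomorphic X (lp k hp : normedModType K) ->
  exists (e : nat -> X) (M : R), [/\ 1 <= M, dense_span e & lp_like e p M].
Proof.
move=> /(@isomorphic_model (lp k hp) (@lp_unit R k p hp) (fun n y => y n) (@lp_tends R k p hp))[e [B [B1 de eB Be]]].
have p0 : 0 < p by exact: lt_le_trans ltr01 hp.
have B0 : 0 <= B by exact: le_trans ler01 B1.
exists e, (B `^ p); split => // [|s a us].
  by apply: le_trans (ge0_ler_powR (ltW p0) _ _ B1); rewrite ?powR1 ?nnegrE.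
have [N sN] := seq_bound s; pose b n := if n \in s then a n else 0.
have -> : \sum_(n <- s) a n *: e n = \sum_(n < N) b n *: e n.
  rewrite (sum_seq_ord _ us sN); apply: eq_bigr => n _; rewrite /b.
  by case: ifP => //; rewrite scale0r.
have -> : \sum_(n <- s) modulus (a n) `^ p = \sum_(n < N) modulus (b n) `^ p.
  rewrite (sum_seq_ord _ us sN); apply: eq_bigr => n _; rewrite /b.
  by case: ifP => //; rewrite modulus0 powR0 ?gt_eqF.
rewrite -(lp_like_unit hp); split; rewrite -powRM ?nrm_ge0// ge0_ler_powR ?nnegrE ?mulr_ge0 ?nrm_ge0// ?ltW//.
Qed.

Lemma c0_model : isomorphic X (c0 R k : normedModType K) ->
  exists (e : nat -> X) (M : R), [/\ 1 <= M, dense_span e & sup_like e M].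
Proof.
move=> /(@isomorphic_model (c0 R k) (@c0_unit R k) (fun n y => y n) (@c0_tends R k))[e [B [B1 de eB Be]]].
have B0 : 0 <= B by exact: le_trans ler01 B1.
have ext s a : uniq s -> exists N (b : nat -> K), [/\ forall n, n \in s -> (n < N)%N,
    b = (fun n => if n \in s then a n else 0) &
    \sum_(n <- s) a n *: e n = \sum_(n < N) b n *: e n].
  move=> us; have [N sN] := seq_bound s; exists N, (fun n => if n \in s then a n else 0).
  split=> //; rewrite (sum_seq_ord _ us sN); apply: eq_bigr => n _.
  by case: ifP => //; rewrite scale0r.
exists e, B; split=> //; split=> [s a t us h t0|s a i us si].
  have [N [b [_ bE ->]]] := ext s a us; apply: le_trans (eB _ _) _.
  rewrite ler_wpM2l//; apply: c0_sum_le => // n _; rewrite bE.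
  by case: ifP => [/h|]; rewrite ?modulus0.
have [N [b [sN bE ->]]] := ext s a us; apply: le_trans (Be _ _).
by have := c0_sum_ge b (sN _ si); rewrite {1}bE si.
Qed.

Lemma powR_root_le (p M u v : R) : 0 < p -> 0 <= M -> 0 <= u -> 0 <= v ->
  u `^ p <= M * v `^ p -> u <= M `^ p^-1 * v.
Proof.
move=> p0 M0 u0 v0 h.
have pr x : 0 <= x -> (x `^ p) `^ p^-1 = x :> R.
  by move=> x0; rewrite -powRrM divff ?gt_eqF// powRr1.
have := @ge0_ler_powR _ p^-1 _ _ _ _ _ h.
rewrite !nnegrE powRM ?mulr_ge0 ?powR_ge0// !pr// invr_ge0; apply=> //.
exact: ltW.
Qed.

Lemma lp_like_unc (e : nat -> X) p M : 0 < p -> 1 <= M -> lp_like e p M ->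
  unc e ((M * M) `^ p^-1).
Proof.
move=> p0 M1 h; split=> [|s a th us th1]; first exact: powR_ge0.
have M0 : 0 <= M by exact: le_trans ler01 M1.
apply: powR_root_le; rewrite ?mulr_ge0 ?nrm_ge0//.
have [h1 _] := h s (fun i => th i * a i) us; have [_ h2] := h s a us.
apply: le_trans h1 _; rewrite -mulrA ler_wpM2l//; apply: le_trans h2.
apply: ler_sum => i _; apply: ge0_ler_powR; rewrite ?nnegrE ?modulus_ge0//; first exact: ltW.
by rewrite modulusM ler_piMl ?modulus_ge0.
Qed.

Lemma lp_like_ge (e : nat -> X) p M i : lp_like e p M -> 1 <= M * nrm (e i) `^ p.
Proof.
by move=> /(_ [:: i] (fun=> 1) isT)[_]; rewrite !big_seq1 modulus1 powR1 scale1r.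
Qed.

Lemma sup_like_unc (e : nat -> X) M : 0 <= M -> sup_like e M -> unc e (M * M).
Proof.
move=> M0 [h1 h2]; split=> [|s a th us th1]; first exact: mulr_ge0.
rewrite -mulrA; apply: h1 => // [i si|]; last by rewrite mulr_ge0// nrm_ge0.
by apply: le_trans (h2 s a i us si); rewrite modulusM ler_piMl ?modulus_ge0.
Qed.

End ModelBases.

(** * Stable spaces are isomorphic to a model *)

Section Classification.
Context (R : realType) (k : scalar_kind).
Local Notation K := (scalars R k).
Local Notation "t %:K" := (@of_real R k t) (at level 2, format "t %:K").
Context (X : completeNormedModType K).

Lemma coordinates_iso_lp (e : nat -> X) c C p (hp : 1 <= p) M : 0 <= M ->
  coordinates e c C -> lp_like e p M -> isomorphic X (lp k hp : normedModType K).
Proof.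
move=> M0 hc h; have p0 : 0 < p by exact: lt_le_trans ltr01 hp.
have C0 : 0 <= C by have [] := hc.
have h1 N (a : nat -> K) : nrm (\sum_(n < N) a n *: e n) `^ p <= M * \sum_(n < N) modulus (a n) `^ p.
  have [+ _] := h (index_iota 0 N) a (iota_uniq _ _).
  by rewrite !big_mkord.
have h2 N (a : nat -> K) : \sum_(n < N) modulus (a n) `^ p <= M * nrm (\sum_(n < N) a n *: e n) `^ p.
  have [_] := h (index_iota 0 N) a (iota_uniq _ _).
  by rewrite !big_mkord.
apply: (@iso_of_coordinates R k X (lp k hp) e c C (M `^ p^-1) (@lp_unit R k p hp)
  (fun n y => y n) hc).
- exact: powR_ge0.
- by [].
- exact: lp_tends.
- move=> N a; apply: powR_root_le; rewrite ?nrm_ge0//.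
  by rewrite lp_like_unit.
- move=> N a; apply: powR_root_le; rewrite ?nrm_ge0//.
  by rewrite lp_like_unit.
move=> x; have mem : (fun n => c n x) \in lp_finite hp.
  apply: (@lp_mem _ _ _ _ _ (M * (C * nrm x) `^ p)) => N.
  apply: le_trans (h2 N (c^~ x)) _; rewrite ler_wpM2l//.
  apply: ge0_ler_powR; rewrite ?nnegrE ?mulr_ge0 ?nrm_ge0 ?(ltW p0)//.
  exact: coordinates_truncation hc.
by exists (Lp mem).
Qed.

Lemma coordinates_iso_c0 (e : nat -> X) c C M : 0 <= M -> (forall n, nrm (e n) = 1) ->
  coordinates e c C -> c0_like e M -> isomorphic X (c0 R k : normedModType K).
Proof.
move=> M0 e1 hc h; have C0 : 0 <= C by have [] := hc.
have ue := coordinates_unc hc.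
have lower N (a : nat -> K) n : (n < N)%N -> modulus (a n) <= C * nrm (\sum_(n < N) a n *: e n).
  move=> nN; have nI : n \in index_iota 0 N by rewrite mem_index_iota.
  have := unc_coordinate a ue (iota_uniq _ _) nI.
  by rewrite big_mkord e1 mulr1.
apply: (@iso_of_coordinates R k X (c0 R k) e c C (M + C) (@c0_unit R k) (fun n y => y n) hc).
- exact: addr_ge0.
- by [].
- exact: c0_tends.
- move=> N a; rewrite -(big_mkord xpredT (fun n => a n *: e n)).
  have h' n : n \in index_iota 0 N -> modulus (a n) <= nrm (\sum_(n < N) a n *: c0_unit R k n).
    by rewrite mem_index_iota => /andP[_ nN]; exact: c0_sum_ge.
  apply: le_trans (h _ _ _ (iota_uniq _ _) h' (nrm_ge0 _)) _.
  by rewrite ler_wpM2r ?nrm_ge0// lerDl.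
- move=> N a; apply: c0_sum_le => [|n nN]; first by rewrite mulr_ge0 ?addr_ge0 ?nrm_ge0.
  by apply: le_trans (lower N a n nN) _; rewrite ler_wpM2r ?nrm_ge0// lerDr.
move=> x; have mem : (fun n => c n x) \in @c0_null R k.
  apply/c0_memP => eps eps0; have [_ _ cx _ _] := hc.
  have [N hN] := tends_cauchy (cx x) eps0; exists N => n Nn.
  have := hN n.+1 n (leqW Nn) Nn; rewrite big_ord_recr /= addrAC subrr add0r nrmZ e1 mulr1.
  exact.
by exists (Defs.C0 mem).
Qed.

(** By [perfectly_homogeneous_power] a normalized basis has power growth, hence is equivalent to
    the unit vectors of a sequence space; [stable_exponent] excludes the finite exponents other
    than 1 and 2. *)
Lemma stable_isomorphic (e : nat -> X) : stable X -> unconditional_basis e ->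
  [\/ isomorphic X (ell1 R k), isomorphic X (ell2 R k) | isomorphic X (c0 R k)].
Proof.
move=> st fb; have [c0 [C0 [_ f0 _ _ _]]] := basis_coordinates fb.
have eb := normalize_basis fb; have e1 n := nrm_normalize (f0 n).
have [c [C hc]] := basis_coordinates eb; have ue := coordinates_unc hc.
have [al [t [/andP[al0 al1] t1 ht]]] := perfectly_homogeneous_power st eb e1.
move: al0; rewrite le_eqVlt => /predU1P[al0|al0].
  rewrite -al0 in ht; have [M M0 hM] := sum_power_c0_like ue t1 ht.
  by apply: Or33; exact: coordinates_iso_c0 hc hM.
have al01 : 0 < al <= 1 by rewrite al0.
have [M M0 hM] := sum_power_lp_like st eb e1 ue al01 t1 ht.
have : 1 <= al^-1 by rewrite invf_ge1.
rewrite le_eqVlt => /predU1P[p1|p1].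
  by rewrite -p1 in hM; apply: Or31; exact: coordinates_iso_lp hc hM.
have hM1 : lp_like (normalize e) al^-1 (M + 1).
  move=> s a us; have [h1 h2] := hM s a us; split.
    apply: le_trans h1 _; rewrite ler_wpM2r ?lerDl// sumr_ge0// => i _; exact: powR_ge0.
  by apply: le_trans h2 _; rewrite ler_wpM2r ?lerDl ?powR_ge0.
have p2 : al^-1 = 2 by apply: stable_exponent st eb p1 _ hM1; rewrite lerDr.
by rewrite p2 in hM; apply: Or32; exact: coordinates_iso_lp hc hM.
Qed.

End Classification.

(** * Square functions of families of projections *)

Section SquareFunctions.
Context (R : realType) (k : scalar_kind).
Local Notation K := (scalars R k).
Local Notation "t %:K" := (@of_real R k t) (at level 2, format "t %:K").

Lemma cauchy_schwarz n (a b : nat -> K) :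
  \sum_(i < n) modulus (a i) * modulus (b i) <= Num.sqrt (sqsum n a) * Num.sqrt (sqsum n b).
Proof.
elim: n => [|n ih]; first by rewrite big_ord0 mulr_ge0 ?sqrtr_ge0.
have sS (d : nat -> K) : sqsum n.+1 d = sqsum n d + modulus (d n) ^+ 2.
  by rewrite /sqsum big_ord_recr.
rewrite big_ord_recr /= !sS.
set A := sqsum n a; set B := sqsum n b; set x := modulus (a n); set y := modulus (b n).
have A0 : 0 <= A by exact: sqsum_ge0.
have B0 : 0 <= B by exact: sqsum_ge0.
have [x0 y0] : 0 <= x /\ 0 <= y by split; exact: modulus_ge0.
apply: le_trans (lerD ih (lexx (x * y))) _.
rewrite -(sqrtrM _ (addr_ge0 A0 (sqr_ge0 x))).
have := sqr_sqrtr A0; have := sqr_sqrtr B0.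
have := sqrtr_ge0 A; have := sqrtr_ge0 B.
move: (Num.sqrt A) (Num.sqrt B) => u v v0 u0 <- <-.
have L0 : 0 <= u * v + x * y by rewrite addr_ge0 ?mulr_ge0.
rewrite -(ger0_norm L0) -sqrtr_sqr; apply: ler_wsqrtr.
have : 0 <= (u * y - v * x) ^+ 2 by exact: sqr_ge0.
by move: x y u v {x0 y0 u0 v0 L0} => x y u v; nra.
Qed.

Context (X : completeNormedModType K).

Lemma nrm_cvg (u : nat -> X) x : tends u x -> (fun n => nrm (u n)) @ \oo --> nrm x.
Proof.
move=> ux; apply/cvgrPdist_le => eps /ux[N hN]; exists N => // n /hN h /=.
apply: le_trans h; rewrite ler_norml; apply/andP; split.
  by rewrite lerNl opprB lerBlDr nrm_le_split.
by rewrite lerBlDr nrmBC nrm_le_split.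
Qed.

Lemma cvg_sum_seq I (s : seq I) (f : I -> nat -> R) (l : I -> R) :
  (forall i, f i @ \oo --> l i) ->
  (fun n => \sum_(i <- s) f i n) @ \oo --> \sum_(i <- s) l i.
Proof.
move=> h; elim: s => [|i s ih].
  by rewrite big_nil; under eq_fun do rewrite big_nil; exact: cvg_cst.
by rewrite big_cons; under eq_fun do rewrite big_cons; exact: cvgD.
Qed.

Lemma sum_nrm_le_lim n (u : nat -> nat -> X) (x : nat -> X) (D : R) :
  (forall i, tends (u i) (x i)) -> (forall m, \sum_(i < n) nrm (u i m) <= D) ->
  \sum_(i < n) nrm (x i) <= D.
Proof.
move=> ux h; have := @cvg_sum_seq _ (index_enum 'I_n) _ _ (fun i : 'I_n => nrm_cvg (ux i)).
move=> /ler_cvg_to /(_ (@cvg_cst _ D _ _ _)); apply.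
by apply: nearW => m; exact: h.
Qed.

Lemma sum_sqr_le_lim I (s : seq I) (u : I -> nat -> X) (x : I -> X) (D : R) :
  (forall i, tends (u i) (x i)) -> (forall m, \sum_(i <- s) nrm (u i m) ^+ 2 <= D) ->
  \sum_(i <- s) nrm (x i) ^+ 2 <= D.
Proof.
move=> ux h; have cv i : (fun m => nrm (u i m) ^+ 2) @ \oo --> nrm (x i) ^+ 2.
  by rewrite expr2; under eq_fun do rewrite expr2; apply: cvgM; exact: nrm_cvg.
have := @cvg_sum_seq _ s _ _ cv.
move=> /ler_cvg_to /(_ (@cvg_cst _ D _ _ _)); apply.
by apply: nearW => m; exact: h.
Qed.

Context (e : nat -> X) (c : nat -> X -> K) (C : R) (hc : coordinates e c C).
Let C0 : 0 <= C. Proof. by have [] := hc. Qed.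
Let Q J x := \sum_(j < J) c j x *: e j.
Let Q_tends x : tends (Q^~ x) x. Proof. by have [_ _ h _ _] := hc; exact: h. Qed.

Lemma coordinates_sum n I (s : seq I) (a : I -> K) (x : I -> X) :
  c n (\sum_(i <- s) a i *: x i) = \sum_(i <- s) a i * c n (x i).
Proof.
have [_ _ _ lin _] := hc; have c00 : c n 0 = 0.
  by have := lin n (-1) 0 0; rewrite scaler0 addr0 mulN1r addNr.
elim: s => [|i s ih]; first by rewrite !big_nil.
by rewrite !big_cons lin ih.
Qed.

Section Hilbertian.
Context (M : R).
Hypothesis M0 : 0 <= M.
Hypothesis sqr_le : forall J (a : nat -> K),
  nrm (\sum_(j < J) a j *: e j) ^+ 2 <= M * \sum_(j < J) modulus (a j) ^+ 2.
Hypothesis sqr_ge : forall J (a : nat -> K),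
  \sum_(j < J) modulus (a j) ^+ 2 <= M * nrm (\sum_(j < J) a j *: e j) ^+ 2.

(** Orthogonality of the signs, one coordinate at a time. *)
Lemma avg_coordinates n J (x : nat -> X) :
  avg (fun w : signs n => \sum_(j < J) modulus (c j (\sum_(i < n) (rad R w i)%:K *: x i)) ^+ 2) =
  \sum_(i < n) \sum_(j < J) modulus (c j (x i)) ^+ 2.
Proof.
rewrite avg_sum exchange_big /=; apply: eq_bigr => j _.
rewrite -[RHS]/(sqsum n (fun i => c j (x i))) -rsum_sqr.
by apply: eq_avg => w; rewrite coordinates_sum.
Qed.

Let truncation_sqr J x : nrm (Q J x) ^+ 2 <= C ^+ 2 * nrm x ^+ 2.
Proof.
rewrite -exprMn; apply: lerXn2r; [exact: nrm_ge0|exact: mulr_ge0 C0 (nrm_ge0 _)|].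
exact: coordinates_truncation hc.
Qed.

(** Truncation to [J] coordinates reduces to [avg_coordinates]; then [J] tends to infinity. *)
Lemma avg_sqr_le n (x : nat -> X) :
  avg (fun w : signs n => nrm (\sum_(i < n) (rad R w i)%:K *: x i) ^+ 2) <=
  M * (M * (C ^+ 2 * \sum_(i < n) nrm (x i) ^+ 2)).
Proof.
rewrite /avg ler_pdivrMl ?ltr0n ?expn_gt0//.
pose y (w : signs n) := \sum_(i < n) (rad R w i)%:K *: x i.
apply: (@sum_sqr_le_lim _ _ (fun w J => Q J (y w)) y) => [w|J]; first exact: Q_tends.
rewrite -ler_pdivrMl ?ltr0n ?expn_gt0// -[leLHS]/(avg (fun w => nrm (Q J (y w)) ^+ 2)).
apply: le_trans (avg_le (fun w => sqr_le J (fun j => c j (y w)))) _.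
rewrite avgZ avg_coordinates ler_wpM2l// !mulr_sumr; apply: ler_sum => i _.
apply: le_trans (sqr_ge J (fun j => c j (x i))) _; apply: ler_wpM2l => //; exact: truncation_sqr.
Qed.

Lemma avg_sqr_ge n (x : nat -> X) :
  \sum_(i < n) nrm (x i) ^+ 2 <=
  M * (M * (C ^+ 2 * avg (fun w : signs n => nrm (\sum_(i < n) (rad R w i)%:K *: x i) ^+ 2))).
Proof.
pose y (w : signs n) := \sum_(i < n) (rad R w i)%:K *: x i.
apply: (@sum_sqr_le_lim _ _ (fun (i : 'I_n) J => Q J (x i)) x) => [i|J]; first exact: Q_tends.
apply: (@le_trans _ _ (\sum_(i < n) M * \sum_(j < J) modulus (c j (x i)) ^+ 2)).
  by apply: ler_sum => i _; exact: (sqr_le J (fun j => c j (x i))).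
rewrite -mulr_sumr ler_wpM2l// -avg_coordinates -!avgZ.
apply: avg_le => w; apply: le_trans (sqr_ge J (fun j => c j (y w))) _.
by apply: ler_wpM2l => //; exact: truncation_sqr.
Qed.

End Hilbertian.

Section SignedFamily.
Context (n : nat) (T : nat -> X -> X) (U : R).
Hypothesis U0 : 0 <= U.
Hypothesis T_linear : forall i a x y, T i (a *: x + y) = a *: T i x + T i y.
Hypothesis T_bounded : forall i x, (i < n)%N -> nrm (T i x) <= U * nrm x.
Hypothesis T_signs : forall (w : signs n) x,
  nrm (\sum_(i < n) (rad R w i)%:K *: T i x) <= U * nrm x.

Lemma signed_sum i y (w : signs n) :
  rsum (fun l => c i (T l y)) w = c i (\sum_(l < n) (rad R w l)%:K *: T l y).
Proof. by rewrite coordinates_sum. Qed.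

Lemma family_truncation l J x :
  T l (Q J x) = \sum_(j < J) c j x *: T l (e j).
Proof.
have T0 : T l 0 = 0 by have := T_linear l (-1) 0 0; rewrite scaler0 addr0 scaleN1r addNr.
rewrite /Q; elim: J => [|J ih]; first by rewrite !big_ord0.
by rewrite !big_ord_recr /= addrC T_linear ih addrC.
Qed.

Lemma family_tends l x (u : nat -> X) : (l < n)%N -> tends u x -> tends (T l \o u) (T l x).
Proof.
move=> ln ux eps eps0; have U1 : 0 < U + 1 by rewrite ltr_wpDl.
have [N hN] := ux _ (divr_gt0 eps0 U1); exists N => m /hN; rewrite ler_pdivlMr// mulrC => h.
have -> : T l (u m) - T l x = T l (u m - x).
  by rewrite addrC -scaleN1r -T_linear scaleN1r addrC.
apply: le_trans (T_bounded _ ln) _; apply: le_trans h.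
by rewrite ler_wpM2r ?nrm_ge0// lerDl.
Qed.

Lemma cs_entries i j (x : nat -> X) :
  \sum_(l < n) modulus (c i (T l (e j))) * modulus (c j (x l)) <=
  Num.sqrt (sqsum n (fun l => c i (T l (e j)))) * Num.sqrt (sqsum n (fun l => c j (x l))).
Proof. exact: (cauchy_schwarz n (fun l => c i (T l (e j))) (fun l => c j (x l))). Qed.

Section Summable.
Context (M : R).
Hypothesis M0 : 0 <= M.
Hypothesis sum_le : forall J (a : nat -> K), nrm (\sum_(j < J) a j *: e j) <= M * \sum_(j < J) modulus (a j).
Hypothesis sum_ge : forall J (a : nat -> K), \sum_(j < J) modulus (a j) <= M * nrm (\sum_(j < J) a j *: e j).

(** For each choice of signs the norm of the signed sum is bounded; averaging and
    [khintchine_L1] turn the moduli of its coordinates into square functions. *)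
Lemma square_function_le I y :
  \sum_(i < I) Num.sqrt (sqsum n (fun l => c i (T l y))) <= 26 * (M * (C * (U * nrm y))).
Proof.
apply: (@le_trans _ _ (\sum_(i < I) 26 * avg (fun w : signs n =>
    modulus (rsum (fun l => c i (T l y)) w)))).
  by apply: ler_sum => i _; exact: khintchine_L1.
rewrite -mulr_sumr ler_wpM2l// -(avg_sum (index_enum 'I_I)) -[leRHS](avg_cst n).
apply: avg_le => w; under eq_bigr do rewrite signed_sum.
apply: le_trans (sum_ge I (fun i => c i _)) _; rewrite ler_wpM2l//.
by apply: le_trans (coordinates_truncation _ _ hc) _; rewrite ler_wpM2l.
Qed.

(** Writing [T l x] as [T l (T l x)] exposes products of the entries [c i (T l (e j))] and
    [c j (T l x)]. Summed over [l] they are separated by [cauchy_schwarz] into two square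
    functions: the columns of the matrices, and the one of [x]. *)
Lemma summable_family x : (forall l, (l < n)%N -> T l (T l x) = T l x) ->
  \sum_(l < n) nrm (T l x) <= M * (26 * (M * (C * (U * M)))) * (26 * (M * (C * (U * nrm x)))).
Proof.
move=> TT; set B := 26 * (M * (C * (U * M))).
have B0 : 0 <= B by rewrite !mulr_ge0.
have eM j : nrm (e j) <= M.
  have := sum_le j.+1 (fun i => (i == j)%:R).
  rewrite (bigD1 ord_max)//= eqxx scale1r big1 ?addr0; last first.
    by move=> i; rewrite -val_eqE /= => /negbTE ->; rewrite scale0r.
  rewrite (bigD1 ord_max)//= eqxx modulus1 big1 ?addr0 ?mulr1// => i.
  by rewrite -val_eqE /= => /negbTE ->; rewrite modulus0.
have main I J : \sum_(l < n) nrm (Q I (T l (Q J (T l x)))) <=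
    M * B * (26 * (M * (C * (U * nrm x)))).
  apply: (@le_trans _ _ (\sum_(l < n) M * \sum_(i < I) modulus (c i (T l (Q J (T l x)))))).
    by apply: ler_sum => l _; exact: (sum_le I (fun i => c i _)).
  rewrite -mulr_sumr -mulrA ler_wpM2l//.
  apply: (@le_trans _ _ (\sum_(l < n) \sum_(i < I) \sum_(j < J)
      modulus (c i (T l (e j))) * modulus (c j (T l x)))).
    apply: ler_sum => l _; apply: ler_sum => i _.
    rewrite family_truncation coordinates_sum; apply: le_trans (modulus_sum _ _ _) _.
    by apply: ler_sum => j _; rewrite modulusM mulrC.
  rewrite exchange_big /=; under eq_bigr do rewrite exchange_big /=.
  rewrite exchange_big /=.
  apply: (@le_trans _ _ (\sum_(j < J) B * Num.sqrt (sqsum n (fun l => c j (T l x))))); last first.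
    by rewrite -mulr_sumr ler_wpM2l// square_function_le.
  apply: ler_sum => j _; apply: (@le_trans _ _ (\sum_(i < I)
      Num.sqrt (sqsum n (fun l => c i (T l (e j)))) * Num.sqrt (sqsum n (fun l => c j (T l x))))).
    by apply: ler_sum => i _; exact: cs_entries (T^~ x).
  rewrite -mulr_suml ler_wpM2r ?sqrtr_ge0//; apply: le_trans (square_function_le _ _) _.
  by rewrite /B !ler_wpM2l.
have step J : \sum_(l < n) nrm (T l (Q J (T l x))) <= M * B * (26 * (M * (C * (U * nrm x)))).
  apply: (@sum_nrm_le_lim n (fun l I => Q I (T l (Q J (T l x)))) (fun l => T l (Q J (T l x)))).
    by move=> l; exact: Q_tends.
  by move=> I; exact: main.
have -> : \sum_(l < n) nrm (T l x) = \sum_(l < n) nrm (T l (T l x)).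
  by apply: eq_bigr => l _; rewrite TT.
pose u l J := if (l < n)%N then T l (Q J (T l x)) else 0.
pose v l := if (l < n)%N then T l (T l x) else 0.
have -> : \sum_(l < n) nrm (T l (T l x)) = \sum_(l < n) nrm (v l).
  by apply: eq_bigr => l _; rewrite /v ltn_ord.
apply: (@sum_nrm_le_lim n u v) => [l|J].
  rewrite /u /v; case: ifP => ln; last exact: tends_cst.
  exact: (family_tends ln (Q_tends (T l x))).
by under eq_bigr do rewrite /u ltn_ord; exact: step.
Qed.

End Summable.
Section Supremum.
Context (M : R).
Hypothesis M0 : 0 <= M.
Hypothesis sup_le : forall J (a : nat -> K) t, 0 <= t ->
  (forall j, (j < J)%N -> modulus (a j) <= t) -> nrm (\sum_(j < J) a j *: e j) <= M * t.
Hypothesis sup_ge : forall J (a : nat -> K) j, (j < J)%N ->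
  modulus (a j) <= M * nrm (\sum_(j < J) a j *: e j).

Lemma coordinate_le i x : modulus (c i x) <= M * (C * nrm x).
Proof.
apply: le_trans (@sup_ge i.+1 (fun j => c j x) i _) _ => //.
by rewrite ler_wpM2l//; exact: coordinates_truncation hc.
Qed.

Lemma family_sum (w : signs n) J (a : nat -> K) :
  \sum_(l < n) (rad R w l)%:K *: T l (\sum_(j < J) a j *: e j) =
  \sum_(j < J) a j *: \sum_(l < n) (rad R w l)%:K *: T l (e j).
Proof.
have T0 l : T l 0 = 0 by have := T_linear l (-1) 0 0; rewrite scaler0 addr0 scaleN1r addNr.
have TS l : T l (\sum_(j < J) a j *: e j) = \sum_(j < J) a j *: T l (e j).
  elim: J => [|J ih]; first by rewrite !big_ord0.
  by rewrite !big_ord_recr /= addrC T_linear ih addrC.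
under eq_bigr do rewrite TS scaler_sumr; rewrite exchange_big /=.
apply: eq_bigr => j _; rewrite scaler_sumr; apply: eq_bigr => l _.
by rewrite !scalerA mulrC.
Qed.

(** Dual to [square_function_le]: the functional [c i] is tested on combinations of the basis
    vectors with unimodular coefficients. *)
Lemma row_square_function_le i J :
  \sum_(j < J) Num.sqrt (sqsum n (fun l => c i (T l (e j)))) <= 26 * (M * (C * (U * M))).
Proof.
apply: (@le_trans _ _ (\sum_(j < J) 26 * avg (fun w : signs n =>
    modulus (rsum (fun l => c i (T l (e j))) w)))).
  by apply: ler_sum => j _; exact: khintchine_L1.
rewrite -mulr_sumr ler_wpM2l// -(avg_sum (index_enum 'I_J)) -[leRHS](avg_cst n).
apply: avg_le => w; under eq_bigr do rewrite signed_sum.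
pose z j := c i (\sum_(l < n) (rad R w l)%:K *: T l (e j)).
have ex j : exists u, modulus u = 1 /\ z j = (modulus (z j))%:K * u.
  by have [u u1 zu] := of_real_modulus_sign (z j); exists u.
have [th hth] := choice ex.
have th1 j : modulus (th j) = 1 by have [] := hth j.
have zE j : (th j)^-1 * z j = (modulus (z j))%:K.
  have [t1 {1}->] := hth j; rewrite mulrC -mulrA mulfV ?mulr1//.
  by apply/eqP => t0; move: t1; rewrite t0 modulus0 => /eqP; rewrite eq_sym oner_eq0.
have -> : \sum_(j < J) modulus (z j) =
    modulus (c i (\sum_(l < n) (rad R w l)%:K *: T l (\sum_(j < J) (th j)^-1 *: e j))).
  rewrite (family_sum w J (fun j => (th j)^-1)) coordinates_sum; under [in RHS]eq_bigr do rewrite zE.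
  by rewrite -of_real_sum modulus_of_real ger0_norm// sumr_ge0// => j _; exact: modulus_ge0.
apply: le_trans (coordinate_le _ _) _; rewrite !ler_wpM2l//.
apply: le_trans (T_signs _ _) _; rewrite ler_wpM2l// -[leRHS]mulr1.
by apply: (sup_le (a := fun j => (th j)^-1)) => // j _; rewrite modulusV th1 invr1.
Qed.

(** With [x l = T l (T l (x l))], each coordinate of the sum involves products of two matrix
    entries; [cauchy_schwarz] in [l] separates them into square functions of two rows. *)
Lemma supremum_family x t : 0 <= t -> (forall l, (l < n)%N -> T l (T l (x l)) = x l) ->
  (forall l, (l < n)%N -> nrm (x l) <= t) ->
  nrm (\sum_(l < n) x l) <=
    M * ((26 * (M * (C * (U * M)))) * ((26 * (M * (C * (U * M)))) * (M * (C * t)))).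
Proof.
move=> t0 TT xt; set B := 26 * (M * (C * (U * M))).
have B0 : 0 <= B by rewrite !mulr_ge0.
set D := leRHS.
have main I J L : nrm (Q I (\sum_(l < n) T l (Q J (T l (Q L (x l)))))) <= D.
  apply: (sup_le (a := fun i => c i _)) => [|i _]; first by rewrite !mulr_ge0.
  have -> : c i (\sum_(l < n) T l (Q J (T l (Q L (x l))))) =
      \sum_(l < n) \sum_(m < J) \sum_(j < L) c i (T l (e m)) * c m (T l (e j)) * c j (x l).
    have := coordinates_sum i (index_enum 'I_n) (fun=> 1) (fun l => T l (Q J (T l (Q L (x l))))).
    under eq_bigr do rewrite scale1r; move=> ->; apply: eq_bigr => l _; rewrite mul1r.
    rewrite family_truncation coordinates_sum; apply: eq_bigr => m _.
    rewrite family_truncation coordinates_sum mulr_suml; apply: eq_bigr => j _.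
    by rewrite mulrC [c j (x l) * _]mulrC mulrA.
  apply: le_trans (modulus_sum _ _ _) _.
  apply: (@le_trans _ _ (\sum_(l < n) \sum_(m < J) \sum_(j < L)
      modulus (c i (T l (e m))) * modulus (c m (T l (e j))) * (M * (C * t)))).
    apply: ler_sum => l _; apply: le_trans (modulus_sum _ _ _) _; apply: ler_sum => m _.
    apply: le_trans (modulus_sum _ _ _) _; apply: ler_sum => j _; rewrite !modulusM.
    rewrite ler_wpM2l ?mulr_ge0 ?modulus_ge0//; apply: le_trans (coordinate_le _ _) _.
    by rewrite !ler_wpM2l// xt.
  rewrite exchange_big /=; under eq_bigr do rewrite exchange_big /=.
  apply: (@le_trans _ _ (\sum_(m < J) \sum_(j < L)
      Num.sqrt (sqsum n (fun l => c i (T l (e m)))) *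
      (Num.sqrt (sqsum n (fun l => c m (T l (e j)))) * (M * (C * t))))).
    apply: ler_sum => m _; apply: ler_sum => j _.
    rewrite -mulr_suml [leRHS]mulrA ler_wpM2r ?mulr_ge0//.
    exact: (cauchy_schwarz n (fun l => c i (T l (e m))) (fun l => c m (T l (e j)))).
  apply: (@le_trans _ _ (\sum_(m < J)
      Num.sqrt (sqsum n (fun l => c i (T l (e m)))) * (B * (M * (C * t))))).
    apply: ler_sum => m _; rewrite -mulr_sumr ler_wpM2l ?sqrtr_ge0//.
    by rewrite -mulr_suml ler_wpM2r ?mulr_ge0// row_square_function_le.
  by rewrite -mulr_suml ler_wpM2r ?mulr_ge0// row_square_function_le.
have step1 J L : nrm (\sum_(l < n) T l (Q J (T l (Q L (x l))))) <= D.
  by apply: (tends_nrm_le (N := 0) (Q_tends _)) => I _; exact: main.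
have step2 J : nrm (\sum_(l < n) T l (Q J (T l (x l)))) <= D.
  apply: (tends_nrm_le (N := 0) (u := fun L => \sum_(l < n) T l (Q J (T l (Q L (x l)))))) => [|L _].
    apply: (@tends_sum _ _ _ _ _ (fun (l : 'I_n) L => T l (Q J (T l (Q L (x l)))))) => l.
    have h := family_tends (ltn_ord l) (Q_tends (x l)).
    have Qt : tends (fun L => Q J (T l (Q L (x l)))) (Q J (T l (x l))).
      move=> eps eps0; have C1 : 0 < C + 1 by rewrite ltr_wpDl.
      have [N hN] := h _ (divr_gt0 eps0 C1); exists N => m /hN; rewrite ler_pdivlMr// mulrC => {}h.
      have -> : Q J (T l (Q m (x l))) - Q J (T l (x l)) = Q J (T l (Q m (x l)) - T l (x l)).
        rewrite /Q -sumrB; apply: eq_bigr => j _; rewrite -scalerBl; congr (_ *: _).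
        have [_ _ _ lin _] := hc.
        have cB a b : c j (a - b) = c j a - c j b by rewrite addrC -scaleN1r lin mulN1r addrC.
        by rewrite cB.
      apply: le_trans (coordinates_truncation _ _ hc) _; apply: le_trans h.
      by rewrite ler_wpM2r ?nrm_ge0// lerDl.
    exact: family_tends (ltn_ord l) Qt.
  exact: step1.
apply: (tends_nrm_le (N := 0) (u := fun J => \sum_(l < n) T l (Q J (T l (x l))))) => [|J _].
  apply: (@tends_sum _ _ _ _ _ (fun (l : 'I_n) J => T l (Q J (T l (x l))))) => l.
  by rewrite -[X in tends _ X]TT//; exact: family_tends (ltn_ord l) (Q_tends (T l (x l))).
exact: step2.
Qed.

End Supremum.
End SignedFamily.
End SquareFunctions.

(** * Domination in decompositions of the models *)

Section Domination.
Context (R : realType) (k : scalar_kind).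
Local Notation K := (scalars R k).
Local Notation "t %:K" := (@of_real R k t) (at level 2, format "t %:K").
Context (X : completeNormedModType K).

(** A substitute for a lattice norm: the vectors may be changed in each block independently. *)
Definition dominated (E : nat -> set X) (D : R) := 0 <= D /\
  forall (s : seq nat) (x y : nat -> X), uniq s ->
    (forall n, E n (x n)) -> (forall n, E n (y n)) ->
    (forall n, n \in s -> nrm (x n) <= nrm (y n)) ->
    nrm (\sum_(n <- s) x n) <= D * nrm (\sum_(n <- s) y n).

Section Projections.
Context (E : nat -> set X) (P : nat -> X -> X) (U : R) (hP : bounded_projections E P U).
Context (s : seq nat) (us : uniq s).
Let T i := P (nth 0%N s i).
Let n := size s.

Lemma projection_le m x : nrm (P m x) <= U * nrm x.
Proof.
have [_ _ _ _ [_ h]] := hP; have := h [:: m] (fun=> 1) x isT.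
by rewrite big_seq1 scale1r; apply => ?; rewrite modulus1.
Qed.

Lemma projection_sum (x : nat -> X) m : (forall i, E i (x i)) ->
  P m (\sum_(i <- s) x i) = if m \in s then x m else 0.
Proof. by have [_ _ _ _ [h _]] := hP; exact: h. Qed.

Lemma projection_id m x : E m x -> P m x = x.
Proof.
move=> Ex; have [_ EP _ _ [h _]] := hP.
have := h [:: m] (fun i => if i == m then x else P i 0) m isT.
rewrite big_seq1 eqxx mem_seq1 eqxx; apply=> i.
by case: eqP => [->|].
Qed.

Lemma signed_projections (w : signs n) x :
  nrm (\sum_(i < n) (rad R w i)%:K *: T i x) <= U * nrm x.
Proof.
have [_ _ _ _ [_ h]] := hP; have := h s (fun m => (rad R w (index m s))%:K) x us.
rewrite (big_nth 0%N) big_mkord.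
have -> : \sum_(i < n) (rad R w i)%:K *: T i x =
    \sum_(i < size s) (rad R w (index (nth 0%N s i) s))%:K *: P (nth 0%N s i) x.
  by apply: eq_bigr => i _; rewrite index_uniq.
apply=> m; rewrite modulus_of_real.
by rewrite -(@ler_pXn2r _ 2)// ?nnegrE// expr1n real_normK ?num_real// expr2 rad_sqr.
Qed.

End Projections.

(** Both sums are comparable with the sum of the norms of their components. *)
Lemma dominated_summable (e : nat -> X) c C M E : 0 <= M -> coordinates e c C ->
  lp_like e 1 M -> UFDD E -> exists D, dominated E D.
Proof.
move=> M0 hc h hE; have [P [U hP]] := UFDD_projections hE.
have C0 : 0 <= C by have [] := hc.
have U0 : 0 <= U by have [] := hP.
have EP m x : E m (P m x) by have [_ h' _ _ _] := hP.
have Plin m a x y : P m (a *: x + y) = a *: P m x + P m y by have [_ _ _ h' _] := hP.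
have hle J (a : nat -> K) : nrm (\sum_(j < J) a j *: e j) <= M * \sum_(j < J) modulus (a j).
  have [+ _] := h (index_iota 0 J) a (iota_uniq _ _).
  rewrite !big_mkord powRr1 ?nrm_ge0//.
  by under [X in _ * X]eq_bigr do rewrite powRr1 ?modulus_ge0//.
have hge J (a : nat -> K) : \sum_(j < J) modulus (a j) <= M * nrm (\sum_(j < J) a j *: e j).
  have [_] := h (index_iota 0 J) a (iota_uniq _ _).
  rewrite !big_mkord powRr1 ?nrm_ge0//.
  by under eq_bigr do rewrite powRr1 ?modulus_ge0//.
exists (M * (26 * (M * (C * (U * M)))) * (26 * (M * (C * U)))); split; first by rewrite !mulr_ge0.
move=> s x y us Ex Ey xy; apply: le_trans (nrm_sum _ _ _) _.
have PP m z : P m (P m z) = P m z by exact: (projection_id hP (EP m z)).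
have := @summable_family R k X e c C hc (size s) (fun i => P (nth 0%N s i)) U U0
  (fun i => Plin (nth 0%N s i)) (fun i z _ => projection_le hP (nth 0%N s i) z)
  (signed_projections hP us) M M0 hle hge (\sum_(m <- s) y m) (fun l _ => PP _ _).
rewrite (sum_ord_nth s (fun m => nrm (P m (\sum_(m <- s) y m)))) !mulrA.
apply: le_trans; rewrite [leLHS]big_seq [leRHS]big_seq; apply: ler_sum => m ms.
by rewrite (projection_sum hP us)// ms xy.
Qed.

(** Changing signs is harmless in both sums, and the average over signs of the square of the norm
    is comparable with the sum of the squares of the norms of the components. *)
Lemma dominated_hilbert (e : nat -> X) c C M E : 0 <= M -> coordinates e c C ->
  lp_like e 2 M -> UFDD E -> exists D, dominated E D.
Proof.
move=> M0 hc h hE; have [P [U hP]] := UFDD_projections hE.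
have C0 : 0 <= C by have [] := hc.
have U0 : 0 <= U by have [] := hP.
have hle J (a : nat -> K) :
    nrm (\sum_(j < J) a j *: e j) ^+ 2 <= M * \sum_(j < J) modulus (a j) ^+ 2.
  have [+ _] := h (index_iota 0 J) a (iota_uniq _ _).
  rewrite !big_mkord powR_mulrn ?nrm_ge0//.
  by under [X in _ * X]eq_bigr do rewrite powR_mulrn ?modulus_ge0//.
have hge J (a : nat -> K) :
    \sum_(j < J) modulus (a j) ^+ 2 <= M * nrm (\sum_(j < J) a j *: e j) ^+ 2.
  have [_] := h (index_iota 0 J) a (iota_uniq _ _).
  rewrite !big_mkord powR_mulrn ?nrm_ge0//.
  by under eq_bigr do rewrite powR_mulrn ?modulus_ge0//.
have flip (s : seq nat) (z : nat -> X) (w : signs (size s)) : uniq s -> (forall m, E m (z m)) ->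
    nrm (\sum_(i < size s) (rad R w i)%:K *: z (nth 0%N s i)) <= U * nrm (\sum_(m <- s) z m) /\
    nrm (\sum_(m <- s) z m) <= U * nrm (\sum_(i < size s) (rad R w i)%:K *: z (nth 0%N s i)).
  move=> us Ez; pose r m := (rad R w (index m s))%:K.
  have rE i : (i < size s)%N -> r (nth 0%N s i) = (rad R w i)%:K by move=> im; rewrite /r index_uniq.
  have Pz m : m \in s -> P m (\sum_(m <- s) z m) = z m.
    by move=> ms; rewrite (projection_sum hP us)// ms.
  have Er m : E m (r m *: z m).
    have [_ EP _ lin _] := hP; have P0 : P m 0 = 0.
      by have := lin m (-1) 0 0; rewrite scaler0 addr0 scaleN1r addNr.
    by have := lin m (r m) (z m) 0; rewrite !addr0 P0 addr0 (projection_id hP (Ez m)) => <-.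
  have sumE : \sum_(i < size s) (rad R w i)%:K *: z (nth 0%N s i) = \sum_(m <- s) r m *: z m.
    by rewrite -(sum_ord_nth s (fun m => r m *: z m)); apply: eq_bigr => i _; rewrite rE.
  split.
    have := signed_projections hP us w (\sum_(m <- s) z m).
    suff -> : \sum_(i < size s) (rad R w i)%:K *: P (nth 0%N s i) (\sum_(m <- s) z m) =
        \sum_(i < size s) (rad R w i)%:K *: z (nth 0%N s i) by [].
    by apply: eq_bigr => i _; rewrite Pz ?mem_nth.
  rewrite sumE; have := signed_projections hP us w (\sum_(m <- s) r m *: z m).
  suff -> : \sum_(i < size s) (rad R w i)%:K *: P (nth 0%N s i) (\sum_(m <- s) r m *: z m) =
      \sum_(m <- s) z m by [].
  rewrite -(sum_ord_nth s z); apply: eq_bigr => i _.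
  rewrite (projection_sum hP us)// mem_nth// rE// scalerA -of_realM rad_sqr.
  by rewrite of_real1 scale1r.
pose B := M * (M * C ^+ 2); have B0 : 0 <= B by rewrite !mulr_ge0 ?sqr_ge0.
exists (U * B * U); split => [|s x y us Ex Ey xy]; first by rewrite !mulr_ge0.
have h1 : nrm (\sum_(m <- s) x m) ^+ 2 <= U ^+ 2 * (B * \sum_(m <- s) nrm (x m) ^+ 2).
  have hh : avg (fun w : signs (size s) =>
      nrm (\sum_(i < size s) (rad R w i)%:K *: x (nth 0%N s i)) ^+ 2) <=
      B * \sum_(m <- s) nrm (x m) ^+ 2.
    apply: le_trans (avg_sqr_le hc M0 hle hge (size s) (fun i => x (nth 0%N s i))) _.
    by rewrite -(sum_ord_nth s (fun m => nrm (x m) ^+ 2)) /B -!mulrA.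
  apply: le_trans (ler_wpM2l (sqr_ge0 U) hh).
  rewrite -[leLHS](avg_cst (size s)) -avgZ; apply: avg_le => w.
  rewrite -exprMn; apply: lerXn2r; [exact: nrm_ge0|exact: mulr_ge0 U0 (nrm_ge0 _)|].
  by have [] := flip s x w us Ex.
have h2 : \sum_(m <- s) nrm (y m) ^+ 2 <= B * (U ^+ 2 * nrm (\sum_(m <- s) y m) ^+ 2).
  have hh : \sum_(m <- s) nrm (y m) ^+ 2 <= B * avg (fun w : signs (size s) =>
      nrm (\sum_(i < size s) (rad R w i)%:K *: y (nth 0%N s i)) ^+ 2).
    rewrite -(sum_ord_nth s (fun m => nrm (y m) ^+ 2)).
    apply: le_trans (avg_sqr_ge hc M0 hle hge (size s) (fun i => y (nth 0%N s i))) _.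
    by rewrite /B -!mulrA.
  apply: le_trans hh _; rewrite ler_wpM2l//.
  rewrite -[leRHS](avg_cst (size s)); apply: avg_le => w.
  rewrite -exprMn; apply: lerXn2r; [exact: nrm_ge0|exact: mulr_ge0 U0 (nrm_ge0 _)|].
  by have [] := flip s y w us Ey.
have h3 : \sum_(m <- s) nrm (x m) ^+ 2 <= \sum_(m <- s) nrm (y m) ^+ 2.
  rewrite [leLHS]big_seq [leRHS]big_seq; apply: ler_sum => m ms.
  by apply: lerXn2r; [exact: nrm_ge0|exact: nrm_ge0|exact: xy].
rewrite -(@ler_pXn2r _ 2)// ?nnegrE ?mulr_ge0 ?nrm_ge0//.
apply: le_trans h1 _; apply: le_trans (ler_wpM2l (sqr_ge0 U) (ler_wpM2l B0 (le_trans h3 h2))) _.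
by rewrite le_eqVlt; apply/orP; left; apply/eqP; ring.
Qed.

(** The components of the larger sum are bounded by its norm through the projections, so the
    components of the other sum have a common bound. *)
Lemma dominated_supremum (e : nat -> X) c C M E : 0 <= M -> coordinates e c C ->
  sup_like e M -> UFDD E -> exists D, dominated E D.
Proof.
move=> M0 hc [h1 h2] hE; have [P [U hP]] := UFDD_projections hE.
have C0 : 0 <= C by have [] := hc.
have U0 : 0 <= U by have [] := hP.
have Plin m a x y : P m (a *: x + y) = a *: P m x + P m y by have [_ _ _ h' _] := hP.
have hle J (a : nat -> K) t : 0 <= t -> (forall j, (j < J)%N -> modulus (a j) <= t) ->
    nrm (\sum_(j < J) a j *: e j) <= M * t.
  move=> t0 at0; rewrite -(big_mkord xpredT (fun j => a j *: e j)).
  by apply: h1 => //; rewrite ?iota_uniq// => j; rewrite mem_index_iota => /andP[_ /at0].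
have hge J (a : nat -> K) j : (j < J)%N -> modulus (a j) <= M * nrm (\sum_(j < J) a j *: e j).
  move=> jJ; rewrite -(big_mkord xpredT (fun j => a j *: e j)).
  by apply: h2; rewrite ?iota_uniq// mem_index_iota.
pose B := 26 * (M * (C * (U * M))).
exists (M * (B * (B * (M * (C * U))))); split; first by rewrite !mulr_ge0.
move=> s x y us Ex Ey xy.
have t0 : 0 <= U * nrm (\sum_(m <- s) y m) by rewrite mulr_ge0 ?nrm_ge0.
have PP l : (l < size s)%N -> P (nth 0%N s l) (P (nth 0%N s l) (x (nth 0%N s l))) = x (nth 0%N s l).
  by move=> _; rewrite !(projection_id hP (Ex _)).
have xt l : (l < size s)%N -> nrm (x (nth 0%N s l)) <= U * nrm (\sum_(m <- s) y m).
  move=> ls; have ms := mem_nth 0%N ls; apply: le_trans (xy _ ms) _.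
  by have := projection_le hP (nth 0%N s l) (\sum_(m <- s) y m); rewrite (projection_sum hP us)// ms.
have := @supremum_family R k X e c C hc (size s) (fun i => P (nth 0%N s i)) U U0
  (fun i => Plin (nth 0%N s i)) (fun i z _ => projection_le hP (nth 0%N s i) z)
  (signed_projections hP us) M M0 hle hge (fun i => x (nth 0%N s i)) _ t0 PP xt.
by rewrite (sum_ord_nth s x) !mulrA.
Qed.

End Domination.

(** * From blocks to the whole family *)

Section Families.
Context (R : realType) (k : scalar_kind).
Local Notation K := (scalars R k).
Local Notation "t %:K" := (@of_real R k t) (at level 2, format "t %:K").
Context (X : completeNormedModType K).

(** More vectors than the dimension would allow are linearly dependent. *)
Lemma infinite_dimensional (e : nat -> X) c C m (h : 'I_m -> X) : coordinates e c C ->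
  ~ forall x, exists a : 'I_m -> K, x = \sum_i a i *: h i.
Proof.
move=> [_ _ _ _ [ce _]] span; have [A hA] := choice (fun i : 'I_m.+1 => span (e i)).
pose B : 'M[K]_(m.+1, m) := \matrix_(i, j) A i j.
have /rowV0Pn[v /sub_kermxP vB v0] : kermx B != 0.
  by rewrite -mxrank_eq0 mxrank_ker -lt0n subn_gt0 ltnS rank_leq_col.
have sum0 : \sum_(i < m.+1) v 0 i *: e i = 0.
  under eq_bigr do rewrite hA scaler_sumr; rewrite exchange_big big1// => j _ /=.
  have := congr1 (fun w : 'rV_m => w 0 j) vB; rewrite !mxE => vBj.
  under eq_bigr do rewrite scalerA; rewrite -scaler_suml.
  rewrite (_ : \sum_(i < m.+1) _ = 0) ?scale0r// -[RHS]vBj.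
  by apply: eq_bigr => i _; rewrite mxE.
case/eqP: v0; apply/rowP => i; rewrite mxE.
have := ce (index_iota 0 m.+1) (fun j => v 0 (inord j)) i (iota_uniq _ _).
rewrite big_mkord mem_index_iota ltn_ord /= inord_val => <-.
under eq_bigr do rewrite inord_val.
rewrite sum0; have := ce [::] (fun=> 0) i isT; by rewrite big_nil.
Qed.

Lemma infinite_bijection (I : countType) : ~ finite_set [set: I] ->
  exists s : nat -> I, bijective s.
Proof.
move=> infI; have /card_set_bijP[s] : ([set: I] #= [set: nat])%card.
  by rewrite card_eq_le; apply/andP; split; [exact: countableP|exact/infiniteP].
by rewrite setTT_bijective => -[s' ss' s's]; exists s', s.
Qed.

Lemma finite_basis_neq0 (E : set X) d (f : 'I_d -> X) i : finite_basis E f -> f i != 0.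
Proof.
move=> [Ef uniqf]; apply/eqP => fi0.
have zero (a : 'I_d -> K) : (forall j, j != i -> a j = 0) -> 0 = \sum_j a j *: f j.
  move=> a0; rewrite big1// => j _; have [->|/a0 ->] := eqVneq j i; first by rewrite fi0 scaler0.
  by rewrite scale0r.
have E0 : E 0 by rewrite (zero (fun=> 0))//; exact: Ef.
have [a [_ au]] := uniqf 0 E0.
have a1 : a = fun j => (j == i)%:R by apply/au/zero => j /negbTE ->.
have a2 : a = fun=> 0 by exact/au/zero.
by have := congr1 (fun b => b i) (etrans (esym a1) a2); rewrite /= eqxx => /eqP; rewrite oner_eq0.
Qed.

(** The constants [is_ubc] only concern unimodular multipliers; every multiplier of modulus at
    most 1 is controlled through indicators of sets, which are averages of signs. *)
Lemma ubc_multiplier d (f : 'I_d -> X) (B : K) : is_ubc f B ->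
  forall a th : 'I_d -> K, (forall i, modulus (th i) <= 1) ->
  nrm (\sum_i (th i * a i) *: f i) <= 4 * modulus B * nrm (\sum_i a i *: f i).
Proof.
move=> [[B0 hB] _] a th th1.
have {}hB eps : (forall i, modulus (eps i) = 1) ->
    nrm (\sum_i (eps i * a i) *: f i) <= modulus B * nrm (\sum_i a i *: f i).
  move=> e1; rewrite -(of_real_le k) of_realM modulusE !nrmE ger0_norm//.
  by apply: hB => i; rewrite -modulusE e1 of_real1.
under eq_bigr do rewrite -scalerA; rewrite -mulrA; apply: nrm_multiplier => //.
  exact: index_enum_uniq.
move=> m; have -> : \sum_(i | m i) a i *: f i = (2^-1)%:K *: (\sum_i (1 * a i) *: f i +
    \sum_i ((if m i then 1 else -1) * a i) *: f i).
  rewrite -big_split /= scaler_sumr big_mkcond /=; apply: eq_bigr => i _.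
  have two : (2^-1)%:K * (1 + 1) = 1 :> K.
    by rewrite -of_real1 -of_realD -of_realM mulVf// pnatr_eq0.
  rewrite -scalerDl -mulrDl scalerA; case: ifP => _; last by rewrite subrr mul0r mulr0 scale0r.
  by rewrite mulrA two mul1r.
rewrite nrmZr ger0_norm ?invr_ge0// ler_pdivrMl//; apply: le_trans (nrmD _ _) _.
have h1 := hB (fun=> 1) (fun=> modulus1 R k).
have h2 : nrm (\sum_i ((if m i then 1 else -1) * a i) *: f i) <=
    modulus B * nrm (\sum_i a i *: f i).
  by apply: hB => i; case: ifP => _; rewrite ?modulusN modulus1.
by apply: le_trans (lerD h1 h2) _; rewrite mulr_natl mulr2n.
Qed.

Lemma sum_tagged (V : nmodType) (d : nat -> nat) (F : {n : nat & 'I_(d n)} -> V)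
    (s : seq {n : nat & 'I_(d n)}) (ns : seq nat) : uniq s -> uniq ns ->
  (forall t, t \in s -> tag t \in ns) ->
  \sum_(t <- s) F t = \sum_(n <- ns) \sum_(j < d n)
    (if Tagged (fun n => 'I_(d n)) j \in s then F (Tagged (fun n => 'I_(d n)) j) else 0).
Proof.
move=> us uns sub.
pose L := [seq Tagged (fun n => 'I_(d n)) j | n <- ns, j <- index_enum 'I_(d n)].
have -> : \sum_(n <- ns) \sum_(j < d n)
    (if Tagged (fun n => 'I_(d n)) j \in s then F (Tagged (fun n => 'I_(d n)) j) else 0) =
    \sum_(t <- L) if t \in s then F t else 0 by rewrite big_allpairs_dep.
rewrite -big_mkcond -big_filter; apply: perm_big; apply: uniq_perm => //.
  rewrite filter_uniq// allpairs_uniq_dep// => [n _|]; first exact: index_enum_uniq.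
  by move=> [n j] [n' j'] /= _ _ h; exact: h.
move=> t; rewrite mem_filter; case: (boolP (t \in s)) => //= ts.
apply/esym/allpairsPdep; exists (tag t), (tagged t); rewrite sub// mem_index_enum.
by split=> //; case: (t).
Qed.

(** Inside a block the multipliers act with a uniform constant, so they enlarge the norm of each
    block component by a bounded factor; domination adds up the blocks. *)
Lemma dominated_family (E : nat -> set X) (d : nat -> nat) (f : forall n, 'I_(d n) -> X)
    (u : nat -> K) (D : R) (e : nat -> X) :
  dominated E D -> UFDD E -> (forall n, finite_basis (E n) (f n)) ->
  (forall n, is_ubc (f n) (u n)) -> has_ubound (range u) -> unconditional_basis e ->
  unconditional_basis_family (fun i : {n : nat & 'I_(d n)} => f (tag i) (tagged i)).
Proof.
move=> [D0 hD] hE fb fu [B uB] eb; pose g (i : {n : nat & 'I_(d n)}) := f (tag i) (tagged i).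
have [ce [Ce hce]] := basis_coordinates eb.
have bound n : modulus (u n) <= modulus B.
  have [[un0 _] _] := fu n; have unB : u n <= B by apply: uB; exists n.
  by rewrite -(of_real_le k) !modulusE !ger0_norm// (le_trans un0).
have g0 t : g t != 0 by exact: finite_basis_neq0 (fb (tag t)).
pose A := 4 * modulus B; have A0 : 0 <= A by rewrite mulr_ge0 ?modulus_ge0.
have EZ n a x : E n x -> E n (a *: x).
  have [_ _ hZ _] := finite_dimensional_closed (ex_intro _ _ (ex_intro _ _ (fb n))); exact: hZ.
have ug : unc g (D * A).
  split=> [|s a th us th1]; first exact: mulr_ge0.
  pose ns := undup [seq tag t | t <- s].
  have sub t : t \in s -> tag t \in ns by move=> ts; rewrite mem_undup map_f.
  pose b n (j : 'I_(d n)) := let t := Tagged (fun n => 'I_(d n)) j in if t \in s then a t else 0.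
  pose x n := \sum_j (th (Tagged (fun n => 'I_(d n)) j) * b n j) *: f n j.
  pose y n := \sum_j b n j *: f n j.
  have -> : \sum_(t <- s) (th t * a t) *: g t = \sum_(n <- ns) x n.
    rewrite (sum_tagged _ us (undup_uniq _) sub); apply: eq_bigr => n _; apply: eq_bigr => j _.
    by rewrite /b; case: ifP => _; rewrite ?mulr0 ?scale0r.
  have -> : \sum_(t <- s) a t *: g t = \sum_(n <- ns) y n.
    rewrite (sum_tagged _ us (undup_uniq _) sub); apply: eq_bigr => n _; apply: eq_bigr => j _.
    by rewrite /b; case: ifP => _; rewrite ?scale0r.
  have xy n : n \in ns -> nrm (x n) <= nrm (A%:K *: y n).
    move=> _; rewrite nrmZr ger0_norm//.
    apply: le_trans (ubc_multiplier (fu n) _ _) _ => //.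
    by rewrite !ler_wpM2r ?nrm_ge0// ler_wpM2l.
  have Ex n : E n (x n) by have [h _] := fb n; exact: h.
  have Ey n : E n (A%:K *: y n) by apply: EZ; have [h _] := fb n; exact: h.
  apply: le_trans (hD ns x _ (undup_uniq _) Ex Ey xy) _.
  by rewrite -scaler_sumr nrmZr ger0_norm// mulrA.
have coef x : exists (a : {n : nat & 'I_(d n)} -> K),
    tends (fun N => \sum_(n < N) \sum_(j < d n) a (Tagged (fun n => 'I_(d n)) j) *: f n j) x.
  have [_ /(_ x)[[y [[Ey /tendsP hy] _]] _]] := hE.
  have ex n : exists a : 'I_(d n) -> K, y n = \sum_j a j *: f n j.
    by have [_ /(_ _ (Ey n))[a [ya _]]] := fb n; exists a.
  pose a n := projT1 (cid (ex n)); exists (fun t => a (tag t) (tagged t)).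
  have aE n : \sum_(j < d n) a n j *: f n j = y n by rewrite /a; case: cid.
  rewrite seriesE in hy; under [X in tends X]eq_fun do under eq_bigr do rewrite /= aE.
  exact: hy.
have flat N (a : {n : nat & 'I_(d n)} -> K) :
    \sum_(n < N) \sum_(j < d n) a (Tagged (fun n => 'I_(d n)) j) *: f n j =
    \sum_(t <- [seq Tagged (fun n => 'I_(d n)) j | n <- index_iota 0 N, j <- index_enum 'I_(d n)])
      a t *: g t.
  rewrite big_allpairs_dep.
  by rewrite -(big_mkord xpredT (fun n => \sum_(j < d n) a (Tagged (fun n => 'I_(d n)) j) *: f n j)).
have dg : dense_span g.
  move=> x eps /= eps0; have [a /(_ _ eps0)[N /(_ N (leqnn N))]] := coef x.
  by rewrite flat nrmBC; eexists; eexists; eassumption.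
(* A finite index set would make all but finitely many blocks trivial. *)
have infI : ~ finite_set [set: {n : nat & 'I_(d n)}].
  move=> /finite_seqP[s sE]; pose N := (\max_(t <- s) tag t).+1.
  have dN n : (N <= n)%N -> forall j : 'I_(d n), False.
    move=> Nn j; have : [set: {n : nat & 'I_(d n)}] (Tagged (fun n => 'I_(d n)) j) by [].
    rewrite sE /= => ts; suff : (n < N)%N by rewrite ltnNge Nn.
    rewrite ltnS -[n]/(tag (Tagged (fun n => 'I_(d n)) j)).
    exact: (@leq_bigmax_seq _ s xpredT (fun t : {n : nat & 'I_(d n)} => tag t)).
  pose L := [seq Tagged (fun n => 'I_(d n)) j | n <- index_iota 0 N, j <- index_enum 'I_(d n)].
  apply: (@infinite_dimensional e ce Ce (size L) (fun i => g (tnth (in_tuple L) i)) hce) => x.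
  have [a hx] := coef x; exists (fun i => a (tnth (in_tuple L) i)).
  rewrite -(big_tnth _ _ _ xpredT (fun t => a t *: g t)) -flat.
  apply: (tends_unique hx) => eps eps0; exists N => n Nn.
  rewrite -!(big_mkord xpredT (fun n => \sum_(j < d n) a (Tagged (fun n => 'I_(d n)) j) *: f n j)).
  rewrite (big_cat_nat (leq0n N) Nn) /= addrAC subrr add0r.
  rewrite big_nat_cond big1 ?nrm0 ?ltW// => m /andP[/andP[Nm _] _].
  by rewrite big1// => j; have := dN m Nm j.
have [s sb] := infinite_bijection infI; exists s; split=> //.
apply: (basis_criterion (C := D * A)) => [n||].
- exact: g0.
- have [s' ss' s's] := sb; exact: unc_inj (can_inj ss') ug.
move=> x eps eps0; have [l [a h]] := dg x eps eps0; have [s' ss' s's] := sb.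
exists (map s' l), (a \o s); rewrite big_map.
by under eq_bigr do rewrite /= s's.
Qed.

End Families.

(** * The models are stable *)

Section Stability.
Context (R : realType) (k : scalar_kind).
Local Notation K := (scalars R k).
Context (X : completeNormedModType K).

Lemma dominated_stable (e : nat -> X) : unconditional_basis e ->
  (forall E : nat -> set X, UFDD E -> exists D, dominated E D) -> stable X.
Proof.
move=> eb dom E d f u hE fb fu ub; have [D hD] := dom E hE.
exact: dominated_family hD hE fb fu ub eb.
Qed.

(** The images of the unit vectors give a basis equivalent to the model one; in each of the three
    cases every decomposition is dominated. *)
Lemma isomorphic_stable :
  [\/ isomorphic X (ell1 R k), isomorphic X (ell2 R k) | isomorphic X (c0 R k)] -> stable X.
Proof.
have lp_case p (hp : 1 <= p) : isomorphic X (lp k hp) -> exists e c C M,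
    [/\ 0 <= M, unconditional_basis e, @coordinates R k X e c C & lp_like e p M].
  move=> /lp_model[e [M [M1 de h]]]; have p0 : 0 < p by exact: lt_le_trans ltr01 hp.
  have e0 n : e n != 0.
    apply/eqP => en; have := lp_like_ge n h.
    by rewrite en nrm0 powR0 ?gt_eqF// mulr0 leNgt ltr01.
  have eb := basis_criterion e0 (lp_like_unc p0 M1 h) de.
  have [c [C hc]] := basis_coordinates eb; exists e, c, C, M; split=> //.
  exact: le_trans ler01 M1.
case=> [/lp_case[e [c [C [M [M0 eb hc h]]]]]|/lp_case[e [c [C [M [M0 eb hc h]]]]]|].
- by apply: (dominated_stable eb) => E; exact: dominated_summable hc h.
- by apply: (dominated_stable eb) => E; exact: dominated_hilbert hc h.
move=> /c0_model[e [M [M1 de h]]]; have M0 : 0 <= M by exact: le_trans ler01 M1.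
have e0 n : e n != 0.
  apply/eqP => en; have [_ h2] := h; have := h2 [:: n] (fun=> 1) n isT (mem_head _ _).
  by rewrite big_seq1 en scaler0 nrm0 mulr0 modulus1 leNgt ltr01.
have eb := basis_criterion e0 (sup_like_unc M0 h) de.
have [c [C hc]] := basis_coordinates eb.
by apply: (dominated_stable eb) => E; exact: dominated_supremum hc h.
Qed.

End Stability.

Theorem theorem2p4 (R : realType) (k : scalar_kind)
    (X : completeNormedModType (scalars R k))
    (hX : exists e : nat -> X, unconditional_basis e) :
  [\/ isomorphic X (ell1 R k), isomorphic X (ell2 R k) | isomorphic X (c0 R k)]
  <->
  (forall (E : nat -> set X) (d : nat -> nat) (f : forall n, 'I_(d n) -> X)
          (u : nat -> scalars R k),
     UFDD E ->
     (forall n, finite_basis (E n) (f n)) ->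
     (forall n, is_ubc (f n) (u n)) -> has_ubound (range u) ->
     unconditional_basis_family
       (fun i : {n : nat & 'I_(d n)} => f (tag i) (tagged i))).
Proof.
have [e eb] := hX; split=> [iso|st]; first exact: isomorphic_stable iso.
exact: stable_isomorphic st eb.
Qed.
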